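(* For every $\varepsilon>0$, as $H\to\infty$, \[ E_3(H) = 8\Bigl(\frac{\pi^2}{6}+\frac14\Bigr)H^2 + O_\varepsilon\bigl(H^{1.5+\varepsilon}\bigr). \]
   Context: For a real number $H>0$ and an integer $n\ge 3$, $E_n(H)$ denotes the number of integer vectors $(a_1,\dots,a_n)\in(\mathbb Z\cap[-H,H])^n$ such that the Galois group $G_f$ (the automorphism group of the splitting field over $\mathbb Q$) of $f(X)=X^n+a_1X^{n-1}+\cdots+a_{n-1}X+a_n$ is not isomorphic to the symmetric group $S_n$, where $G_f$ is regarded as a subgroup of $S_n$ via its action on the roots; inseparable polynomials are counted (their Galois group is not isomorphic to $S_n$). *)

(* Defs.v *)
From HB Require Import structures.
From mathcomp Require Import all_boot all_order all_algebra all_fingroup all_field.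
From mathcomp Require Import boolp reals trigo exp.
Set Implicit Arguments. Unset Strict Implicit. Unset Printing Implicit Defensive.
Import Order.TTheory GRing.Theory Num.Theory.
Local Open Scope ring_scope.

Definition monic_of (n : nat) (a : seq int) : {poly rat} :=
  'X^n + \sum_(i < n) ((a`_i)%:~R)%:P * 'X^(n - i.+1).

Definition gal_isog_Sn (n : nat) (f : {poly rat}) : Prop :=
  exists (L : splittingFieldType rat) (E : {subfield L}),
    splittingFieldFor 1%AS (map_poly (in_alg L) f) E /\
    ('Gal(E / 1%AS) \isog [set: 'S_n])%g.

(* E_n(H): number of a in (Z cap [-H,H])^n with Gal(f_a) not isomorphic to S_n.
   Z cap [-H,H] = {-N,...,N} with N = floor H (H > 0); the coordinate
   i : 'I_(2N+1) encodes the integer i - N. *)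
Definition E_count (R : realType) (n : nat) (H : R) : nat :=
  let N := Num.truncn H in
  #|[set a : n.-tuple 'I_(N + N).+1 |
      ~~ `[< gal_isog_Sn n (monic_of n [seq (val i)%:Z - N%:Z | i <- a]) >] ]|.

(* Main.v *)
Require Import Defs.
From HB Require Import structures.
From mathcomp Require Import all_boot all_order all_algebra all_fingroup all_field.
From mathcomp Require Import zify ring lra.
From mathcomp Require Import boolp classical_sets reals topology normedtype derive realfun trigo exp.
Set Implicit Arguments. Unset Strict Implicit. Unset Printing Implicit Defensive.
Import Order.TTheory GRing.Theory Num.Theory.
Import numFieldNormedType.Exports.
Local Open Scope ring_scope.

(** Write f = X^3 + a X^2 + b X + c and let D be its discriminant. A cubic with
    an integer root never has group S_3, and a cubic without integer root has
    group S_3 unless D is a square; two integer roots force D to be a square.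
    Hence E_3 is the sum over r of the number of f with f(r) = 0, up to an error
    O(S), where S counts the f of square discriminant.

    For fixed r, writing f = (X - r)(X^2 + p X + q) turns the first count into a
    lattice point count: 4 N^2 / r^2 + O(N / |r|) for |r| >= 2, 3 N^2 + O(N) for
    r = 1 and r = -1, 4 N^2 + O(N) for r = 0. The sum over r gives the main term
    through the Basel sum.

    To bound S, put A = a^2 - 3 b and B = 2 a^3 - 9 a b + 27 c. If D = z^2 then
    B^2 + 27 z^2 = 4 A^3, so x = (B + 3 z sqrt(-3)) / 2 is an Eisenstein integer
    of norm A^3, and therefore x = N(k) k t^3 with A = N(k) N(t). If a or b is
    O(sqrt N), there are O(N^(3/2)) pairs (a, b), and each A has N^o(1) such x.
    Otherwise the argument of x is within O(N / A) of the real axis. Fixing the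
    smaller of k and t (up to the content of t) and the dyadic size of A, the
    arguments of the possible x are separated, because Eisenstein integers that
    are not proportional have a determinant that is at least 1; this leaves
    N^(1 + o(1)) values of x. Each x comes from only O(sqrt N) values of a, by
    the identity (a - a') (9 (b + b') - (a - a')^2) = 54 (c - c') for two cubics
    with the same A and B. *)

(** * Bounding cardinalities by uniq sequences *)


(** The trivial bound for S is N^(2 + o(1)), as large as the main term: there are O(N^2) pairs (a,
    b), each with N^o(1) values of c. What beats it is the smallness of z: no pure power of a occurs
    in D, so for large a one has z = O(a N) while B is close to 2 a^3, which confines x to a thin
    sector. Counting bins in a sector costs at least one bin for each fixed factor and content,
    however thin the sector is. The smaller factor has norm times content at most sqrt A = O(N), so
    these extra bins are as cheap as the others. Arguments are replaced by rational slopes and bins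
    by floors, which keeps the bound on S in integer and rational arithmetic; N^o(1) appears as a
    bound on K-th powers by a fixed power of N, with K arbitrary. The sets live in infinite types
    and are given by arbitrary propositions, so a cardinality is bounded through all duplicate-free
    lists of elements. *)

Definition atmost (T : eqType) (P : T -> Prop) (c : nat) : Prop :=
  forall s : seq T, uniq s -> (forall x, x \in s -> P x) -> (size s <= c)%N.

Lemma atmost_sub (T : eqType) (P Q : T -> Prop) c d :
  (forall x, P x -> Q x) -> (c <= d)%N -> atmost Q c -> atmost P d.
Proof.
move=> PQ cd Qc s us sP; apply: leq_trans cd; apply: Qc => // x xs.
exact/PQ/sP.
Qed.

Lemma atmost_seq (T : eqType) (t : seq T) : atmost (fun x => x \in t) (size t).
Proof. by move=> s us st; apply: uniq_leq_size. Qed.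

Lemma atmost1 (T : eqType) (P : T -> Prop) :
  (forall x y, P x -> P y -> x = y) -> atmost P 1.
Proof.
move=> Pxy [|x [|y s]] //= /andP[xs _] sP.
by move: xs; rewrite (Pxy x y) ?inE ?eqxx //; apply: sP; rewrite !inE eqxx ?orbT.
Qed.

Lemma atmost_fiber (T U : eqType) (P : T -> Prop) (Q : U -> Prop)
    (f : T -> U) c d :
  (forall x, P x -> Q (f x)) -> atmost Q c ->
  (forall u, Q u -> atmost (fun x => P x /\ f x = u) d) -> atmost P (c * d).
Proof.
move=> PQ Qc fib s us sP.
have h0 (t : seq T) (us0 : seq U) : {subset map f t <= us0} ->
    (size t <= \sum_(u <- us0) count (fun x => f x == u) t)%N.
  elim: t => [|x t IH] sub //=; rewrite big_split /= -add1n.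
  apply: leq_add; last by apply: IH => u ut; apply: sub; rewrite inE ut orbT.
  have fx : f x \in us0 by apply: sub; rewrite inE eqxx.
  by rewrite (big_rem _ fx) /= eqxx.
apply: leq_trans (h0 s (undup (map f s)) _) _; first by move=> u; rewrite mem_undup.
have h1 : (size (undup (map f s)) <= c)%N.
  apply: Qc; first exact: undup_uniq.
  by move=> u; rewrite mem_undup => /mapP[x xs ->]; apply/PQ/sP.
apply: leq_trans (leq_mul h1 (leqnn d)).
have <- : (\sum_(u <- undup (map f s)) d = size (undup (map f s)) * d)%N.
  by rewrite big_const_seq count_predT iter_addn_0 mulnC.
rewrite big_seq_cond [X in (_ <= X)%N]big_seq_cond.
apply: leq_sum => u; rewrite andbT mem_undup => /mapP[x xs ->].
rewrite -size_filter; apply: (fib (f x)); first exact/PQ/sP.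
  exact: filter_uniq.
by move=> y; rewrite mem_filter => /andP[/eqP -> ys]; split=> //; apply: sP.
Qed.

Lemma atmost_inj (T U : eqType) (P : T -> Prop) (Q : U -> Prop) (f : T -> U) c :
  (forall x, P x -> Q (f x)) -> (forall x y, P x -> P y -> f x = f y -> x = y) ->
  atmost Q c -> atmost P c.
Proof.
move=> PQ fI Qc; rewrite -(muln1 c); apply: (atmost_fiber PQ Qc) => u _.
by apply: atmost1 => x y [Px <-] [Py /esym]; apply: fI.
Qed.

Lemma atmost_or (T : eqType) (P Q : T -> Prop) c d :
  atmost P c -> atmost Q d -> (forall x, P x \/ ~ P x) ->
  atmost (fun x => P x \/ Q x) (c + d).
Proof.
move=> Pc Qd dec s us sPQ.
suff [s1 [s2 [ps s1P s2Q]]] : exists s1 s2, [/\ perm_eq s (s1 ++ s2),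
   forall x, x \in s1 -> P x & forall x, x \in s2 -> Q x].
  have := us; rewrite (perm_uniq ps) cat_uniq => /and3P[u1 _ u2].
  by rewrite (perm_size ps) size_cat leq_add //; [apply: Pc | apply: Qd].
elim: s {us} sPQ => [|x s IH] sPQ; first by exists [::], [::].
have [y ys|s1 [s2 [ps s1P s2Q]]] := IH; first by apply: sPQ; rewrite inE ys orbT.
have [Px|nPx] := dec x.
  exists (x :: s1), s2; split=> //=; first by rewrite perm_cons.
  by move=> y; rewrite inE => /orP[/eqP ->|/s1P].
exists s1, (x :: s2); split=> //.
  have -> : s1 ++ x :: s2 = s1 ++ [:: x] ++ s2 by [].
  by rewrite perm_sym perm_catCA /= perm_cons perm_sym.
move=> y; rewrite inE => /orP[/eqP ->|/s2Q //].
by have [//|] := sPQ x (mem_head _ _).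
Qed.

(** An empty set satisfies every bound, so a reference element may be fixed before counting the
    others relative to it. *)
Lemma atmost_base (T : eqType) (P : T -> Prop) c :
  (forall x0, P x0 -> atmost P c) -> atmost P c.
Proof. by move=> Pc [|x s] us sP //; apply: (Pc x) => //; apply/sP/mem_head. Qed.

Lemma atmost_int_abs (M : nat) : atmost (fun j : int => `|j| <= M%:Z) (M + M).+1.
Proof.
apply: (@atmost_inj _ _ _ (fun i => i \in iota 0 (M + M).+1)
  (fun j => absz (j + M%:Z))).
- by move=> j; rewrite mem_iota; lia.
- by move=> j j'; lia.
by rewrite -{2}(size_iota 0 (M + M).+1); apply: atmost_seq.
Qed.

Lemma atmost_pair (T U : eqType) (P : T -> Prop) (Q : U -> Prop) c d :
  atmost P c -> atmost Q d -> atmost (fun z => P z.1 /\ Q z.2) (c * d).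
Proof.
move=> Pc Qd; apply: (@atmost_fiber _ _ _ P fst) => // [z []//|u Pu].
apply: (@atmost_inj _ _ _ Q snd) => // [z [[]]//|].
by move=> [x y] [x' y'] [_ /= ->] [_ /= ->] /= ->.
Qed.

Lemma atmost_bool : atmost (fun _ : bool => True) 2.
Proof.
by apply: (atmost_sub _ (leqnn _) (@atmost_seq _ [:: true; false])) => -[].
Qed.

(** * The divisor bound *)


Definition tau (n : nat) : nat := size (divisors n).

Lemma tau_gt0 n : (0 < tau n)%N.
Proof. by rewrite /tau; have := divisor1 n; case: divisors. Qed.

Lemma atmost_dvdn n : (0 < n)%N -> atmost (fun d => d %| n)%N (tau n).
Proof.
move=> n0; apply: (atmost_sub _ (leqnn _) (@atmost_seq _ (divisors n))) => d.
by rewrite dvdn_divisors.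
Qed.

Lemma tau_le n c : (0 < n)%N -> atmost (fun d => d %| n)%N c -> (tau n <= c)%N.
Proof.
by move=> n0; apply=> [|x]; rewrite ?divisors_uniq // -dvdn_divisors.
Qed.

(** A divisor is determined by its valuation at [p], at most [e], and its part prime to [p], which
    divides [m]. *)
Lemma tau_pM p e m : prime p -> coprime p m -> (0 < m)%N ->
  (tau (p ^ e * m) <= e.+1 * tau m)%N.
Proof.
move=> pp cpm m0; have p0 := prime_gt0 pp.
apply: tau_le; first by rewrite muln_gt0 expn_gt0 p0.
apply: (@atmost_fiber _ _ _ (fun i => i \in iota 0 e.+1) (logn p)).
- move=> d dn; rewrite mem_iota /= add0n ltnS.
  have := dvdn_leq_log p _ dn; rewrite muln_gt0 expn_gt0 p0 m0 => /(_ isT).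
  by rewrite lognM ?expn_gt0 ?p0 // pfactorK // (logn_coprime cpm) addn0.
- by rewrite -{2}(size_iota 0 e.+1); apply: atmost_seq.
move=> i _.
apply: (@atmost_inj _ _ _ _ (fun d => d %/ p ^ i)%N _ _ _ (atmost_dvdn m0)).
  move=> d [dn di].
  have d0 : (0 < d)%N by apply: dvdn_gt0 dn; rewrite muln_gt0 expn_gt0 p0.
  have [q pq dE] := pfactor_coprime pp d0.
  rewrite dE di mulnK ?expn_gt0 ?p0 //.
  have /Gauss_dvdr <- : coprime q (p ^ e) by rewrite coprime_sym coprimeXl.
  by apply: dvdn_trans dn; rewrite dE dvdn_mulr.
move=> d1 d2 [_ <-] [_ e2] h.
rewrite -(divnK (pfactor_dvdnn p d1)) h -e2.
by rewrite divnK // pfactor_dvdnn.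
Qed.

(** [e + 1 <= k (e %/ k + 1) <= k 2^(e %/ k)], raised to the power [k]. It serves for the exponents
    of small primes and again for the number of dyadic sizes. *)
Lemma succ_expn_le k e : (0 < k)%N -> (e.+1 ^ k <= k ^ k * 2 ^ e)%N.
Proof.
move=> k0; apply: (@leq_trans ((k * 2 ^ (e %/ k)) ^ k)).
  rewrite leq_exp2r //; apply: (@leq_trans (k * (e %/ k).+1)).
    by rewrite {1}(divn_eq e k) mulnS mulnC addnC -addSn leq_add2r ltn_pmod.
  by rewrite leq_mul2l ltn_expl ?orbT.
by rewrite expnMn leq_mul2l -expnM leq_exp2l // leq_trunc_div orbT.
Qed.

(* [tau n ^ k / n] is multiplicative; only the primes below [2 ^ k] contribute
   a factor exceeding 1. *)
Lemma tau_expn_aux k n B : (0 < k)%N -> (0 < n)%N ->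
  (forall p, prime p -> p %| n -> B <= p)%N ->
  (tau n ^ k <= (k ^ k) ^ (2 ^ k - B) * n)%N.
Proof.
move=> k0; elim/ltn_ind: n B => n IH B n0 nB.
have C0 : (0 < k ^ k)%N by rewrite expn_gt0 k0.
have [n1|n1] := leqP n 1.
  have -> : n = 1%N by apply/eqP; rewrite eqn_leq n1.
  by rewrite muln1 exp1n expn_gt0 C0.
set p := pdiv n; have pp : prime p by apply: pdiv_prime.
have pn : (p %| n)%N by apply: pdiv_dvd.
have [m pm nE] := pfactor_coprime pp n0; set e := logn p n in nE.
have e0 : (0 < e)%N by rewrite /e logn_gt0 mem_primes pp n0 pn.
have m0 : (0 < m)%N by move: n0; rewrite nE; case: m {pm nE}.
have mn : (m < n)%N.
  by rewrite nE -{1}(muln1 m) ltn_pmul2l // -{1}(expn0 p) ltn_exp2l // prime_gt1.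
(* All prime factors of [m] exceed [p], so the induction resumes with [p.+1] in place of [B]: each
   integer below [2 ^ k] pays the factor [k ^ k] at most once. *)
have h : (tau m ^ k <= (k ^ k) ^ (2 ^ k - p.+1) * m)%N.
  apply: IH => // q pq qm; rewrite ltn_neqAle pdiv_min_dvd ?prime_gt1 //.
    by rewrite andbT; apply: contraTneq qm => <-; rewrite -prime_coprime.
  by rewrite nE dvdn_mulr.
rewrite nE mulnC; apply: leq_trans (_ : (e.+1 * tau m) ^ k <= _)%N.
  by rewrite leq_exp2r // tau_pM.
rewrite expnMn.
have Bp : (B <= p)%N by apply: nB.
have [p2|p2] := ltnP p (2 ^ k)%N.
  apply: (@leq_trans ((k ^ k * p ^ e) * ((k ^ k) ^ (2 ^ k - p.+1) * m))).
    apply: leq_mul h; apply: leq_trans (succ_expn_le e k0) _.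
    by rewrite leq_mul2l leq_exp2r ?prime_gt1 ?orbT.
  have -> : (k ^ k * p ^ e * ((k ^ k) ^ (2 ^ k - p.+1) * m) =
    (k ^ k) ^ (2 ^ k - p) * (p ^ e * m))%N.
    have -> : (2 ^ k - p = (2 ^ k - p.+1).+1)%N by rewrite subnSK.
    by rewrite expnS; lia.
  rewrite leq_mul2r; apply/orP; right.
  by apply: leq_pexp2l => //; apply: leq_sub2l.
(* For [p >= 2 ^ k], [(e + 1) ^ k <= (2 ^ k) ^ e <= p ^ e], so no constant is lost. *)
apply: (@leq_trans (p ^ e * m)).
  apply: leq_mul.
    apply: (@leq_trans ((2 ^ e) ^ k)); first by rewrite leq_exp2r // ltn_expl.
    by rewrite -expnM mulnC expnM leq_exp2r.
  by move: h; rewrite (_ : 2 ^ k - p.+1 = 0)%N ?expn0 ?mul1n //; lia.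
by rewrite leq_pmull // expn_gt0 C0.
Qed.

Lemma tau_expn_le k : (0 < k)%N ->
  exists C, forall n, (0 < n)%N -> (tau n ^ k <= C * n)%N.
Proof.
move=> k0; exists ((k ^ k) ^ (2 ^ k))%N => n n0.
by have := @tau_expn_aux k n 0 k0 n0 (fun _ _ _ => leq0n _); rewrite subn0.
Qed.

Lemma tau_mono m n : (0 < n)%N -> (m %| n)%N -> (tau m <= tau n)%N.
Proof.
move=> n0 mn; apply: tau_le; first exact: dvdn_gt0 mn.
by apply: atmost_sub (atmost_dvdn n0) => // d dm; apply: dvdn_trans mn.
Qed.

(** * Representations by x^2 + 3 y^2 *)


Definition rep3 (n : nat) (p : int * int) : Prop :=
  p.1 ^+ 2 + 3 * p.2 ^+ 2 = n%:Z.

Lemma rep3_coprime n p : rep3 n p -> coprimez p.1 p.2 -> coprimez p.2 n%:Z.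
Proof.
case: p => x y; rewrite /rep3 /= => <- cxy.
have -> : x ^+ 2 + 3 * y ^+ 2 = (3 * y) * y + x ^+ 2 by ring.
by rewrite /coprimez gcdzMDl -/(coprimez _ _) coprimez_pexpr // coprimez_sym.
Qed.

(* With [p0 = (x, y)] fixed, [n] divides [(x y' - x' y) (x y' + x' y)] for every
   [p = (x', y')]; [d] records how [n] splits between the two factors. *)
Lemma rep3_det_dvd (n : nat) (p0 p q : int * int) (d : int) : (0 < n)%N ->
  rep3 n p0 -> coprimez p0.1 p0.2 ->
  rep3 n p -> coprimez p.1 p.2 -> rep3 n q -> coprimez q.1 q.2 ->
  gcdz n (p0.1 * p.2 - p.1 * p0.2) = d -> gcdz n (p0.1 * q.2 - q.1 * p0.2) = d ->
  (n%:Z %| 6 * (p.1 * q.2 - q.1 * p.2))%Z.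
Proof.
case: p0 p q => [x y] [x1 y1] [x2 y2] n0.
move=> r0 c0 r1 c1 r2 c2.
have cyn := rep3_coprime r0 c0; have cy1n := rep3_coprime r1 c1.
move: r0 r1 r2 cyn cy1n; rewrite /rep3 /= => r0 r1 r2 cyn cy1n g1 g2.
have d0 : d != 0 by rewrite -g1 gcdz_eq0; lia.
have dn : (d %| n%:Z)%Z by rewrite -g1 dvdz_gcdl.
have dP1 : (d %| x * y1 - x1 * y)%Z by rewrite -g1 dvdz_gcdr.
have dP2 : (d %| x * y2 - x2 * y)%Z by rewrite -g2 dvdz_gcdr.
have [e nE] := dvdzP dn.
have e0 : e != 0 by apply/eqP => e0; move: nE; rewrite e0 mul0r; lia.
have eQ z t : z ^+ 2 + 3 * t ^+ 2 = n%:Z -> gcdz n (x * t - z * y) = d ->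
    (e %| x * t + z * y)%Z.
  move=> rz gz; have [u [v uv]] := Bezoutz n%:Z (x * t - z * y).
  have : (e * d %| (x * t + z * y) * d)%Z.
    rewrite -nE -gz -uv; apply/dvdzP.
    exists (u * (x * t + z * y) + v * (t ^+ 2 - y ^+ 2)).
    have hx : x ^+ 2 = n%:Z - 3 * y ^+ 2 by rewrite -r0; ring.
    have hz : z ^+ 2 = n%:Z - 3 * t ^+ 2 by rewrite -rz; ring.
    transitivity (u * (x * t + z * y) * n%:Z +
      v * (x ^+ 2 * t ^+ 2 - z ^+ 2 * y ^+ 2)); first by ring.
    by rewrite hx hz; ring.
  by rewrite dvdz_mul2r.
have eQ1 := eQ _ _ r1 g1; have eQ2 := eQ _ _ r2 g2.
have yV m : (m %| n%:Z)%Z -> (m %| y * (x1 * y2 - x2 * y1))%Z ->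
   (m %| x1 * y2 - x2 * y1)%Z.
  move=> mn; rewrite Gauss_dvdzr // coprimez_sym.
  by move: cyn; case/dvdzP: mn => k ->; rewrite coprimezMr => /andP[].
have dV : (d %| x1 * y2 - x2 * y1)%Z.
  apply: yV => //; have -> : y * (x1 * y2 - x2 * y1) =
     (x * y2 - x2 * y) * y1 - (x * y1 - x1 * y) * y2 by ring.
  by rewrite rpredB // dvdz_mulr.
have eV : (e %| x1 * y2 - x2 * y1)%Z.
  apply: yV; first by rewrite nE dvdz_mulr.
  have -> : y * (x1 * y2 - x2 * y1) =
     (x * y1 + x1 * y) * y2 - (x * y2 + x2 * y) * y1 by ring.
  by rewrite rpredB // dvdz_mulr.
(* A common divisor of [d] and [e] divides the sum and the difference of [x y1] and [x1 y], and is
   coprime to [y] and [y1]. Hence it divides [2 x], then [6 y^2 = 2 n - 2 x^2], and finally 6. *)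
have g6 : (gcdz d e %| 6)%Z.
  set g := gcdz d e.
  have gd : (g %| d)%Z by rewrite dvdz_gcdl.
  have ge : (g %| e)%Z by rewrite dvdz_gcdr.
  have gn : (g %| n%:Z)%Z by rewrite nE dvdz_mull.
  have cg m : coprimez m n%:Z -> coprimez g m.
    by case/dvdzP: gn => k ->; rewrite coprimezMr => /andP[_]; rewrite coprimez_sym.
  have g2x : (g %| 2 * x)%Z.
    rewrite -(Gauss_dvdzl _ (cg _ cy1n)).
    have -> : 2 * x * y1 = (x * y1 + x1 * y) + (x * y1 - x1 * y) by ring.
    by rewrite rpredD //; [apply: dvdz_trans ge _ | apply: dvdz_trans gd _].
  rewrite -(Gauss_dvdzl _ (cg _ cyn)) -(Gauss_dvdzl _ (cg _ cyn)).
  have -> : 6 * y * y = 2 * n%:Z - (2 * x) * x by rewrite -r0; ring.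
  by apply: rpredB; [exact: dvdz_mull | exact: dvdz_mulr].
have [u [v uv]] := Bezoutz d e.
have gV : (n%:Z %| gcdz d e * (x1 * y2 - x2 * y1))%Z.
  rewrite -uv mulrDl; apply: rpredD.
    by rewrite nE -mulrA dvdz_mull // mulrC dvdz_mul.
  by rewrite nE -mulrA dvdz_mull // dvdz_mul.
apply: dvdz_trans gV _; exact: dvdz_mul.
Qed.

(** Within a class of fixed [d], take a second reference point [p] and put U + V sqrt(-3) = conj(p)
    q. Then U^2 + 3 V^2 = n^2 and n divides 6 V, so 6 V = j n with |j| <= 6. These 13 values and the
    sign of U determine [q], whence 26. *)
Lemma atmost_rep3_coprime n : (0 < n)%N ->
  atmost (fun p => rep3 n p /\ coprimez p.1 p.2) (tau n * 26).
Proof.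
move=> n0; apply: atmost_base => p0 [r0 c0].
apply: (@atmost_fiber _ _ _ (fun d => d %| n)%N
  (fun p => gcdn n (absz (p0.1 * p.2 - p.1 * p0.2)%R))); first by move=> *; apply: dvdn_gcdl.
  exact: atmost_dvdn.
move=> d _; apply: atmost_base => p [[r1 c1] g1].
have hn : n%:Z != 0 by lia.
have key q : rep3 n q -> coprimez q.1 q.2 ->
    gcdn n (absz (p0.1 * q.2 - q.1 * p0.2)%R) = d ->
    6 * (p.1 * q.2 - q.1 * p.2) = (6 * (p.1 * q.2 - q.1 * p.2) %/ n)%Z * n%:Z.
  move=> r2 c2 g2; rewrite divzK //.
  by apply: (rep3_det_dvd n0 r0 c0 r1 c1 r2 c2 (d := d)); rewrite /gcdz ?g1 ?g2.
have UV q : rep3 n q -> (p.1 * q.1 + 3 * p.2 * q.2) ^+ 2 +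
    3 * (p.1 * q.2 - q.1 * p.2) ^+ 2 = n%:Z ^+ 2.
  rewrite /rep3 => r2; transitivity ((p.1 ^+ 2 + 3 * p.2 ^+ 2) * (q.1 ^+ 2 + 3 * q.2 ^+ 2)).
    by ring.
  by rewrite r1 r2 expr2.
apply: (@atmost_inj _ _ _ (fun z : int * bool => `|z.1| <= 6%N%:Z /\ True)
  (fun q => ((6 * (p.1 * q.2 - q.1 * p.2) %/ n)%Z,
             0 <= p.1 * q.1 + 3 * p.2 * q.2))).
- move=> q [[r2 c2] g2]; split=> //=.
  have := key q r2 c2 g2; have := UV q r2.
  set V := _ - _; set U := p.1 * q.1 + _; set j := (_ %/ _)%Z => h1 h2.
  have V2 : `|V| <= n%:Z.
    rewrite -(@ler_pXn2r _ 2) ?nnegrE // real_normK ?num_real // -h1.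
    by move: (sqr_ge0 U) (sqr_ge0 V); lra.
  have nj : `|j| * n%:Z = 6 * `|V| by rewrite -[n%:Z]ger0_norm // -normrM -h2 normrM.
  have n1 : 0 < n%:Z by lia.
  by rewrite -(ler_pM2r n1) nj ler_pM2l.
- move=> q q' [[r2 c2] g2] [[r2' c2'] g2'] [ej eU].
  have := key q r2 c2 g2; rewrite ej -key // => /mulfI eV.
  have {}eV : p.1 * q.2 - q.1 * p.2 = p.1 * q'.2 - q'.1 * p.2 by apply: eV.
  have := UV q r2; rewrite -(UV q' r2') eV => /addIr eU2.
  have {eU2 eU} eU : p.1 * q.1 + 3 * p.2 * q.2 = p.1 * q'.1 + 3 * p.2 * q'.2.
    move/eqP: eU2; rewrite eqf_sqr => /orP[/eqP //|/eqP h].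
    move: eU; rewrite h; move: (p.1 * q'.1 + _) => W.
    by case: (leP 0 W); case: (leP 0 (- W)) => //; lia.
  rewrite (surjective_pairing q) (surjective_pairing q').
  congr pair; apply: (mulfI hn); rewrite -r1.
    transitivity (p.1 * (p.1 * q.1 + 3 * p.2 * q.2) -
       3 * p.2 * (p.1 * q.2 - q.1 * p.2)); first by ring.
    by rewrite eU eV; ring.
  transitivity (p.2 * (p.1 * q.1 + 3 * p.2 * q.2) +
       p.1 * (p.1 * q.2 - q.1 * p.2)); first by ring.
  by rewrite eU eV; ring.
exact: (atmost_pair (@atmost_int_abs 6) atmost_bool).
Qed.

(** Dividing by the content [d], itself a divisor of [n], leaves a coprime representation of
    [n / d^2]; the class is empty unless [d^2] divides [n]. *)
Lemma atmost_rep3 n : (0 < n)%N -> atmost (rep3 n) (tau n * (tau n * 26)).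
Proof.
move=> n0.
have gE p : rep3 n p -> exists g u v, [/\ (0 < g)%N, p = (g%:Z * u, g%:Z * v),
    coprimez u v & gcdn `|p.1| `|p.2| = g].
  case: p => x y; rewrite /rep3 /= => r.
  have g0 : (0 < gcdn `|x| `|y|)%N.
    rewrite gcdn_gt0 !absz_gt0; case: eqVneq r => //= ->; case: eqVneq => //= ->.
    by rewrite expr0n /= mulr0 addr0 => -[nE]; rewrite -nE in n0.
  have [u [v [cuv [ex ey]]]] : exists u v, coprimez u v /\
     x = gcdz x y * u /\ y = gcdz x y * v.
    exists (x %/ gcdz x y)%Z, (y %/ gcdz x y)%Z; split.
      have gz : gcdz x y != 0 by rewrite /gcdz; lia.
      apply/eqP/(mulIf gz); rewrite mul1r.
      have := mulz_gcdl (x %/ gcdz x y)%Z (y %/ gcdz x y)%Z (gcdz x y).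
      by rewrite !divzK ?dvdz_gcdl ?dvdz_gcdr.
    by rewrite ![gcdz x y * _]mulrC !divzK ?dvdz_gcdl ?dvdz_gcdr.
  by exists (gcdn `|x| `|y|), u, v; split=> //; congr pair.
apply: (@atmost_fiber _ _ _ (fun d => d %| n)%N (fun p => gcdn `|p.1| `|p.2|)).
- move=> p /[dup] r /gE[g [u [v [g0 pE cuv ->]]]]; move: r; rewrite pE /rep3 /= => r.
  apply/dvdnP; exists (absz (g%:Z * u ^+ 2 + 3 * g%:Z * v ^+ 2)%R).
  have -> : n = absz n%:Z by [].
  by rewrite -r -[g in RHS]/(absz g%:Z) -abszM; congr absz; ring.
- exact: atmost_dvdn.
move=> d dn.
have d0 : (0 < d)%N by apply: dvdn_gt0 dn.
have [dd|dd] := boolP (d ^ 2 %| n)%N; last first.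
  move=> [|p s] // _ /(_ p (mem_head _ _)) [/[dup] r /gE[g [u [v [g0 pE cuv ->]]]] gd].
  case/negP: dd; apply/dvdnP; exists (absz (u ^+ 2 + 3 * v ^+ 2)%R).
  move: r; rewrite pE /rep3 /= gd => r; have -> : n = absz n%:Z by [].
  by rewrite -r -[d in RHS]/(absz d%:Z) -abszX -abszM; congr absz; ring.
have m0 : (0 < n %/ d ^ 2)%N.
  by rewrite divn_gt0 ?expn_gt0 ?d0 //; apply: dvdn_leq n0 dd.
have mle : (tau (n %/ d ^ 2) * 26 <= tau n * 26)%N.
  by rewrite leq_mul2r tau_mono ?orbT //; apply: dvdn_div.
apply: (atmost_sub (fun _ h => h) mle).
have dz : d%:Z != 0 by rewrite eqz_nat -lt0n.
apply: (@atmost_inj _ _ _ _ (fun p => ((p.1 %/ d)%Z, (p.2 %/ d)%Z)) _ _ _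
   (atmost_rep3_coprime m0)).
  move=> p [r gd]; have [g [u [v [g0 pE cuv gg]]]] := gE p r.
  move: r; rewrite gg in gd; rewrite pE gd /rep3 /= !mulKz // => r; split=> //.
  have d2 : d%:Z ^+ 2 != 0 by rewrite expf_neq0.
  have E : d%:Z ^+ 2 * (n %/ d ^ 2)%N%:Z = n%:Z.
    by rewrite -[n in RHS](divnK dd) mulnC PoszM -!mulnn PoszM expr2.
  by apply: (mulfI d2); rewrite E -r; ring.
move=> p q [rp gp] [rq gq].
have [g [u [v [_ pE _ gg]]]] := gE p rp; have [g' [u' [v' [_ qE _ gg']]]] := gE q rq.
rewrite gg in gp; rewrite gg' in gq; rewrite pE qE gp gq /= !mulKz //.
by case=> -> ->.
Qed.

(** * Eisenstein integers of cubic norm *)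


(* [Eis x y] is the Eisenstein integer x + y w, with w^2 = - 1 - w. *)
Record eis := Eis { ere : int; eim : int }.

Definition eis_pair z := (ere z, eim z).
Definition pair_eis p := Eis p.1 p.2.
Lemma eis_pairK : cancel eis_pair pair_eis. Proof. by case. Qed.
HB.instance Definition _ := Choice.copy eis (can_type eis_pairK).

Definition eadd x y := Eis (ere x + ere y) (eim x + eim y).
Definition eopp x := Eis (- ere x) (- eim x).
Definition emul x y := Eis (ere x * ere y - eim x * eim y)
  (ere x * eim y + eim x * ere y - eim x * eim y).

Lemma eisP x y : ere x = ere y -> eim x = eim y -> x = y.
Proof. by case: x y => [? ?] [? ?] /= -> ->. Qed.

Lemma eaddA : associative eadd.
Proof. by move=> x y z; apply: eisP => /=; ring. Qed.
Lemma eaddC : commutative eadd.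
Proof. by move=> x y; apply: eisP => /=; ring. Qed.
Lemma eadd0 : left_id (Eis 0 0) eadd.
Proof. by move=> x; apply: eisP => /=; ring. Qed.
Lemma eaddN : left_inverse (Eis 0 0) eopp eadd.
Proof. by move=> x; apply: eisP => /=; ring. Qed.
HB.instance Definition _ := GRing.isZmodule.Build eis eaddA eaddC eadd0 eaddN.

Lemma emulA : associative emul.
Proof. by move=> x y z; apply: eisP => /=; ring. Qed.
Lemma emulC : commutative emul.
Proof. by move=> x y; apply: eisP => /=; ring. Qed.
Lemma emul1 : left_id (Eis 1 0) emul.
Proof. by move=> x; apply: eisP => /=; ring. Qed.
Lemma emulDl : left_distributive emul eadd.
Proof. by move=> x y z; apply: eisP => /=; ring. Qed.
Lemma eone_neq0 : Eis 1 0 != 0. Proof. by []. Qed.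
HB.instance Definition _ :=
  GRing.Zmodule_isComNzRing.Build eis emulA emulC emul1 emulDl eone_neq0.

Lemma ereD x y : ere (x + y) = ere x + ere y. Proof. by []. Qed.
Lemma eimD x y : eim (x + y) = eim x + eim y. Proof. by []. Qed.
Lemma ereN x : ere (- x) = - ere x. Proof. by []. Qed.
Lemma eimN x : eim (- x) = - eim x. Proof. by []. Qed.
Lemma ereM x y : ere (x * y) = ere x * ere y - eim x * eim y. Proof. by []. Qed.
Lemma eimM x y : eim (x * y) = ere x * eim y + eim x * ere y - eim x * eim y.
Proof. by []. Qed.
Lemma ere1 : ere 1 = 1. Proof. by []. Qed.
Lemma eim1 : eim 1 = 0. Proof. by []. Qed.
Lemma ere0 : ere 0 = 0. Proof. by []. Qed.
Lemma eim0 : eim 0 = 0. Proof. by []. Qed.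
Definition eisE := (ereD, eimD, ereN, eimN, ereM, eimM, ere1, eim1, ere0, eim0).

Definition ez (n : int) : eis := Eis n 0.
Definition econj (x : eis) : eis := Eis (ere x - eim x) (- eim x).
Definition enorm (x : eis) : int := ere x ^+ 2 - ere x * eim x + eim x ^+ 2.

Lemma enormM x y : enorm (x * y) = enorm x * enorm y.
Proof. by rewrite /enorm !eisE; ring. Qed.
Lemma enorm1 : enorm 1 = 1. Proof. by []. Qed.
Lemma enormX x n : enorm (x ^+ n) = enorm x ^+ n.
Proof. by elim: n => [|n IH]; rewrite ?expr0 // !exprS enormM IH. Qed.
Lemma enorm_ez n : enorm (ez n) = n ^+ 2. Proof. by rewrite /enorm /=; ring. Qed.
Lemma enorm_conj x : enorm (econj x) = enorm x.
Proof. by rewrite /enorm /=; ring. Qed.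
Lemma emul_conj x : x * econj x = ez (enorm x).
Proof. by apply: eisP; rewrite !eisE /enorm /=; ring. Qed.
Lemma econjK : involutive econj.
Proof. by move=> x; apply: eisP => /=; ring. Qed.
Lemma econjM x y : econj (x * y) = econj x * econj y.
Proof. by apply: eisP; rewrite ?eisE /=; ring. Qed.
Lemma ezM m n : ez (m * n) = ez m * ez n.
Proof. by apply: eisP; rewrite ?eisE /=; ring. Qed.
Lemma ezX m n : ez (m ^+ n) = ez m ^+ n.
Proof. by elim: n => [|n IH] //; rewrite !exprS ezM IH. Qed.

Lemma enorm4 x : 4 * enorm x = (2 * ere x - eim x) ^+ 2 + 3 * eim x ^+ 2.
Proof. by rewrite /enorm; ring. Qed.
Lemma enorm_ge0 x : 0 <= enorm x.
Proof.
have h := enorm4 x; have h1 := sqr_ge0 (2 * ere x - eim x).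
have h2 := sqr_ge0 (eim x); lra.
Qed.
Lemma enorm_eq0 x : (enorm x == 0) = (x == 0).
Proof.
apply/eqP/eqP => [h|->] //; have := enorm4 x; rewrite h mulr0.
move: (sqr_ge0 (2 * ere x - eim x)) (sqr_ge0 (eim x)) => h1 h2 h3.
have /eqP : eim x ^+ 2 = 0 by lra.
rewrite sqrf_eq0 => /eqP h4; have /eqP : (2 * ere x - eim x) ^+ 2 = 0 by lra.
rewrite sqrf_eq0 h4 subr0 => /eqP h5.
by apply: eisP; rewrite ?h4 // ere0; lia.
Qed.
Lemma enorm_gt0 x : x != 0 -> 0 < enorm x.
Proof. by rewrite lt0r enorm_ge0 enorm_eq0 andbT. Qed.

Lemma round_div (s M : int) : 0 < M -> exists q, `|2 * (s - q * M)| <= M.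
Proof.
move=> M0; exists ((2 * s + M) %/ (2 * M))%Z.
have := divz_eq (2 * s + M) (2 * M).
have := modz_ge0 (2 * s + M) (d := 2 * M); have := ltz_pmod (2 * s + M) (d := 2 * M).
move: (_ %/ _)%Z (_ %% _)%Z => q r h1 h2 h3.
have h0 : 0 < 2 * M by lia.
have {}h1 := h1 h0; have {}h2 := h2 (lt0r_neq0 h0).
have h4 : 2 * (s - q * M) = r - M by rewrite mulrBr; lia.
by rewrite h4; lia.
Qed.

(** Rounding both coordinates of x conj(y) / N(y) leaves errors of at most 1/2, and the norm of such
    a remainder is at most 3/4. *)
Lemma eis_euclid (x y : eis) : y != 0 -> exists q, enorm (x - q * y) < enorm y.
Proof.
move=> y0; have M0 := enorm_gt0 y0.
have [q1 h1] := round_div (ere (x * econj y)) M0.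
have [q2 h2] := round_div (eim (x * econj y)) M0.
exists (Eis q1 q2); rewrite -(ltr_pM2r M0).
have -> : enorm (x - Eis q1 q2 * y) * enorm y =
   enorm (x * econj y - Eis q1 q2 * (y * econj y)).
  by rewrite -[enorm y]enorm_conj -enormM mulrBl mulrA.
rewrite emul_conj; move: (enorm y) M0 h1 h2 => M M0.
rewrite /enorm; set e := ere (_ - _); set f := eim (_ - _) => h1 h2.
have {}h1 : `|2 * e| <= M.
  by move: h1; rewrite /e !eisE /= mulr0 subr0.
have {}h2 : `|2 * f| <= M.
  by move: h2; rewrite /f !eisE /= !mulr0 subr0 add0r.
by move: e f h1 h2 => e f h1 h2; nia.
Qed.

Lemma eis_bezout (x y : eis) :
  exists g u v x' y', [/\ g = u * x + v * y, x = g * x' & y = g * y'].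
Proof.
have [n] := ubnP (absz (enorm y)); elim: n x y => // n IH x y yn.
have [->|y0] := eqVneq y 0.
  by exists x, 1, 0, 1, 0; split; rewrite ?mulr1 ?mulr0 ?mul1r ?addr0.
have [q qy] := eis_euclid x y0.
have [|g [u [v [y' [r' [gE yE rE]]]]]] := IH y (x - q * y).
  by have := enorm_ge0 (x - q * y); have := enorm_ge0 y; lia.
exists g, v, (u - v * q), (r' + q * y'), y'; split=> //.
  by rewrite gE; ring.
by rewrite mulrDr -rE mulrCA -yE subrK.
Qed.

Lemma enorm_unit x : enorm x = 1 -> x * econj x = 1.
Proof. by move=> h; rewrite emul_conj h. Qed.

Lemma prime_intdiv (p : nat) (a b : int) : prime p -> 0 <= a -> 0 <= b ->
  a * b = p%:Z -> a = 1 \/ a = p%:Z.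
Proof.
move=> pp a0 b0 ab.
have : (absz a %| p)%N by apply/dvdnP; exists (absz b); rewrite -abszM mulrC ab.
by move/primeP: pp => [_ h] /h /orP[/eqP|/eqP]; lia.
Qed.

Definition edvd (x y : eis) := exists z, y = x * z.

(** The gcd [g] of [a] and [p] has norm 1, p or p^2. Norm 1 is excluded because p divides N(u a + v
    p); norm p^2 makes [g] an associate of [p], so that [p] divides [a]. *)
Lemma eis_prime_norm (p : nat) (a : eis) : prime p -> (p%:Z %| enorm a)%Z ->
  ~ edvd (ez p) a -> exists2 q, enorm q = p & edvd q a.
Proof.
move=> pp /dvdzP[m ha] npa.
have [g [u [v [a' [p' [gE aE pE]]]]]] := eis_bezout a (ez p).
exists g; last by exists a'.
have p1 := prime_gt1 pp.
have : enorm g * enorm p' = p%:Z ^+ 2 by rewrite -enormM -pE enorm_ez.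
move=> gp; have : (absz (enorm g) %| p ^ 2)%N.
  by apply/dvdnP; exists (absz (enorm p')); rewrite -abszM mulrC gp abszX.
case/(dvdn_pfactor _ _ pp) => [[|[|[|//]]]] _ gn.
- have : (p%:Z %| enorm g)%Z.
    rewrite gE; apply/dvdzP.
    exists (enorm u * m + ere (u * a * econj v) * 2 - eim (u * a * econj v) +
      enorm v * p%:Z).
    transitivity (enorm u * enorm a + p%:Z * (ere (u * a * econj v) * 2
       - eim (u * a * econj v)) + enorm v * p%:Z ^+ 2); last by rewrite ha; ring.
    by rewrite /enorm !eisE /=; ring.
  have := enorm_ge0 g; rewrite dvdzE gn => _.
  by rewrite expn0 dvdn1 => /eqP; lia.
- by have := enorm_ge0 g; rewrite -[enorm g]gez0_abs ?gn ?expn1 ?enorm_ge0.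
case: npa; exists (econj p' * a').
have gE2 : enorm g = p%:Z ^+ 2.
  by rewrite -[enorm g]gez0_abs ?gn ?enorm_ge0 // -rmorphXn.
have p20 : p%:Z ^+ 2 != 0 by rewrite expf_neq0 //; lia.
have p1' : enorm p' = 1.
  by apply: (mulfI p20); rewrite mulr1 -{1}gE2.
by rewrite pE mulrA -[g * _ * _]mulrA enorm_unit // mulr1.
Qed.

Lemma eis_Gauss (p : nat) (q x y : eis) : prime p -> enorm q = p ->
  edvd q (x * y) -> edvd q x \/ edvd q y.
Proof.
move=> pp qp [z xyE].
have [g [u [v [q' [x' [gE qE xE]]]]]] := eis_bezout q x.
have : enorm g * enorm q' = p by rewrite -enormM -qE.
have [g0 q0] := (enorm_ge0 g, enorm_ge0 q').
move=> h; case: (prime_intdiv pp g0 q0 h) => gn.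
- right; exists ((u * y + v * z) * econj g).
  rewrite mulrA; transitivity (g * econj g * y); last first.
    rewrite {1}gE; transitivity (u * q * y * econj g + v * (x * y) * econj g).
      by ring.
    by rewrite xyE; ring.
  by rewrite enorm_unit ?mul1r.
left; exists (econj q' * x').
have q1 : enorm q' = 1.
  have p0 : p%:Z != 0 by have := prime_gt0 pp; lia.
  by apply: (mulfI p0); rewrite mulr1 -{1}gn.
by rewrite qE mulrA -[g * _ * _]mulrA enorm_unit // mulr1.
Qed.

Lemma ez_prime (p : nat) q : enorm q = p -> ez p = q * econj q.
Proof. by move=> <-; rewrite emul_conj. Qed.

Lemma edvd_conj q x : edvd q (econj x) -> edvd (econj q) x.
Proof. by case=> z h; exists (econj z); rewrite -econjM -h econjK. Qed.

(* [ez (enorm q) * q] is [q ^+ 2 * econj q]. *)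
Lemma eis_cube_norm_step (a : eis) (A : nat) : (1 < A)%N -> enorm a = A%:Z ^+ 3 ->
  exists q z, 1 < enorm q /\ (a = q ^+ 3 * z \/ a = ez (enorm q) * q * z).
Proof.
move=> A1 aN; set p := pdiv A.
have pp : prime p by apply: pdiv_prime.
have p1 := prime_gt1 pp; have pz : p%:Z != 0 by lia.
have [B AE] : exists B, A = (p * B)%N.
  by have /dvdnP[B ->] := pdiv_dvd A; exists B; rewrite mulnC.
have {}aN : enorm a = p%:Z ^+ 3 * B%:Z ^+ 3 by rewrite aN AE PoszM exprMn.
have pd m : (p%:Z %| p%:Z * m)%Z by apply: dvdz_mulr.
(* [q] divides x conj(x), hence [x] or its conjugate. In the second case conj(q) divides [x], and q
   conj(q) = p would divide [q x]. *)
have stepq q x m : enorm q = p -> ~ edvd (ez p) (q * x) -> enorm x = p%:Z * m ->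
    exists y, x = q * y.
  move=> qN npx xN; have [//|/edvd_conj[y yE]] : edvd q x \/ edvd q (econj x).
    apply: (eis_Gauss pp qN); rewrite emul_conj xN ezM (ez_prime qN).
    by exists (econj q * ez m); rewrite mulrA.
  by case: npx; exists y; rewrite (ez_prime qN) yE mulrA.
(* Four cases by the power of the rational prime [p] in [a]. Power 0: the same [q] divides [a] three
   times. Power 1: [q] divides [a / p], giving the factor [N(q) q]. Power 3 or more: [p^3] is the
   cube. Power 2: p N(a / p^2) is a cube, so [q] divides [a / p^2], and p^2 q = q^3 conj(q)^2. *)
have [[a1 a1E]|npa] := EM (edvd (ez p) a); last first.
  have dva : (p%:Z %| enorm a)%Z by rewrite aN exprS -!mulrA dvdz_mulr.
  have [q qN [x1 x1E]] := eis_prime_norm pp dva npa.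
  have x1N : enorm x1 = p%:Z * (p%:Z * B%:Z ^+ 3).
    by apply: (mulfI pz); rewrite -{1}qN -enormM -x1E aN; ring.
  have [|x2 x2E] := stepq q x1 _ qN _ x1N; first by rewrite -x1E.
  have x2N : enorm x2 = p%:Z * B%:Z ^+ 3.
    by apply: (mulfI pz); rewrite -{1}qN -enormM -x2E x1N; ring.
  have [|x3 x3E] := stepq q x2 _ qN _ x2N.
    by move=> [y yE]; apply: npa; exists (q * y); rewrite x1E x2E yE; ring.
  exists q, x3; split; first by rewrite qN; lia.
  by left; rewrite x1E x2E x3E; ring.
have a1N : enorm a1 = p%:Z * B%:Z ^+ 3.
  have p2 : p%:Z ^+ 2 != 0 by rewrite expf_neq0.
  by apply: (mulfI p2); rewrite -{1}enorm_ez -enormM -a1E aN; ring.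
have [[a2 a2E]|npa1] := EM (edvd (ez p) a1); last first.
  have [q qN [x1 x1E]] : exists2 q, enorm q = p & edvd q a1.
    by apply: eis_prime_norm => //; rewrite a1N.
  exists q, x1; split; first by rewrite qN; lia.
  by right; rewrite a1E x1E qN; ring.
have [[a3 a3E]|npa2] := EM (edvd (ez p) a2).
  exists (ez p), a3; split; first by rewrite enorm_ez expr2; nia.
  by left; rewrite a1E a2E a3E; ring.
have a2N : p%:Z * enorm a2 = B%:Z ^+ 3.
  by apply: (mulfI pz); rewrite -a1N a2E enormM enorm_ez; ring.
have pB : (p %| B)%N.
  have : (p %| B ^ 3)%N.
    apply/dvdnP; exists (absz (enorm a2)); transitivity (absz (B%:Z ^+ 3)).
      by rewrite abszX.
    by rewrite -a2N abszM mulnC.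
  by rewrite Euclid_dvdX // => /andP[].
have [C BE] := dvdnP pB.
have [q qN [x1 x1E]] : exists2 q, enorm q = p & edvd q a2.
  apply: eis_prime_norm => //; apply/dvdzP; exists (p%:Z * C%:Z ^+ 3).
  by apply: (mulfI pz); rewrite a2N BE PoszM; ring.
exists q, (econj q ^+ 2 * x1); split; first by rewrite qN; lia.
by left; rewrite a1E a2E x1E (ez_prime qN); ring.
Qed.

(** Each step splits off q^3, absorbed by [b], or N(q) q, absorbed by [k]; both divide [A] by N(q) >
    1. *)
Lemma eis_cube_norm_decomp (a : eis) (A : nat) : (0 < A)%N -> enorm a = A%:Z ^+ 3 ->
  exists k b, a = ez (enorm k) * k * b ^+ 3 /\ A%:Z = enorm k * enorm b.
Proof.
elim/ltn_ind: A a => A IH a A0 aN.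
have [A1|A1] := leqP A 1.
  have A1' : A = 1%N by lia.
  rewrite A1' expr1n in aN; exists a, 1.
  by rewrite aN A1' enorm1; split; rewrite ?mulr1 // ?expr1n ?mulr1 mul1r.
have [q [z [q1 az]]] := eis_cube_norm_step A1 aN.
have qz : enorm q ^+ 3 * enorm z = A%:Z ^+ 3.
  by rewrite -aN; case: az => ->; rewrite !enormM ?enormX ?enorm_ez //; ring.
have [B AE] : exists B, A = (absz (enorm q) * B)%N.
  have : (absz (enorm q) ^ 3 %| A ^ 3)%N.
    apply/dvdnP; exists (absz (enorm z)).
    by rewrite -abszX -abszM mulrC qz abszX.
  by rewrite dvdn_pexp2r // => /dvdnP[B ->]; exists B; rewrite mulnC.
have qA : (absz (enorm q))%:Z = enorm q by rewrite gez0_abs // enorm_ge0.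
have zN : enorm z = B%:Z ^+ 3.
  have q30 : enorm q ^+ 3 != 0 by rewrite expf_neq0 //; lia.
  by apply: (mulfI q30); rewrite qz AE PoszM qA; ring.
have B0 : (0 < B)%N by move: A0; rewrite AE; case: (B); rewrite ?muln0.
have BA : (B < A)%N by rewrite AE -{1}(mul1n B) ltn_pmul2r //; lia.
have [k [b [zE BE]]] := IH B BA z B0 zN.
have AE' : A%:Z = enorm q * (enorm k * enorm b) by rewrite AE PoszM qA BE.
case: az => aE.
  exists k, (q * b); rewrite aE zE AE' !enormM; split; last by ring.
  by ring.
exists (q * k), b; rewrite aE zE AE' !enormM !ezM; split; last by ring.
by ring.
Qed.

Definition eprim (x : eis) := coprimez (ere x) (eim x).

Lemma eprim_decomp (x : eis) : x != 0 ->
  exists (n : nat) y, [/\ (0 < n)%N, eprim y & x = ez n * y].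
Proof.
move=> x0; set g := gcdn (absz (ere x)) (absz (eim x)).
have g0 : (0 < g)%N.
  rewrite gcdn_gt0 !absz_gt0; case: eqVneq => //= h1; case: eqVneq => //= h2.
  by case/eqP: x0; apply: eisP.
have gz : g%:Z != 0 by lia.
have d1 : (g%:Z %| ere x)%Z by apply: dvdz_gcdl.
have d2 : (g%:Z %| eim x)%Z by apply: dvdz_gcdr.
exists g, (Eis (ere x %/ g)%Z (eim x %/ g)%Z); split=> //.
  apply/eqP/(mulIf gz) => /=; rewrite mul1r.
  by have := mulz_gcdl (ere x %/ g)%Z (eim x %/ g)%Z g; rewrite !divzK.
by apply: eisP; rewrite !eisE /= !mul0r ?addr0 ?subr0 mulrC divzK.
Qed.

(** A content n of [k] contributes n^3 to N(k) k and therefore moves into the cube. Primitivity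
    matters later: a primitive element is determined up to sign by its direction. *)
Lemma eis_cube_norm_primitive (a : eis) (A : nat) : (0 < A)%N -> enorm a = A%:Z ^+ 3 ->
  exists k b (n : nat), [/\ eprim k, eprim b, (0 < n)%N,
    a = ez (enorm k) * k * (ez n * b) ^+ 3 & A%:Z = enorm k * n%:Z ^+ 2 * enorm b].
Proof.
move=> A0 aN; have [k [b [aE AE]]] := eis_cube_norm_decomp A0 aN.
have k0 : k != 0 by rewrite -enorm_eq0; apply/eqP => h; rewrite h mul0r in AE; lia.
have b0 : b != 0 by rewrite -enorm_eq0; apply/eqP => h; rewrite h mulr0 in AE; lia.
have [n1 [k1 [n10 pk1 kE]]] := eprim_decomp k0.
have [n2 [b1 [n20 pb1 bE]]] := eprim_decomp b0.
exists k1, b1, (n1 * n2)%N; split=> //; first by rewrite muln_gt0 n10.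
  by rewrite aE kE bE enormM enorm_ez PoszM !ezM; ring.
by rewrite AE kE bE !enormM !enorm_ez PoszM; ring.
Qed.

(** * Spacing of arguments *)


Lemma ere_ezM m x : ere (ez m * x) = m * ere x.
Proof. by rewrite eisE /=; ring. Qed.
Lemma eim_ezM m x : eim (ez m * x) = m * eim x.
Proof. by rewrite eisE /=; ring. Qed.

(* [x = (ej x + eim x * sqrt(-3)) / 2], so [slope x] is the tangent of the
   argument of [x], up to the factor [sqrt 3]. *)
Definition ej (x : eis) : int := 2 * ere x - eim x.
Definition slope (x : eis) : rat := (eim x)%:~R / (ej x)%:~R.

Lemma ej_sqr_le x : ej x ^+ 2 <= 4 * enorm x.
Proof. by rewrite enorm4; have := sqr_ge0 (eim x); rewrite /ej; lra. Qed.

Lemma slope_ezM m x : m != 0 -> slope (ez m * x) = slope x.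
Proof.
move=> m0; rewrite /slope /ej ere_ezM eim_ezM.
have -> : 2 * (m * ere x) - m * eim x = m * (2 * ere x - eim x) by ring.
by rewrite !intrM -mulf_div divff ?mul1r // intr_eq0.
Qed.

Lemma slopeB p q : ej p != 0 -> ej q != 0 ->
  slope q - slope p = (2 * eim (econj p * q))%:~R / (ej p * ej q)%:~R.
Proof.
move=> p0 q0; have -> : 2 * eim (econj p * q) = ej p * eim q - ej q * eim p.
  by rewrite /ej !eisE /=; ring.
rewrite /slope; move: (ej p) (ej q) (eim p) (eim q) p0 q0 => a b c d a0 b0.
by rewrite intrB !intrM; field; rewrite !intr_eq0 a0 b0.
Qed.

Lemma floor_eq_lt1 (x y : rat) : Num.floor x = Num.floor y -> `|x - y| < 1.
Proof.
move=> h; have /andP[h1 h2] := floor_itv x; have /andP[] := floor_itv y.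
rewrite -h => h3 h4; rewrite intrD /= in h2 h4; rewrite ltr_norml; lra.
Qed.

(* [2 * eim (econj p * q)] is the determinant of [p] and [q] in the coordinates
   [(ej, eim)], hence the numerator of the difference of their slopes. *)
Lemma same_bin_lt (X : rat) p q : 0 < X -> ej p != 0 -> ej q != 0 ->
  Num.floor (2 * X * slope p) = Num.floor (2 * X * slope q) ->
  X ^+ 2 * (eim (econj p * q) ^+ 2)%:~R < (enorm p * enorm q)%:~R.
Proof.
move=> X0 p0 q0 /esym/floor_eq_lt1; rewrite -mulrBr slopeB //.
set V := eim _; have pq0 : ej p * ej q != 0 by rewrite mulf_neq0.
rewrite mulrA normrM normfV ltr_pdivrMr; last by rewrite normr_gt0 intr_eq0.
rewrite mul1r => h.
have {}h : (2 * X * (2 * V)%:~R) ^+ 2 < ((ej p * ej q) ^+ 2)%:~R.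
  by move: h; rewrite -(@ltr_pXn2r _ 2) ?nnegrE // !real_normK ?num_real // rmorphXn.
have h2 : ((ej p * ej q) ^+ 2)%:~R <= (16 * (enorm p * enorm q))%:~R :> rat.
  rewrite ler_int exprMn.
  have -> : 16 * (enorm p * enorm q) = (4 * enorm p) * (4 * enorm q) by ring.
  by apply: ler_pM; rewrite ?sqr_ge0 ?ej_sqr_le.
have := lt_le_trans h h2; rewrite (intrM _ 2 V) (intrM _ 16) (rmorphXn intr 2 V) /=.
by move: (V%:~R) (_ * enorm q)%:~R => v w; lra.
Qed.

Lemma int_sqr_lt (X : rat) (v a b : int) : 0 < X -> 0 <= a -> 0 <= b ->
  a%:~R <= X -> b%:~R <= X -> X ^+ 2 * (v ^+ 2)%:~R < (a * b)%:~R -> v = 0.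
Proof.
move=> X0 a0 b0 aX bX h; apply/eqP; apply/negP => /negP v0.
have : X ^+ 2 * 1 <= X ^+ 2 * (v ^+ 2)%:~R.
  rewrite ler_pM2l ?exprn_gt0 // -[1]/(1%:~R) ler_int -gtz0_ge1.
  by rewrite exprn_even_gt0.
have : (a * b)%:~R <= X ^+ 2 by rewrite intrM expr2 ler_pM // ler0z.
by lra.
Qed.

(** The determinant of [k1 t] and [k2 t] is N(t) times that of [k1] and [k2]. After cancelling N(t)
    from the bound, an integer of absolute value below 1 remains. *)
Lemma gap_linear (X : rat) k1 k2 t : 0 < X -> 
  (enorm k1)%:~R <= X -> (enorm k2)%:~R <= X ->
  ej (k1 * t) != 0 -> ej (k2 * t) != 0 ->
  Num.floor (2 * X * slope (k1 * t)) = Num.floor (2 * X * slope (k2 * t)) ->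
  eim (econj k1 * k2) = 0.
Proof.
move=> X0 h1 h2 j1 j2 /(same_bin_lt X0 j1 j2).
have t0 : t != 0 by apply: contraNneq j1 => ->; rewrite mulr0.
have -> : econj (k1 * t) * (k2 * t) = ez (enorm t) * (econj k1 * k2).
  by rewrite -emul_conj econjM; ring.
rewrite eim_ezM => h.
apply: (int_sqr_lt X0 (enorm_ge0 k1) (enorm_ge0 k2) h1 h2).
have T0 : 0 < (enorm t)%:~R ^+ 2 :> rat by rewrite exprn_gt0 // ltr0z enorm_gt0.
rewrite -(ltr_pM2l T0); move: h; rewrite !enormM.
move: (enorm t) (enorm k1) (enorm k2) (eim _) => T a b v.
have -> : ((T * v) ^+ 2)%:~R = T%:~R ^+ 2 * (v ^+ 2)%:~R :> rat.
  by rewrite exprMn intrM (rmorphXn intr 2 T).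
have -> : (a * T * (b * T))%:~R = T%:~R ^+ 2 * (a * b)%:~R :> rat.
  by rewrite !intrM; ring.
by move: (v ^+ 2)%:~R (a * b)%:~R T%:~R => v' c T'; lra.
Qed.

(** Up to sign, [x], [y] and [x - y] are p, q and p + q for some positive p and q, and the norm form
    becomes p^2 + p q + q^2, which is at most 2 p q (p + q). *)
Lemma int_cubic_ge (x y : int) : x * y * (x - y) != 0 ->
  (x ^+ 2 - x * y + y ^+ 2) ^+ 2 <= 4 * (x * y * (x - y)) ^+ 2.
Proof.
move=> h0; suff h : x ^+ 2 - x * y + y ^+ 2 <= 2 * `|x * y * (x - y)|.
  have -> : 4 * (x * y * (x - y)) ^+ 2 = (2 * `|x * y * (x - y)|) ^+ 2.
    by rewrite [RHS]exprMn real_normK ?num_real.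
  by rewrite ler_pXn2r ?nnegrE ?mulr_ge0 //; apply: (enorm_ge0 (Eis x y)).
have pos (p q : int) : 0 < p -> 0 < q -> p ^+ 2 + p * q + q ^+ 2 <= 2 * (p * q * (p + q)).
  by move=> p0 q0; nia.
have [x0 [y0 xy0]] : x != 0 /\ y != 0 /\ x - y != 0.
  by move: h0; rewrite !mulf_eq0 !negb_or => /andP[/andP[]].
rewrite !normrM.
have [xp|xn] := ltrP 0 x; have [yp|yn] := ltrP 0 y.
- have [xy|xy] := ltrP 0 (x - y).
    have := pos y (x - y) yp xy; rewrite !gtr0_norm //; lra.
  have h : 0 < y - x by lia.
  by have := pos x (y - x) xp h; rewrite distrC !gtr0_norm //; lra.
- have y1 : 0 < - y by lia.
  have h : 0 < x - y by lia.
  have := pos x (- y) xp y1; rewrite -(normrN y) !gtr0_norm //; lra.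
- have x1 : 0 < - x by lia.
  have h : 0 < y - x by lia.
  by have := pos (- x) y x1 yp; rewrite -(normrN x) distrC !gtr0_norm //; lra.
have x1 : 0 < - x by lia.
have y1 : 0 < - y by lia.
rewrite -(normrN x) -(normrN y).
have [xy|xy] := ltrP 0 (x - y).
  have := pos (- x) (x - y) x1 xy; rewrite !gtr0_norm //; lra.
have h : 0 < y - x by lia.
by have := pos (- y) (y - x) y1 h; rewrite distrC !gtr0_norm //; lra.
Qed.

Lemma eim_cube w : eim (w ^+ 3) = 3 * (ere w * eim w * (ere w - eim w)).
Proof. by rewrite !exprS expr0 mulr1 !eisE; ring. Qed.

(** With w = conj(b1) b2 and eim(w^3) = 3 V, sharing a bin means 9 X^2 V^2 < N(w)^3. A lower bound
    of 1 for |V| would not contradict this; [int_cubic_ge] gives 4 V^2 >= N(w)^2, and N(w) <= X^2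
    then yields 9 X^2 V^2 >= (9/4) N(w)^3. *)
Lemma gap_cubic (X : rat) k b1 b2 : 0 < X ->
  (enorm b1)%:~R <= X -> (enorm b2)%:~R <= X ->
  ej (k * b1 ^+ 3) != 0 -> ej (k * b2 ^+ 3) != 0 ->
  Num.floor (2 * X * slope (k * b1 ^+ 3)) = Num.floor (2 * X * slope (k * b2 ^+ 3)) ->
  eim ((econj b1 * b2) ^+ 3) = 0.
Proof.
move=> X0 h1 h2 j1 j2 /(same_bin_lt X0 j1 j2).
have k0 : k != 0 by apply: contraNneq j1 => ->; rewrite mul0r.
have b10 : b1 != 0 by apply: contraNneq j1 => ->; rewrite expr0n mulr0.
have b20 : b2 != 0 by apply: contraNneq j2 => ->; rewrite expr0n mulr0.
have -> : econj (k * b1 ^+ 3) * (k * b2 ^+ 3) = ez (enorm k) * (econj b1 * b2) ^+ 3.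
  by rewrite -emul_conj !exprS expr0 !mulr1 !econjM; ring.
rewrite eim_ezM => h; set w := econj b1 * b2.
have wN : enorm w = enorm b1 * enorm b2 by rewrite enormM enorm_conj.
have w0 : 0 < enorm w by rewrite wN mulr_gt0 ?enorm_gt0.
rewrite eim_cube; set V := _ * (_ - _).
have [->|V0] := eqVneq V 0; first by rewrite mulr0.
have hV : enorm w ^+ 2 <= 4 * V ^+ 2 by apply: int_cubic_ge.
have T0 : 0 < (enorm k)%:~R ^+ 2 :> rat by rewrite exprn_gt0 // ltr0z enorm_gt0.
have {}h : X ^+ 2 * (9 * V ^+ 2)%:~R < (enorm w ^+ 3)%:~R.
  rewrite -(ltr_pM2l T0); move: h; rewrite eim_cube -/V !(enormM k) !enormX wN.
  move: (enorm k) (enorm b1) (enorm b2) (V) => T a b v.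
  have -> : ((T * (3 * v)) ^+ 2)%:~R = T%:~R ^+ 2 * (9 * v ^+ 2)%:~R :> rat.
    by rewrite -(rmorphXn intr 2 T) -intrM; congr (_%:~R); ring.
  have -> : (T * a ^+ 3 * (T * b ^+ 3))%:~R = T%:~R ^+ 2 * ((a * b) ^+ 3)%:~R :> rat.
    by rewrite -(rmorphXn intr 2 T) -intrM; congr (_%:~R); ring.
  by move: (9 * v ^+ 2)%:~R ((a * b) ^+ 3)%:~R T%:~R => v' c T'; lra.
have X2 : (enorm w)%:~R <= X ^+ 2.
  by rewrite wN intrM expr2 ler_pM // ler0z enorm_ge0.
exfalso; have W0 : 0 < (enorm w)%:~R :> rat by rewrite ltr0z.
have : (enorm w ^+ 2)%:~R <= (4 * V ^+ 2)%:~R :> rat by rewrite ler_int.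
move: h; rewrite !(intrM _ _ (V ^+ 2)) (rmorphXn intr 2 V) (rmorphXn intr 2 (enorm w)).
rewrite (rmorphXn intr 3 (enorm w)) /=; move: (V%:~R) => v.
move: X2 W0; move: (enorm w)%:~R => W X2 W0 h h'.
have : W * (9 * v ^+ 2) <= X ^+ 2 * (9 * v ^+ 2).
  have v9 : 0 <= 9 * v ^+ 2 by have := sqr_ge0 v; lra.
  exact: ler_wpM2r v9 _ _ X2.
have : W * W ^+ 2 <= W * (4 * v ^+ 2) by rewrite ler_pM2l.
have := sqr_ge0 v; rewrite -exprS; have : 0 <= W * v ^+ 2 by rewrite mulr_ge0 ?sqr_ge0 ?ltW.
have W3 : 0 < W ^+ 3 by rewrite exprn_gt0.
lra.
Qed.

Lemma eprim_prop (m t : int) k1 k2 : m != 0 -> eprim k1 -> eprim k2 ->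
  ez m * k2 = ez t * k1 -> k2 = k1 \/ k2 = - k1.
Proof.
move=> m0 /eqP p1 /eqP p2 h.
have e1 : m * ere k2 = t * ere k1 by rewrite -!ere_ezM h.
have e2 : m * eim k2 = t * eim k1 by rewrite -!eim_ezM h.
have mt : absz m = absz t.
  have := mulz_gcdr m (ere k2) (eim k2); rewrite e1 e2 -mulz_gcdr p1 p2; lia.
have : t = m \/ t = - m by lia.
case=> tE; [left|right]; apply: eisP; rewrite ?eisE; apply: (mulfI m0);
  rewrite ?e1 ?e2 tE; ring.
Qed.

Lemma eim0_ez x : eim x = 0 -> x = ez (ere x).
Proof. by move=> h; apply: eisP. Qed.

Lemma conj_real_prop k1 k2 : eprim k1 -> eprim k2 -> k1 != 0 ->
  eim (econj k1 * k2) = 0 -> k2 = k1 \/ k2 = - k1.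
Proof.
move=> p1 p2 k10 h; apply: (@eprim_prop (enorm k1) (ere (econj k1 * k2))) => //.
  by rewrite enorm_eq0.
by rewrite -(eim0_ez h) -emul_conj; ring.
Qed.

Definition omega := Eis 0 1.

Lemma eprim_omega x : eprim x -> eprim (x * omega).
Proof.
rewrite /eprim !eisE /= => /coprimezP[[u v] /= uv]; apply/coprimezP.
by exists (- v - u, u) => /=; rewrite -[RHS]uv; ring.
Qed.

Lemma ere_omega x : ere (x * omega) = - eim x.
Proof. by rewrite !eisE /=; ring. Qed.
Lemma eim_omega x : eim (x * omega) = ere x - eim x.
Proof. by rewrite !eisE /=; ring. Qed.

(** The cube of w = conj(b1) b2 is real exactly on three lines through 0. Multiplying [b2] by a
    power of [omega] moves w to the real axis and leaves the cube of [b2] unchanged. *)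
Lemma conj_cube_real_prop b1 b2 : eprim b1 -> eprim b2 -> b1 != 0 ->
  eim ((econj b1 * b2) ^+ 3) = 0 -> b2 ^+ 3 = b1 ^+ 3 \/ b2 ^+ 3 = - b1 ^+ 3.
Proof.
move=> p1 p2 b10; rewrite eim_cube => h.
have cube x : x ^+ 3 = (x * omega) ^+ 3.
  by rewrite exprMn [omega ^+ 3](_ : _ = 1) ?mulr1 //; apply: eisP.
have sgn x : eprim x -> eim (econj b1 * x) = 0 ->
    x ^+ 3 = b1 ^+ 3 \/ x ^+ 3 = - b1 ^+ 3.
  move=> px /(conj_real_prop p1 px b10)[->|->]; first by left.
  by right; rewrite !exprS expr0; ring.
set w := econj b1 * b2 in h.
have /orP[/orP[/eqP w0|/eqP w0]|/eqP w0] : (ere w == 0) || (eim w == 0) || (ere w - eim w == 0).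
  by move/eqP: h; rewrite !mulf_eq0 /=.
- rewrite cube (cube (b2 * omega)); apply: sgn; first by do 2!apply: eprim_omega.
  by rewrite !mulrA -/w !eim_omega ere_omega w0; ring.
- by apply: sgn.
by rewrite cube; apply: sgn; [apply: eprim_omega | rewrite mulrA -/w eim_omega].
Qed.

(** * Square discriminants *)


(** For codes that are not canonical: an element may have several, and one is picked by choice. *)
Lemma atmost_rel (T U : eqType) (P : T -> Prop) (Q : U -> Prop)
    (S : T -> U -> Prop) c :
  (forall x, P x -> exists2 y, Q y & S x y) ->
  (forall x x' y, P x -> P x' -> S x y -> S x' y -> x = x') ->
  atmost Q c -> atmost P c.
Proof.
move=> PQ SI Qc; apply: atmost_base => x0 /PQ[y0 _ _].
have /choice[f fP] x : exists y, P x -> Q y /\ S x y.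
  have [/PQ[y Qy Sy]|nP] := EM (P x); first by exists y.
  by exists y0 => /nP.
apply: (@atmost_inj _ _ _ Q f) => // [x /fP[]//|x x' Px Px' fx].
apply: (SI x x' (f x)) => //; first by case: (fP x Px).
by rewrite fx; case: (fP x' Px').
Qed.

Lemma atmost_enorm n : (0 < n)%N ->
  atmost (fun x => enorm x = n%:Z) (tau (4 * n) * (tau (4 * n) * 26)).
Proof.
move=> n0; have n4 : (0 < 4 * n)%N by rewrite muln_gt0.
apply: (@atmost_inj _ _ _ _ (fun x => (ej x, eim x)) _ _ _ (atmost_rep3 n4)).
  by move=> x xn; rewrite /rep3 /= /ej -enorm4 xn PoszM.
move=> x y _ _ [h1 h2]; apply: eisP => //; move: h1; rewrite /ej h2; lia.
Qed.

(** The product m is at most [Y]; [k] and [|j| + 1] divide m, one bit gives the sign of [j], and the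
    norm of [nu] is then forced. The 4 in the hypothesis comes from 4 N(nu) = ej^2 + 3 eim^2. *)
Lemma atmost_code (Y G : nat) :
  (forall m, (0 < m <= 4 * Y)%N -> (tau m <= G)%N) ->
  atmost (fun x : nat * eis * int => [/\ (0 < x.1.1)%N, x.1.2 != 0 &
    (`|x.2| + 1) * enorm x.1.2 * x.1.1%:Z <= Y%:Z])
    (Y * (G * G * 2 * (G * (G * 26)))).
Proof.
move=> GY.
pose f (x : nat * eis * int) := ((absz x.2).+1 * absz (enorm x.1.2) * x.1.1)%N.
have fE x : (f x)%:Z = (`|x.2| + 1) * enorm x.1.2 * x.1.1%:Z.
  rewrite /f !PoszM gez0_abs ?enorm_ge0 //; congr (_ * _ * _); lia.
apply: (@atmost_fiber _ _ _ (fun m => m \in iota 1 Y) f).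
- move=> x [k0 nu0 h]; have fY : (f x <= Y)%N by rewrite -lez_nat fE.
  rewrite mem_iota add1n ltnS fY andbT /f !muln_gt0 k0 andbT /= absz_gt0; exact: lt0r_neq0 (enorm_gt0 nu0).
- by rewrite -{2}(size_iota 1 Y); apply: atmost_seq.
move=> m; rewrite mem_iota add1n ltnS => /andP[m0 mY].
have tm d : (0 < d)%N -> (d %| m)%N -> (tau (4 * d) <= G)%N.
  move=> d0 dm; apply: GY; rewrite muln_gt0 d0 /= leq_mul2l /=.
  by apply: leq_trans mY; apply: dvdn_leq.
have dvm : atmost (fun d => d %| m)%N G.
  apply: (atmost_sub _ _ (atmost_dvdn m0)) => //; apply: GY; rewrite m0 /=.
  by apply: leq_trans mY _; rewrite leq_pmull.
apply: (@atmost_fiber _ _ _ (fun y => (y.1.1 %| m /\ y.1.2 %| m)%N /\ True)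
  (fun x : nat * eis * int => (x.1.1, (absz x.2).+1, 0 <= x.2))).
- move=> x [_ <-] /=; split=> //; rewrite /f; split; first exact: dvdn_mull.
  by rewrite -mulnA dvdn_mulr.
- exact: (atmost_pair (atmost_pair dvm dvm) atmost_bool).
move=> y _; apply: atmost_base => x0 [[[k0 nu0 _] fm] yE].
have n0 : (0 < absz (enorm x0.1.2))%N by rewrite absz_gt0 lt0r_neq0 ?enorm_gt0.
have tG : (tau (4 * absz (enorm x0.1.2)) <= G)%N.
  by apply: tm => //; rewrite -fm /f -mulnA mulnCA dvdn_mulr.
apply: (atmost_sub (fun _ h => h) (leq_mul tG (leq_mul tG (leqnn 26)))).
apply: (@atmost_inj _ _ _ _ (fun x : nat * eis * int => x.1.2) _ _ _
  (atmost_enorm n0)).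
- move=> x [[[k1 nu1 _] fx] xE]; move: fx yE; rewrite -fm -xE /f => + [e1 e2 _].
  rewrite e1 e2 => /eqP; rewrite eqn_pmul2r // eqn_pmul2l // => /eqP <-.
  by rewrite gez0_abs // enorm_ge0.
move=> [[k nu] j] [[k' nu'] j'] [_ /= e] [_ /= e'] /= ->.
move: e'; rewrite -e => -[-> h1 h2]; congr pair; move: h1 h2.
by case: (leP 0 j) (leP 0 j') => ? [] ? //; lia.
Qed.

(** * Covariants of a cubic and bounds in terms of its coefficients *)

Definition cdisc (a b c : int) : int :=
  a ^+ 2 * b ^+ 2 - 4 * a ^+ 3 * c + 18 * a * b * c - 4 * b ^+ 3 - 27 * c ^+ 2.
(* 27 f((Y - a) / 3) = Y^3 - 3 (hA a b) Y + hB a b c. *)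
Definition hA (a b : int) : int := a ^+ 2 - 3 * b.
Definition hB (a b c : int) : int := 2 * a ^+ 3 - 9 * a * b + 27 * c.

Lemma cdiscE a b c : 4 * hA a b ^+ 3 = hB a b c ^+ 2 + 27 * cdisc a b c.
Proof. by rewrite /hA /hB /cdisc; ring. Qed.

Lemma cdisc_eis a b c z : cdisc a b c = z ^+ 2 ->
  exists x, [/\ ej x = hB a b c, eim x = 3 * z & enorm x = hA a b ^+ 3].
Proof.
move=> Dz; have h := cdiscE a b c; rewrite Dz in h.
have : (2 %| hB a b c + 3 * z)%Z.
  have : (2 %| (hB a b c + 3 * z) ^+ 2)%Z.
    apply/dvdzP; exists (2 * hA a b ^+ 3 - 9 * z ^+ 2 + 3 * hB a b c * z).
    by move: h; move: (hA a b) (hB a b c) => u v h; lra.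
  by rewrite dvdzE abszX Euclid_dvdX // => /andP[].
case/dvdzP => x xE; exists (Eis x (3 * z)); rewrite /ej /=.
have jE : 2 * x - 3 * z = hB a b c by lra.
split=> //; have := enorm4 (Eis x (3 * z)); rewrite /= jE; lra.
Qed.

(** Equal signs of [b] and [b'] give s^2 >= 2 N and |b - b'| <= |s|; equal signs of [a] and [a']
    give h^2 <= |h (a + a')| = 3 |b - b'|. Hence |9 s - h^2| >= 6 |s|, and h (9 s - h^2) = 54 (c -
    c'), of size at most 108 N, leaves h^2 <= (108 N)^2 / (72 N) = 162 N. *)
Lemma shift_bound (N a b c a' b' c' : int) :
  0 < N -> `|c| <= N -> `|c'| <= N -> N < b ^+ 2 -> N < b' ^+ 2 ->
  (0 < a) = (0 < a') -> (0 < b) = (0 < b') -> a != 0 -> a' != 0 ->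
  hA a b = hA a' b' -> hB a b c = hB a' b' c' -> (a - a') ^+ 2 <= 162 * N.
Proof.
move=> N_gt0 cN cN' bN bN' sa sb a0 a0' eA eB.
set h := a - a'; set s := b + b'.
have N0 : 0 <= N by apply: ltW.
have key : h * (9 * s - h ^+ 2) = 54 * (c - c').
  have e1 : 27 * c = hB a b c + a ^+ 3 - 3 * a * hA a b by rewrite /hA /hB; ring.
  have e2 : 27 * c' = hB a' b' c' + a' ^+ 3 - 3 * a' * hA a' b'.
    by rewrite /hA /hB; ring.
  have e3 : 9 * b = 3 * (a ^+ 2 - hA a b) by rewrite /hA; ring.
  have e4 : 9 * b' = 3 * (a' ^+ 2 - hA a' b') by rewrite /hA; ring.
  transitivity (2 * (27 * c - 27 * c')); last by ring.
  have e5 : 9 * s = 9 * b + 9 * b' by rewrite /s; ring.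
  by rewrite e1 e2 eB -eA e5 e3 e4 -eA /h; ring.
have s2 : 2 * N <= s ^+ 2.
  have : 0 <= b * b'.
    move: sb; case: (ltrP 0 b); case: (ltrP 0 b') => // h1 h2 _.
      by rewrite mulr_ge0 // ltW.
    by rewrite mulr_le0.
  by rewrite /s sqrrD; lra.
have hs : h ^+ 2 <= 3 * `|b - b'|.
  have e : 3 * (b - b') = h * (a + a').
    by move: eA; rewrite /hA /h => eA; have : (a-a')*(a+a') = a ^+ 2 - a' ^+ 2 by [ring]; lra.
  have -> : 3 * `|b - b'| = `|h| * `|a + a'| by rewrite -normrM -e normrM.
  rewrite -(real_normK (num_real h)) expr2 ler_wpM2l // /h.
  move: sa a0 a0'; case: (ltrP 0 a); case: (ltrP 0 a') => // *; lia.
have lo : 36 * s ^+ 2 <= (9 * s - h ^+ 2) ^+ 2.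
  have h2 := sqr_ge0 h; move: sb hs; rewrite /s; move: (h ^+ 2) h2 => u u0.
  case: (ltrP 0 b); case: (ltrP 0 b') => // bs' bs _ us.
    have us' : u <= 3 * (b + b') by lia.
    have v0 : 0 <= 6 * (b + b') by lia.
    have -> : 36 * (b + b') ^+ 2 = (6 * (b + b')) ^+ 2 by ring.
    by rewrite ler_pXn2r ?nnegrE //; lia.
  have v0 : 0 <= - (6 * (b + b')) by lia.
  have -> : 36 * (b + b') ^+ 2 = (- (6 * (b + b'))) ^+ 2 by ring.
  rewrite -[X in _ <= X]sqrrN ler_pXn2r ?nnegrE //; lia.
have d54 : `|54 * (c - c')| <= 108 * N by clear -cN cN'; lia.
have N108 : 0 <= 108 * N by rewrite mulr_ge0.
have up : h ^+ 2 * (9 * s - h ^+ 2) ^+ 2 <= (108 * N) ^+ 2.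
  by rewrite -exprMn key -(real_normK (num_real (54 * _))) ler_pXn2r ?nnegrE.
have N1 : 0 < 72 * N by rewrite mulr_gt0.
rewrite -(ler_pM2r N1); have -> : 162 * N * (72 * N) = (108 * N) ^+ 2 by ring.
apply: le_trans up; rewrite ler_wpM2l ?sqr_ge0 //; lra.
Qed.


(** With a^2 > 100 N the term 3 b is less than 3 percent of a^2. *)
Lemma hA_bounds (N a b : int) : `|a| <= N -> `|b| <= N -> 100 * N < a ^+ 2 ->
  [/\ 0 < hA a b, hA a b <= 4 * N ^+ 2 & 100 * hA a b <= 103 * a ^+ 2].
Proof.
move=> aN bN Na; have N0 : 0 <= N by apply: le_trans aN.
have a2 : a ^+ 2 <= N ^+ 2 by rewrite -(real_normK (num_real a)) ler_pXn2r ?nnegrE.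
have N1 : 1 <= N.
  have [//|h] := lerP 1 N; move: Na a2; have -> : N = 0 by clear -N0 h; lia.
  by rewrite expr0n mulr0 /= => h1 h2; have := lt_le_trans h1 h2; rewrite ltxx.
have NN : N <= N ^+ 2 by rewrite expr2 ler_peMr.
have {bN} [b1 b2] : - N <= b /\ b <= N by clear -bN; lia.
rewrite /hA; move: (a ^+ 2) (N ^+ 2) Na a2 NN => u v Na a2 NN.
by clear -N0 N1 b1 b2 Na a2 NN; split; lia.
Qed.

(** The term 2 a^3 dominates B, which is at least (2 - 0.09 - 0.27) a^3 = 1.64 a^3. Each term of D
    that can be positive is at most its coefficient times a^2 N^2, and 1 + 4 + 18 + 4 <= 36, so |z|
    <= 6 a N. With A <= 1.03 a^2 this leaves 18.54 <= 16 * 1.64. *)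
Lemma slope_le_pos (N a b c z : int) : 0 < a ->
  a <= N -> `|b| <= N -> `|c| <= N -> 100 * N < a ^+ 2 ->
  cdisc a b c = z ^+ 2 -> 0 < hB a b c /\ 3 * `|z| * hA a b <= 16 * N * hB a b c.
Proof.
move=> a0 aN bN cN Na Dz.
have N0 : 0 < N by apply: lt_le_trans aN.
have [A0 _ A103] : [/\ 0 < hA a b, hA a b <= 4 * N ^+ 2 & 100 * hA a b <= 103 * a ^+ 2].
  by apply: hA_bounds => //; rewrite gtr0_norm.
have [b1 b2] : - N <= b /\ b <= N by clear -bN; lia.
have [c1 c2] : - N <= c /\ c <= N by clear -cN; lia.
have a1 : 1 <= a by clear -a0; lia.
have f1 : 100 * N * a <= a ^+ 3 by rewrite exprSr ler_pM2r // ltW.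
have f2 : N <= N * a by rewrite ler_peMr // ltW.
have f3 : a * b <= a * N by rewrite ler_pM2l.
have B164 : 164 * a ^+ 3 <= 100 * hB a b c.
  have -> : 100 * hB a b c = 200 * a ^+ 3 - 900 * (a * b) + 2700 * c by rewrite /hB; ring.
  move: f1 f2 f3; rewrite -mulrA [N * a]mulrC; move: (a ^+ 3) (a * b) (a * N) => u v w.
  by clear -c1; lia.
have a30 : 0 < a ^+ 3 by rewrite exprn_gt0.
have NNa : N ^+ 2 <= a * N ^+ 2 by rewrite ler_peMl // sqr_ge0.
have NNa2 : a * N ^+ 2 <= a ^+ 2 * N ^+ 2.
  by rewrite ler_wpM2r ?sqr_ge0 // expr2 ler_peMl // ltW.
have z2 : z ^+ 2 <= (6 * (a * N)) ^+ 2.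
  have g1 : b ^+ 2 <= N ^+ 2.
    by rewrite -(real_normK (num_real b)) ler_pXn2r ?nnegrE // ltW.
  have h1 : a ^+ 2 * b ^+ 2 <= a ^+ 2 * N ^+ 2 by rewrite ler_wpM2l ?sqr_ge0.
  have h2 : - (a ^+ 3 * c) <= a ^+ 2 * N ^+ 2.
    rewrite -mulrN; apply: (@le_trans _ _ (a ^+ 3 * N)).
      by rewrite ler_pM2l //; clear -c1; lia.
    rewrite exprSr -mulrA ler_wpM2l ?sqr_ge0 // expr2 ler_pM2r //.
  have h3 : a * b * c <= a ^+ 2 * N ^+ 2.
    apply: le_trans NNa2; rewrite -mulrA ler_pM2l // expr2.
    apply: le_trans (ler_norm _) _; rewrite normrM ler_pM //.
  have h4 : - b ^+ 3 <= a ^+ 2 * N ^+ 2.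
    apply: (@le_trans _ _ (N * N ^+ 2)).
      rewrite exprS -mulNr; apply: le_trans (ler_norm _) _.
      by rewrite normrM normrN ler_pM // ger0_norm // sqr_ge0.
    rewrite ler_wpM2r ?sqr_ge0 // ; move: Na; move: (a ^+ 2) => u; clear -N0; lia.
  have h5 := sqr_ge0 c; have h6 : 0 <= a ^+ 2 * N ^+ 2 by rewrite mulr_ge0 ?sqr_ge0.
  have -> : (6 * (a * N)) ^+ 2 = 36 * (a ^+ 2 * N ^+ 2) by ring.
  rewrite -Dz /cdisc.
  have -> : a ^+ 2 * b ^+ 2 - 4 * a ^+ 3 * c + 18 * a * b * c - 4 * b ^+ 3 -
    27 * c ^+ 2 = a ^+ 2 * b ^+ 2 + 4 * - (a ^+ 3 * c) + 18 * (a * b * c)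
    + 4 * - b ^+ 3 - 27 * c ^+ 2 by ring.
  move: (a ^+ 2 * b ^+ 2) (a ^+ 3 * c) (a * b * c) (b ^+ 3) (c ^+ 2)
    (a ^+ 2 * N ^+ 2) h1 h2 h3 h4 h5 h6 => u1 u2 u3 u4 u5 u6; clear; lia.
have B0 : 0 < hB a b c by move: B164 a30; move: (hB a b c) (a ^+ 3) => u v; clear; lia.
split=> //.
have zN : `|z| <= 6 * (a * N).
  have aN0 : 0 <= 6 * (a * N) by rewrite !mulr_ge0 // ltW.
  by move: z2; rewrite -(real_normK (num_real z)) ler_pXn2r ?nnegrE.
have h100 : 0 < 100 :> int by [].
rewrite -(ler_pM2r h100).
apply: (@le_trans _ _ (3 * (6 * (a * N)) * (103 * a ^+ 2))).
  have -> : 3 * `|z| * hA a b * 100 = (3 * `|z|) * (100 * hA a b) by ring.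
  by apply: ler_pM; rewrite ?ler_pM2l // mulr_ge0 // ltW.
apply: (@le_trans _ _ (16 * N * (164 * a ^+ 3))).
  have -> : 3 * (6 * (a * N)) * (103 * a ^+ 2) = 1854 * (a ^+ 3 * N) by ring.
  have -> : 16 * N * (164 * a ^+ 3) = 2624 * (a ^+ 3 * N) by ring.
  by rewrite ler_pM2r // mulr_gt0.
have -> : 16 * N * hB a b c * 100 = 16 * N * (100 * hB a b c) by ring.
by rewrite ler_pM2l // mulr_gt0.
Qed.

Lemma slope_le (N a b c z : int) :
  `|a| <= N -> `|b| <= N -> `|c| <= N -> 100 * N < a ^+ 2 ->
  cdisc a b c = z ^+ 2 ->
  [/\ hB a b c != 0, (0 < hB a b c) = (0 < a) &
    3 * `|z| * hA a b <= 16 * N * `|hB a b c|].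
Proof.
move=> aN bN cN Na Dz; have N0 : 0 <= N by apply: le_trans aN.
have [a0|a0|a0] := ltrgtP 0 a; last first.
- by move: Na; rewrite -a0 expr0n /= => h; clear -N0 h; lia.
(* Replacing f(X) by - f(- X) changes the signs of [a], [c] and B only. *)
- have [||||||B0 h] := @slope_le_pos N (- a) b (- c) z.
  + by rewrite oppr_gt0.
  + by rewrite -(ltr0_norm a0).
  + by [].
  + by rewrite normrN.
  + by rewrite sqrrN.
  + by rewrite -Dz /cdisc; ring.
  have E : hB (- a) b (- c) = - hB a b c by rewrite /hB; ring.
  rewrite E oppr_gt0 in B0; rewrite E in h.
  split; first by rewrite ltr0_neq0.
    by rewrite !ltNge !ltW.
  by rewrite (ltr0_norm B0) (_ : hA a b = hA (- a) b) // /hA sqrrN.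
have [|B0 h] := slope_le_pos a0 _ bN cN Na Dz; first by rewrite -(gtr0_norm a0).
by split; rewrite ?(lt0r_neq0 B0) ?B0 ?(gtr0_norm B0).
Qed.

(** If A = N(nu) k^2 N(y) is below 2^(l+1), this bounds the norm of the free factor y; it is the [X]
    of the gap lemmas. *)
Definition scale (l k : nat) (nu : eis) : rat :=
  (2 ^ l.+1)%N%:R / (k%:R ^+ 2 * (enorm nu)%:~R).

(* [u] records the signs of [a] and [b], the residue of [a] modulo [M], the
   dyadic size of [hA a b], and, with [x = N(kp) kp (k bt)^3], the smaller of
   [kp] and [bt], the content [k] and the slope of [x] up to the resolution
   granted by the gap lemmas. *)
Definition encodes (M : nat) (t : int * int * int)
    (u : bool * bool * (nat * nat) * bool * (nat * eis * int)) : Prop :=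
  let: (a, b, c) := t in
  let: (sa, sb, (am, l), cs, (k, nu, j)) := u in
  exists x kp bt, [/\ [/\ sa = (0 < a), sb = (0 < b) & am%:Z = (a %% M%:Z)%Z],
    [/\ ej x = hB a b c, enorm x = hA a b ^+ 3,
       x = ez (enorm kp) * kp * (ez k%:Z * bt) ^+ 3 &
       hA a b = enorm kp * k%:Z ^+ 2 * enorm bt],
    [/\ eprim kp, eprim bt & (0 < k)%N],
    hA a b < (2 ^ l.+1)%N%:Z & nu = (if cs then kp else bt) /\
    j = Num.floor (2 * scale l k nu * slope x)].

Definition big_square (N : int) (t : int * int * int) : Prop :=
  let: (a, b, c) := t in
  [/\ [/\ `|a| <= N, `|b| <= N & `|c| <= N], 100 * N < a ^+ 2, N < b ^+ 2 &
    exists z, cdisc a b c = z ^+ 2].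

Lemma scale_gt (l k : nat) (nu y : eis) : (0 < k)%N -> nu != 0 ->
  enorm nu * k%:Z ^+ 2 * enorm y < (2 ^ l.+1)%N%:Z ->
  0 < scale l k nu /\ (enorm y)%:~R <= scale l k nu.
Proof.
move=> k0 nu0 h; have n0 : 0 < (enorm nu)%:~R :> rat by rewrite ltr0z enorm_gt0.
have kk0 : 0 < k%:R ^+ 2 :> rat by rewrite exprn_gt0 // ltr0n.
have d0 : 0 < k%:R ^+ 2 * (enorm nu)%:~R :> rat by rewrite mulr_gt0.
split; first by rewrite divr_gt0 // ltr0n expn_gt0.
rewrite /scale ler_pdivlMr // -[k%:R]/(k%:Z%:~R) -[(2 ^ _)%N%:R]/((2 ^ l.+1)%N%:Z%:~R).
rewrite -rmorphXn /= -!intrM ler_int ltW //; apply: le_lt_trans h.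
by rewrite le_eqVlt; apply/orP; left; apply/eqP; ring.
Qed.

(** The integer N(kp) k^3 does not affect the slope, so the bin only sees [kp bt^3]. One of the two
    factors is [nu]; the gap lemma for the other determines it, or its cube, up to sign. *)
Lemma encodes_eis_inj l k (x kp bt x' kp' bt' nu : eis) (cs : bool) j :
  (0 < k)%N -> eprim kp -> eprim bt -> eprim kp' -> eprim bt' ->
  ej x != 0 -> ej x' != 0 ->
  x = ez (enorm kp) * kp * (ez k%:Z * bt) ^+ 3 ->
  x' = ez (enorm kp') * kp' * (ez k%:Z * bt') ^+ 3 ->
  enorm kp * k%:Z ^+ 2 * enorm bt < (2 ^ l.+1)%N%:Z ->
  enorm kp' * k%:Z ^+ 2 * enorm bt' < (2 ^ l.+1)%N%:Z ->
  nu = (if cs then kp else bt) -> nu = (if cs then kp' else bt') ->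
  j = Num.floor (2 * scale l k nu * slope x) ->
  j = Num.floor (2 * scale l k nu * slope x') -> x' = x \/ x' = - x.
Proof.
move=> k0 pk pb pk' pb' jx jx' xE xE' sz sz' nuE nuE' jE; rewrite jE {jE j}.
have xE2 (q y : eis) : ez (enorm q) * q * (ez k%:Z * y) ^+ 3 =
    ez (enorm q * k%:Z ^+ 3) * (q * y ^+ 3).
  by rewrite exprMn ezM ezX; ring.
rewrite xE2 in xE; rewrite xE2 in xE'.
have ejez m y : ej (ez m * y) = m * ej y.
  by rewrite /ej ere_ezM eim_ezM; ring.
have m0 : enorm kp * k%:Z ^+ 3 != 0.
  by apply: contraNneq jx; rewrite xE ejez => ->; rewrite mul0r.
have m0' : enorm kp' * k%:Z ^+ 3 != 0.
  by apply: contraNneq jx'; rewrite xE' ejez => ->; rewrite mul0r.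
have j1 : ej (kp * bt ^+ 3) != 0.
  by apply: contraNneq jx => h; rewrite xE ejez h mulr0.
have j1' : ej (kp' * bt' ^+ 3) != 0.
  by apply: contraNneq jx' => h; rewrite xE' ejez h mulr0.
have kp0 : kp != 0 by apply: contraNneq j1 => ->; rewrite mul0r.
have bt0 : bt != 0 by apply: contraNneq j1 => ->; rewrite expr0n mulr0.
rewrite {1}xE xE' !slope_ezM //.
case: cs nuE nuE' => nuE nuE'; subst nu.
  move: nuE' => nuE'; subst kp'.
  have [X0 X1] := scale_gt k0 kp0 sz; have [_ X2] := scale_gt k0 kp0 sz'.
  move/(gap_cubic X0 X1 X2 j1 j1')/(conj_cube_real_prop pb pb' bt0).
  by rewrite xE; case=> ->; [left|right]; rewrite ?mulrN.
move: nuE' => nuE'; subst bt'.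
have [X0 X1] : 0 < scale l k bt /\ (enorm kp)%:~R <= scale l k bt.
  by apply: scale_gt => //; rewrite mulrC mulrA mulrAC.
have [_ X2] : 0 < scale l k bt /\ (enorm kp')%:~R <= scale l k bt.
  by apply: scale_gt => //; rewrite mulrC mulrA mulrAC.
move/(gap_linear X0 X1 X2 j1 j1')/(conj_real_prop pk pk' kp0).
rewrite xE; case=> ->; [left|right]; rewrite // mulNr mulrN; congr (- (ez (_ * _) * _)).
by rewrite /enorm !eisE !sqrrN mulrNN.
Qed.

(** The code gives x up to sign, hence A; the sign of [a] is that of B and so settles the sign of x.
    Given A and B, the residue of [a] modulo [M] singles out [a] by [shift_bound]; then A gives [b]
    and B gives [c]. *)
Lemma encodes_inj (N M s : nat) t t' u : (0 < N)%N -> (N < s.+1 ^ 2)%N ->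
  M = (13 * s.+1)%N -> big_square N t -> big_square N t' ->
  encodes M t u -> encodes M t' u -> t = t'.
Proof.
case: t t' u => [[a b] c] [[a' b'] c'] [[[[sa sb] [am l]] cs] [[k nu] j]].
move=> N0 Ns ME [[aN bN cN] Na Nb [z Dz]] [[aN' bN' cN'] Na' Nb' [z' Dz']].
move=> [x [kp [bt [[sa1 sb1 am1] [ejx ex xE hE] [pk pb k0] sz [nuE jE]]]]].
move=> [x' [kp' [bt' [[sa2 sb2 am2] [ejx' ex' xE' hE'] [pk' pb' _] sz' [nuE' jE']]]]].
have [B0 Bs _] := slope_le aN bN cN Na Dz.
have [B0' Bs' _] := slope_le aN' bN' cN' Na' Dz'.
have [A0 _ _] := hA_bounds aN bN Na; have [A0' _ _] := hA_bounds aN' bN' Na'.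
have xx' : x' = x \/ x' = - x.
  apply: (@encodes_eis_inj l k x kp bt x' kp' bt' nu cs j) => //.
  + by rewrite ejx.
  + by rewrite ejx'.
  + by rewrite -hE.
  + by rewrite -hE'.
have eN : enorm x' = enorm x.
  by case: xx' => -> //; rewrite /enorm !eisE !sqrrN mulrNN.
have eA : hA a b = hA a' b'.
  apply/eqP; rewrite -(@eqrXn2 _ 3) ?(ltW A0) ?(ltW A0') //.
  by rewrite -ex -ex' eN.
have ss : (0 < a) = (0 < a') by rewrite -sa1 -sa2.
have eB : hB a b c = hB a' b' c'.
  case: xx' => h; first by rewrite -ejx -ejx' h.
  have : hB a' b' c' = - hB a b c.
    by rewrite -ejx -ejx' h /ej !eisE; ring.
  move: Bs Bs' B0 B0'; rewrite ss => <-; move: (hB a b c) (hB a' b' c') => u v.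
  by clear; case: (ltrP 0 u); case: (ltrP 0 v) => //; lia.
have a0 : a != 0 by apply: contraTneq Na => ->; rewrite expr0n /=; clear; lia.
have a0' : a' != 0 by apply: contraTneq Na' => ->; rewrite expr0n /=; clear; lia.
have ssb : (0 < b) = (0 < b') by rewrite -sb1 -sb2.
have sh := @shift_bound N%:Z a b c a' b' c' N0 cN cN' Nb Nb' ss ssb a0 a0' eA eB.
have aa : a = a'.
  (* The 13 in [M] is chosen for this: 162 N < 169 (s + 1)^2. *)
  have lt : (a - a') ^+ 2 < M%:Z ^+ 2.
    apply: le_lt_trans sh _; rewrite ME; clear -Ns; nia.
  have {lt} : `|a - a'| < M%:Z.
    by move: lt; rewrite -(real_normK (num_real (a - a'))) ltr_pXn2r ?nnegrE.
  have : (a = a' %[mod M%:Z])%Z by rewrite -am1 -am2.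
  move/eqP; rewrite eqz_mod_dvd => /dvdzP[q qE]; rewrite qE normrM.
  have [q00|q0] := eqVneq q 0.
    by move=> _; apply/eqP; rewrite -subr_eq0 qE q00 mul0r.
  rewrite [`|M%:Z|]ger0_norm // => h; exfalso.
  have : 1 * M%:Z <= `|q| * M%:Z by rewrite ler_wpM2r //; clear -q0; lia.
  by rewrite mul1r leNgt h.
subst a'; have bb : b = b' by move: eA; rewrite /hA; clear; lia.
subst b'; congr pair; move: eB; rewrite /hB; move: (2 * a ^+ 3 - 9 * a * b) => w.
by clear; lia.
Qed.


Lemma norm_floor_le (y : rat) : (`|Num.floor y|)%:~R <= `|y| + 1.
Proof.
have /andP[h1 h2] := floor_itv y; rewrite intrD /= in h2.
rewrite intr_norm ler_norml; apply/andP.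
by split; have := ler_norm y; have := ler_norm (- y); rewrite normrN; lra.
Qed.

(** The scale is proportional to 2^(l+1) and A >= 2^l, so the scaled slope y satisfies |y| N(nu) k^2
    <= 4 K. Rounding and the added 1 contribute at most 2 N(nu) k. *)
Lemma bin_bound (N K : nat) (x nu : eis) (A : int) (l k : nat) : (0 < k)%N -> nu != 0 ->
  ej x != 0 -> `|eim x| * A <= K%:Z * `|ej x| ->
  (2 ^ l)%N%:Z <= A -> enorm nu * k%:Z <= N%:Z ->
  (`|Num.floor (2 * scale l k nu * slope x)| + 1) * enorm nu * k%:Z <=
    (4 * K + 2 * N)%N%:Z.
Proof.
move=> k0 nu0 j0 h lA nk.
set y := 2 * _ * _.
have n0 : 0 < (enorm nu)%:~R :> rat by rewrite ltr0z enorm_gt0.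
have k0' : 1 <= k%:R :> rat by rewrite ler1n.
have k00 : 0 < k%:R :> rat by rewrite ltr0n.
have jj0 : 0 < `|ej x|%:~R :> rat by rewrite ltr0z normr_gt0.
have s1 : `|slope x| * A%:~R <= K%:R.
  have -> : `|slope x| = (`|eim x|)%:~R / (`|ej x|)%:~R.
    by rewrite /slope normrM normfV !intr_norm.
  by rewrite mulrAC ler_pdivrMr // -[K%:R]/(K%:Z%:~R) -!intrM ler_int.
have s2 : `|slope x| * (2 ^ l)%:R <= K%:R.
  apply: le_trans s1; rewrite ler_wpM2l //.
  by rewrite -[(2 ^ l)%:R]/((2 ^ l)%N%:Z%:~R) ler_int.
have s3 : `|y| * (enorm nu)%:~R * k%:R ^+ 2 <= 4 * K%:R.
  have -> : `|y| * (enorm nu)%:~R * k%:R ^+ 2 = 4 * (`|slope x| * (2 ^ l)%:R).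
    have sc0 : 0 <= scale l k nu.
      by rewrite /scale divr_ge0 ?ler0n // mulr_ge0 ?sqr_ge0 // ltW.
    rewrite /y 2!normrM (ger0_norm sc0) [`|2|]ger0_norm // /scale expnS natrM; field.
    by rewrite !lt0r_neq0.
  by rewrite ler_pM2l.
have s4 : `|y| * (enorm nu)%:~R * k%:R <= 4 * K%:R.
  apply: le_trans s3; rewrite ler_wpM2l //; first by rewrite mulr_ge0 // ltW.
  by rewrite expr2 ler_peMl // ltW.
have nk' : (enorm nu)%:~R * k%:R <= N%:R :> rat.
  by rewrite -[k%:R]/(k%:Z%:~R) -[N%:R]/(N%:Z%:~R) -intrM ler_int.
have nk0 : 0 < (enorm nu)%:~R * k%:R :> rat by rewrite mulr_gt0.
have fl : (`|Num.floor y|)%:~R + 1 <= `|y| + 2 by have := norm_floor_le y; lra.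
rewrite -mulrA -(ler_int rat) intrM intrD intrM.
apply: (@le_trans _ _ ((`|y| + 2) * ((enorm nu)%:~R * k%:R))).
  by rewrite ler_pM2r.
rewrite -[(4 * K + 2 * N)%N%:~R]/((4 * K + 2 * N)%:R) natrD !natrM mulrDl mulrA lerD //.
by rewrite ler_pM2l.
Qed.

Definition code_ok (N M : nat) (u : bool * bool * (nat * nat) * bool * (nat * eis * int)) : Prop :=
  (((True /\ True) /\ (u.1.1.2.1 \in iota 0 M /\
     u.1.1.2.2 \in iota 0 (trunc_log 2 (4 * N ^ 2)).+1)) /\ True) /\
  [/\ (0 < u.2.1.1)%N, u.2.1.2 != 0 &
    (`|u.2.2| + 1) * enorm u.2.1.2 * u.2.1.1%:Z <= (68 * N)%N%:Z].

Lemma encodes_exists (N M : nat) t : (0 < M)%N -> big_square N t ->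
  exists2 u, code_ok N M u & encodes M t u.
Proof.
case: t => [[a b] c] M0 [[aN bN cN] Na Nb [z Dz]].
have [A0 A4 _] := hA_bounds aN bN Na; have [B0 _ sl] := slope_le aN bN cN Na Dz.
have [x [jx ix nx]] := cdisc_eis Dz.
have AE : (absz (hA a b))%:Z = hA a b by rewrite gez0_abs // ltW.
have A0' : (0 < absz (hA a b))%N by rewrite absz_gt0 lt0r_neq0.
have [|kp [bt [k [pk pb k0 xE hE]]]] := @eis_cube_norm_primitive x _ A0'.
  by rewrite AE.
rewrite AE in hE.
have kp0 : kp != 0 by rewrite -enorm_eq0; apply: contraTneq A0; rewrite hE => ->; rewrite !mul0r ltxx.
have bt0 : bt != 0 by rewrite -enorm_eq0; apply: contraTneq A0; rewrite hE => ->; rewrite !mulr0 ltxx.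
set l := trunc_log 2 (absz (hA a b)); set cs := enorm kp <= enorm bt.
pose nu := if cs then kp else bt.
have nu0 : nu != 0 by rewrite /nu; case: (cs).
have lA : (2 ^ l)%N%:Z <= hA a b by rewrite -AE lez_nat; apply: trunc_logP.
have lA2 : hA a b < (2 ^ l.+1)%N%:Z by rewrite -AE ltz_nat; apply: trunc_log_ltn.
(* The smaller of two norms is at most their geometric mean, so (N(nu) k)^2 <= A <= 4 N^2. This is
   why the smaller factor is the one recorded. *)
have nk : enorm nu * k%:Z <= 2 * N%:Z.
  have kp1 := enorm_ge0 kp; have bt1 := enorm_ge0 bt.
  have h : (enorm nu * k%:Z) ^+ 2 <= (2 * N%:Z) ^+ 2.
    apply: (@le_trans _ _ (hA a b)).
      rewrite hE exprMn [X in _ <= X]mulrAC ler_wpM2r ?sqr_ge0 // /nu /cs expr2.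
      case: (lerP (enorm kp) (enorm bt)) => h; first by rewrite ler_wpM2l.
      by rewrite ler_wpM2r // ltW.
    by rewrite exprMn.
  by move: h; rewrite ler_pXn2r ?nnegrE // mulr_ge0 ?enorm_ge0.
pose j := Num.floor (2 * scale l k nu * slope x).
have am0 : 0 <= (a %% M%:Z)%Z by rewrite modz_ge0 //; clear -M0; lia.
exists ((0 < a, 0 < b), (absz (a %% M%:Z)%Z, l), cs, (k, nu, j)).
  split; last split=> //.
    split=> //; split=> //; rewrite /code_ok !mem_iota !add0n !ltnS; split.
      by rewrite -ltz_nat gez0_abs // ltz_pmod.
    apply: leq_trunc_log; rewrite -lez_nat AE; apply: le_trans A4 _.
    by rewrite PoszM -mulnn PoszM expr2.
  (* 16 N is the slope constant of [slope_le], and 2 N bounds N(nu) k. *)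
  have -> : (68 * N = 4 * (16 * N) + 2 * (2 * N))%N by clear; lia.
  apply: (@bin_bound (2 * N) (16 * N) x nu (hA a b)) => //; first by rewrite jx.
  by rewrite jx ix normrM.
exists x, kp, bt; split=> //; split=> //.
by rewrite gez0_abs.
Qed.

Lemma atmost_big_square (N s G : nat) : (0 < N)%N -> (N < s.+1 ^ 2)%N ->
  (forall m, (0 < m <= 4 * (68 * N))%N -> (tau m <= G)%N) ->
  atmost (big_square N) (2 * 2 * (13 * s.+1 * (trunc_log 2 (4 * N ^ 2)).+1) * 2 *
    (68 * N * (G * G * 2 * (G * (G * 26))))).
Proof.
move=> N0 Ns tG; set M := (13 * s.+1)%N.
apply: (@atmost_rel _ _ _ (code_ok N M) (encodes M)).
- by move=> t; apply: encodes_exists.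
- by move=> t t' u bt bt' e e'; apply: (encodes_inj N0 Ns (erefl M) bt bt' e e').
have iM m : atmost (fun i => i \in iota 0 m) m.
  by rewrite -{2}(size_iota 0 m); apply: atmost_seq.
exact: (atmost_pair (atmost_pair (atmost_pair (atmost_pair atmost_bool atmost_bool)
  (atmost_pair (@iM _) (@iM _))) atmost_bool) (atmost_code tG)).
Qed.

(** The pair (B, 3 z) represents 4 A^3 by x^2 + 3 y^2, and B determines [c]. From A <= 4 N^2 comes 4
    A^3 <= 256 N^6. If A <= 0, the identity forces B = 0. *)
Lemma atmost_square_c (N G : nat) (a b : int) : (0 < N)%N -> `|a| <= N%:Z -> `|b| <= N%:Z ->
  (forall m, (0 < m <= 256 * N ^ 6)%N -> (tau m <= G)%N) ->
  atmost (fun c => exists z, cdisc a b c = z ^+ 2) (G * (G * 26)).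
Proof.
move=> N0 aN bN tG.
have G1 : (0 < G)%N by apply: leq_trans (tau_gt0 1) (tG 1%N _); rewrite /= muln_gt0 expn_gt0 N0.
have [A0|A0] := lerP (hA a b) 0.
  apply: (@atmost_sub _ _ _ 1 _ (fun _ h => h)).
    by rewrite !muln_gt0 G1.
  have z0 c : (exists z, cdisc a b c = z ^+ 2) -> hB a b c = 0.
    case=> z Dz; have := cdiscE a b c; rewrite Dz.
    have : hA a b ^+ 3 <= 0 by rewrite exprn_odd_le0.
    have := sqr_ge0 z; have := sqr_ge0 (hB a b c) => h1 h2 h3 h4.
    by apply/eqP; rewrite -sqrf_eq0; apply/eqP; move: h1 h2 h3 h4; clear; lia.
  apply: atmost1 => c c' /z0 h /z0; rewrite -h /hB; move: (2 * _ - _) => w; clear; lia.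
set n := absz (4 * hA a b ^+ 3).
have nE : n%:Z = 4 * hA a b ^+ 3 by rewrite gez0_abs // mulr_ge0 // exprn_ge0 // ltW.
have n0 : (0 < n)%N by rewrite absz_gt0 mulf_neq0 // expf_neq0 // lt0r_neq0.
have nG : (tau n <= G)%N.
  apply: tG; rewrite n0 /= -lez_nat nE.
  have : hA a b ^+ 3 <= (4 * N%:Z ^+ 2) ^+ 3.
    have [b1 b2] : - N%:Z <= b /\ b <= N%:Z by clear -bN; lia.
    rewrite ler_pXn2r ?nnegrE ?mulr_ge0 ?sqr_ge0 ?(ltW A0) // /hA.
    have a2 : a ^+ 2 <= N%:Z ^+ 2.
      by rewrite -(real_normK (num_real a)) ler_pXn2r ?nnegrE.
    have NN : N%:Z <= N%:Z ^+ 2 by rewrite expr2 ler_peMr.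
    by move: a2 NN; move: (a ^+ 2) (N%:Z ^+ 2) => u v; clear -b1; lia.
  rewrite PoszM (_ : (N ^ 6)%N%:Z = N%:Z ^+ 6); last by rewrite -natrXE.
  have -> : (4 * N%:Z ^+ 2) ^+ 3 = 64 * N%:Z ^+ 6 by ring.
  by move: (_ ^+ 3) (_ ^+ 6) => u v; clear; lia.
apply: (atmost_sub (fun _ h => h) (leq_mul nG (leq_mul nG (leqnn 26)))).
apply: (@atmost_rel _ _ _ _ (fun c p => p.1 = hB a b c) _ _ _ (atmost_rep3 n0)).
  move=> c [z Dz]; exists (hB a b c, 3 * z) => //.
  by rewrite /rep3 /= nE (cdiscE a b c) Dz; ring.
move=> c c' p _ _ ->; rewrite /hB; move: (2 * _ - _) => w; clear; lia.
Qed.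


(** * The total number of square discriminants in a box *)

Definition box (N : int) (t : int * int * int) : Prop :=
  [/\ `|t.1.1| <= N, `|t.1.2| <= N & `|t.2| <= N].

Definition square_disc (t : int * int * int) : Prop :=
  exists z, cdisc t.1.1 t.1.2 t.2 = z ^+ 2.

Lemma sqr_le_abs (a : int) (s : nat) : a ^+ 2 < (s ^ 2)%N%:Z -> `|a| <= s%:Z.
Proof.
rewrite -mulnn PoszM -expr2 -(real_normK (num_real a)) ltr_pXn2r ?nnegrE //; exact: ltW.
Qed.

Lemma atmost_square_ab (N A B G : nat) : (0 < N)%N -> (A <= N)%N -> (B <= N)%N ->
  (forall m, (0 < m <= 256 * N ^ 6)%N -> (tau m <= G)%N) ->
  atmost (fun t : int * int * int => [/\ `|t.1.1| <= A%:Z, `|t.1.2| <= B%:Z & square_disc t])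
    ((A + A).+1 * (B + B).+1 * (G * (G * 26))).
Proof.
move=> N0 AN BN tG.
apply: (@atmost_fiber _ _ _ (fun p => `|p.1| <= A%:Z /\ `|p.2| <= B%:Z)
  (fun t : int * int * int => t.1)).
- by move=> t [].
- exact: (atmost_pair (@atmost_int_abs A) (@atmost_int_abs B)).
move=> [a b] [/= aA bB].
have aN : `|a| <= N%:Z by apply: le_trans aA _; rewrite lez_nat.
have bN : `|b| <= N%:Z by apply: le_trans bB _; rewrite lez_nat.
apply: (atmost_inj _ _ (atmost_square_c N0 aN bN tG) (f := snd)).
  by move=> [[a' b'] c] [[_ _ h] /= [<- <-]].
by move=> [p c] [p' c'] [_ /= ->] [_ /= ->] /= ->.
Qed.

Lemma atmost_square (N s G : nat) : (0 < N)%N -> (s ^ 2 <= N < s.+1 ^ 2)%N ->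
  (forall m, (0 < m <= 272 * N ^ 6)%N -> (tau m <= G)%N) ->
  atmost (fun t => box N t /\ square_disc t)
    ((1000 * 400) * (s.+1 * N * (G ^ 4 * (trunc_log 2 (4 * N ^ 2)).+1))).
Proof.
move=> N0 /andP[sN Ns] tG.
have N6 : (N <= N ^ 6)%N by rewrite -{1}(expn1 N) leq_pexp2l.
have G1 : (0 < G)%N.
  by apply: leq_trans (tau_gt0 1) (tG 1%N _); rewrite /= muln_gt0 expn_gt0 N0.
have tG1 m : (0 < m <= 256 * N ^ 6)%N -> (tau m <= G)%N.
  move=> /andP[m0 m1]; apply: tG; rewrite m0; apply: leq_trans m1 _.
  by rewrite leq_mul2r orbT.
have tG2 m : (0 < m <= 4 * (68 * N))%N -> (tau m <= G)%N.
  move=> /andP[m0 m1]; apply: tG; rewrite m0; apply: leq_trans m1 _.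
  by rewrite mulnA leq_mul2l N6.
have s1N : (s.+1 <= 2 * N)%N by clear -sN N0; nia.
set L := (trunc_log 2 _).+1.
(* [A] covers a^2 <= 100 N and [B] covers b^2 <= N; both are capped at [N], as [atmost_square_ab]
   requires. *)
pose A := minn (10 * s.+1) N; pose B := minn s.+1 N.
have AN : (A <= N)%N by rewrite geq_minr.
have BN : (B <= N)%N by rewrite geq_minr.
have h1 := atmost_square_ab N0 AN (leqnn N) tG1.
have h2 := atmost_square_ab N0 (leqnn N) BN tG1.
have h3 := atmost_big_square N0 Ns tG2.
have h12 := atmost_or h1 h2 (fun x => EM _).
have h123 := atmost_or h12 h3 (fun x => EM _).
apply: (atmost_sub _ _ h123).
  move=> [[a b] c] [[/= aN bN cN] sq].
  have minP (x : int) (y : nat) : `|x| <= y%:Z -> `|x| <= N%:Z -> `|x| <= (minn y N)%:Z.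
    by clear; lia.
  have [Na|Na] := ltrP (100 * N%:Z) (a ^+ 2); last first.
    left; left; split=> //=; apply: minP => //; apply: sqr_le_abs.
    by apply: le_lt_trans Na _; clear -Ns; nia.
  have [Nb|Nb] := ltrP N%:Z (b ^+ 2); last first.
    left; right; split=> //=; apply: minP => //; apply: sqr_le_abs.
    exact: le_lt_trans Nb _.
  by right; split.
have A1 : ((A + A).+1 <= 21 * s.+1)%N by rewrite /A; clear; lia.
have B1 : ((B + B).+1 <= 3 * s.+1)%N by rewrite /B; clear; lia.
have N1 : ((N + N).+1 <= 3 * N)%N by clear -N0; lia.
have q1 : ((A + A).+1 * (N + N).+1 <= 63 * (s.+1 * N))%N.
  by apply: leq_trans (leq_mul A1 N1) _; rewrite mulnACA.
have q2 : ((N + N).+1 * (B + B).+1 <= 9 * (s.+1 * N))%N.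
  by apply: leq_trans (leq_mul N1 B1) _; rewrite mulnACA [(N * _)%N]mulnC.
have G2 : (G ^ 2 <= G ^ 4 * L)%N.
  by rewrite -{1}(muln1 (G ^ 2)%N) leq_mul // leq_pexp2l.
set P := (s.+1 * N)%N in q1 q2 *; set E := (G ^ 4 * L)%N in G2 *.
have e1 : (G * (G * 26) = 26 * G ^ 2)%N by rewrite -mulnn; clear; lia.
(* The three contributions add up to 63 * 26 + 9 * 26 + 104 * 3536 = 369616, below 1000 * 400. *)
have e2 : (2 * 2 * (13 * s.+1 * L) * 2 * (68 * N * (G * G * 2 * (26 * G ^ 2))) =
   (104 * 3536) * (P * E))%N.
  rewrite /P /E; have -> : (G ^ 4 = G ^ 2 * G ^ 2)%N by rewrite -expnD.
  rewrite (mulnn G); move: (G ^ 2)%N (s.+1) (L) => g s1 L0; clear. ring.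
rewrite e1 e2.
have r1 := leq_mul q1 (leq_mul (leqnn 26) G2).
have r2 := leq_mul q2 (leq_mul (leqnn 26) G2).
apply: leq_trans (leq_add (leq_add r1 r2) (leqnn _)) _.
by clear -r1; move: (P) (E) => P0 E0; lia.
Qed.

(** Taking the actual maximum of [tau] passes from a bound on K-th powers to a single integer [G]
    without extracting roots. *)
Lemma tau_max (X Y K : nat) : (0 < X)%N -> (0 < K)%N ->
  (forall m, (0 < m <= X)%N -> (tau m ^ K <= Y)%N) ->
  exists2 G, (forall m, (0 < m <= X)%N -> (tau m <= G)%N) & (G ^ K <= Y)%N.
Proof.
move=> X0 K0 h; exists (\max_(i < X.+1 | (0 < i)%N) tau i).
  move=> m /andP[m0 mX]; have mX' : (m < X.+1)%N by [].
  exact: (@leq_bigmax_cond _ _ (fun i : 'I_X.+1 => tau i) (Ordinal mX')).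
elim/big_ind: _ => [|x y hx hy|i i0]; first by rewrite exp0n.
  by case: (leqP x y).
by apply: h; rewrite i0 -ltnS ltn_ord.
Qed.

(** 26 = 24 + 2: [G ^ (4 K)] is at most a constant times (N^6)^4, and the K-th power of the number
    of dyadic sizes at most a constant times N^2. *)
Lemma atmost_square_eps (K : nat) : (0 < K)%N -> exists C, forall N s : nat,
  (0 < N)%N -> (s ^ 2 <= N < s.+1 ^ 2)%N ->
  exists2 E, (E ^ K <= C * N ^ 26)%N &
    atmost (fun t => box N t /\ square_disc t) ((1000 * 400) * (s.+1 * N * E)).
Proof.
move=> K0; have [C tC] := tau_expn_le K0.
exists ((C * 272) ^ 4 * (K ^ K * 4))%N => N s N0 sN.
have X0 : (0 < 272 * N ^ 6)%N by rewrite muln_gt0 expn_gt0 N0.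
have [m /andP[m0 mX]|G tG GK] := @tau_max _ (C * (272 * N ^ 6)) K X0 K0.
  by apply: leq_trans (tC m m0) _; rewrite leq_mul2l mX orbT.
exists (G ^ 4 * (trunc_log 2 (4 * N ^ 2)).+1)%N; last exact: atmost_square.
rewrite expnMn -expnM mulnC [(4 * K)%N]mulnC expnM.
have l1 := succ_expn_le (trunc_log 2 (4 * N ^ 2)) K0.
have l2 : (2 ^ trunc_log 2 (4 * N ^ 2) <= 4 * N ^ 2)%N.
  by apply: trunc_logP; rewrite // muln_gt0 expn_gt0 N0.
have l3 := leq_trans l1 (leq_mul (leqnn (K ^ K)%N) l2).
have g4 : ((G ^ K) ^ 4 <= (C * (272 * N ^ 6)) ^ 4)%N by rewrite leq_exp2r.
apply: leq_trans (leq_mul l3 g4) _.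
have -> : (N ^ 26 = N ^ 2 * (N ^ 6) ^ 4)%N by rewrite -expnM -expnD.
rewrite mulnA !expnMn; move: (K ^ K)%N (C ^ 4)%N (272 ^ 4)%N (N ^ 2)%N => x y z w.
by move: (_ ^ 4)%N => v; clear; lia.
Qed.

(** * Galois groups of cubics *)


Definition cubic (R : nzRingType) (a b c : R) : {poly R} :=
  'X^3 + a *: 'X^2 + b *: 'X + c%:P.

Lemma horner_cubic (R : comNzRingType) (a b c x : R) :
  (cubic a b c).[x] = x ^+ 3 + a * x ^+ 2 + b * x + c.
Proof. by rewrite /cubic !hornerE. Qed.

Lemma size_cubic (R : nzRingType) (a b c : R) : size (cubic a b c) = 4.
Proof.
rewrite /cubic -!addrA size_polyDl size_polyXn //.
rewrite (leq_ltn_trans (size_polyD _ _)) // gtn_max; apply/andP; split.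
  by rewrite (leq_ltn_trans (size_scale_leq _ _)) // size_polyXn.
rewrite (leq_ltn_trans (size_polyD _ _)) // gtn_max; apply/andP; split.
  by rewrite (leq_ltn_trans (size_scale_leq _ _)) // size_polyX.
by rewrite size_polyC; case: eqP.
Qed.

Lemma coef_cubic (R : nzRingType) (a b c : R) :
  ((cubic a b c)`_0 = c) * ((cubic a b c)`_1 = b) * ((cubic a b c)`_2 = a) *
  ((cubic a b c)`_3 = 1).
Proof.
by rewrite /cubic !coefE /= !(mulr0, mulr1, addr0, add0r).
Qed.

Lemma monic_cubic (R : nzRingType) (a b c : R) : cubic a b c \is monic.
Proof. by rewrite monicE lead_coefE size_cubic coef_cubic. Qed.

Lemma map_cubic (R S : nzRingType) (f : {rmorphism R -> S}) (a b c : R) :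
  map_poly f (cubic a b c) = cubic (f a) (f b) (f c).
Proof.
by rewrite /cubic !rmorphD /= map_polyXn !map_polyZ /= map_polyXn map_polyX map_polyC.
Qed.

Lemma monic_ofE (a b c : int) : monic_of 3 [:: a; b; c] = cubic a%:~R b%:~R c%:~R.
Proof.
rewrite /monic_of !big_ord_recl big_ord0 /= /cubic addr0 !addrA.
by rewrite !mul_polyC subSS subn0 expr1 expr0 alg_polyC.
Qed.

Lemma cubic_roots (R : comNzRingType) (a b c x y z : R) :
  cubic a b c = ('X - x%:P) * ('X - y%:P) * ('X - z%:P) ->
  [/\ a = - (x + y + z), b = x * y + y * z + z * x & c = - (x * y * z)].
Proof.
have -> : ('X - x%:P) * ('X - y%:P) * ('X - z%:P) =
    cubic (- (x + y + z)) (x * y + y * z + z * x) (- (x * y * z)).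
  by rewrite /cubic -!mul_polyC !polyCN !polyCD !polyCM; ring.
move=> h; have e i := congr1 (fun p : {poly R} => p`_i) h.
by have := (e 0%N, e 1%N, e 2%N); rewrite /= !coef_cubic => -[[-> ->] ->].
Qed.

Lemma rat_root_int (p : {poly algC}) (q : rat) : p \is monic ->
  p \is a polyOver Num.int -> root p (ratr q) -> exists n : int, q = n%:~R.
Proof.
move=> pm pZ pq.
have : (ratr q : algC) \in Num.int.
  by apply: Cint_rat_Aint; [apply: Crat_rat | apply: root_monic_Aint pm pZ].
case/intrP => n nE; exists n; apply: (fmorph_inj (ratr : {rmorphism rat -> algC})).
by rewrite /= nE ratr_int.
Qed.

Lemma cubic_rat_root (a b c : int) (q : rat) :
  root (cubic a%:~R b%:~R c%:~R) q ->
  exists n : int, n ^+ 3 + a * n ^+ 2 + b * n + c = 0.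
Proof.
move=> rq; have [|||n nE] := @rat_root_int (cubic a%:~R b%:~R c%:~R) q.
- exact: monic_cubic.
- apply/polyOverP => -[|[|[|[|i]]]]; rewrite ?coef_cubic ?rpred_int ?rpred1 //.
  by rewrite nth_default ?rpred0 // size_cubic.
- have := rq; rewrite -(fmorph_root (ratr : {rmorphism rat -> algC})) map_cubic.
  by rewrite /= !ratr_int.
exists n; move: rq; rewrite nE rootE horner_cubic -!rmorphXn -!intrM -!intrD.
by rewrite intr_eq0 => /eqP.
Qed.

Lemma int_sqr_rat (n : int) (q : rat) : q ^+ 2 = n%:~R -> exists m, n = m ^+ 2.
Proof.
move=> qn; have [|||m mE] := @rat_root_int ('X^2 - n%:~R%:P) q.
- exact: monicXnsubC.
- apply/polyOverP => i; rewrite coefB coefXn coefC rpredB ?rpred_nat //.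
  by case: ifP => _; rewrite ?rpred_int ?rpred0.
- by rewrite rootE !hornerE -rmorphXn qn /= ratr_int subrr.
exists m; apply: (@intr_inj rat); rewrite -qn mE rmorphXn //.
Qed.

Section Action.
Variables (L : splittingFieldType rat) (E : {subfield L}) (rs : seq L).
Hypothesis genE : <<1 & rs>>%VS = E.

Lemma roots_sub : {subset rs <= E}.
Proof.
by have /Fadjoin_seqP[] : (<<1 & rs>> <= E)%VS by rewrite genE.
Qed.

(** The fixed field of [s t^-1] contains the roots, hence the field they generate. *)
Lemma gal_eq_on_roots (s t : gal_of E) : s \in 'Gal(E / 1)%g -> t \in 'Gal(E / 1)%g ->
  {in rs, s =1 t} -> s = t.
Proof.
move=> sG tG st; apply/eqP/gal_eqP => x xE.
pose u := (s * t^-1)%g.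
have uG : u \in 'Gal(E / 1)%g by rewrite groupM ?groupV.
have sub : (E <= fixedField [set u])%VS.
  rewrite -{1}genE; apply/Fadjoin_seqP; split; first exact: sub1v.
  move=> y yr; have yE := roots_sub yr.
  apply/fixedFieldP => // v; rewrite inE => /eqP ->.
  by rewrite galM // st // -galM // mulgV gal_id.
have /mem_fixedFieldP[_ /(_ u)] := subvP sub x xE.
rewrite inE eqxx => /(_ isT) ux.
have := galM (s * t^-1)%g t xE; rewrite -/u mulgKV => ->.
by rewrite ux.
Qed.
End Action.

Lemma gal_root_perm (L : splittingFieldType rat) (E : {subfield L}) (p : {poly rat})
   (s : gal_of E) x : s \in 'Gal(E / 1)%g -> x \in E ->
   root (map_poly (in_alg L) p) x -> root (map_poly (in_alg L) p) (s x).
Proof.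
move=> sG xE rx.
have -> : map_poly (in_alg L) p = map_poly s (map_poly (in_alg L) p).
  apply/polyP => i; rewrite !coef_map /=.
  by rewrite (fixed_gal _ sG) ?sub1v // rpredZ // mem1v.
by rewrite /root horner_map /= (eqP rx) rmorph0.
Qed.

(** Every automorphism fixes the rational root R, and z = - a - R - y, so it is determined by
    whether it fixes y. The group has order at most 2 instead of 6; repeated roots are covered as
    well. *)
Lemma root_not_S3 (a b c r : int) : r ^+ 3 + a * r ^+ 2 + b * r + c = 0 ->
  ~ gal_isog_Sn 3 (monic_of 3 [:: a; b; c]).
Proof.
move=> rE [L [E [[rs pE genE] iso]]].
rewrite monic_ofE in pE.
have := card_isog iso; rewrite cardsT card_Sn => cG.
set P := map_poly _ _ in pE.
have Pm : P \is monic by rewrite map_monic monic_cubic.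
have PE : P = \prod_(z <- rs) ('X - z%:P).
  by apply/eqP; rewrite -eqp_monic // monic_prod_XsubC.
have srs : size rs = 3.
  by have := size_prod_XsubC rs id; rewrite -PE size_map_poly size_cubic => -[].
pose R : L := r%:~R.
have rP : root P R.
  rewrite /P map_cubic rootE horner_cubic /= !scaler_int /R.
  by rewrite -!rmorphXn -!intrM -!intrD rE.
have Rrs : R \in rs by move: rP; rewrite PE root_prod_XsubC.
have [y [z yz]] : exists y z, perm_eq rs [:: R; y; z].
  have := perm_to_rem Rrs; have := size_rem Rrs; rewrite srs.
  by case: (rem R rs) => [|y [|z [|]]] // _ h; exists y, z.
have rsE u : (u \in rs) = [|| u == R, u == y | u == z].
  by rewrite (perm_mem yz) !inE.
have PE3 : P = ('X - R%:P) * ('X - y%:P) * ('X - z%:P).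
  by rewrite PE (perm_big _ yz) /= !big_cons big_nil mulr1 mulrA.
have fixR s : s \in 'Gal(E / 1)%g -> s R = R by move=> sG; rewrite /R rmorph_int.
have zE : z = - a%:~R - R - y.
  move: PE3; rewrite /P map_cubic => /cubic_roots[/= + _ _].
  by rewrite scaler_int => ->; ring.
have yE : y \in E by apply: (roots_sub genE); rewrite rsE eqxx orbT.
have sy s : s \in 'Gal(E / 1)%g -> s y != y -> s y = z.
  move=> sG; have : s y \in rs.
    rewrite -root_prod_XsubC -PE; apply: gal_root_perm => //.
    by rewrite -/P PE root_prod_XsubC rsE eqxx orbT.
  rewrite rsE => /or3P[/eqP e|/eqP->|/eqP->//]; last by rewrite eqxx.
  have e2 : s y = s R by rewrite fixR //.
  by rewrite (fmorph_inj _ e2) fixR // eqxx.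
have inj : {in 'Gal(E / 1)%g &, injective (fun s : gal_of E => s y == y)}.
  move=> s t sG tG /= st; apply: (gal_eq_on_roots genE) => // u.
  have sty : s y = t y.
    have [sy1|sy1] := eqVneq (s y) y; have [ty1|ty1] := eqVneq (t y) y.
    - by rewrite sy1 ty1.
    - by move: st; rewrite sy1 eqxx (negbTE ty1).
    - by move: st; rewrite ty1 eqxx (negbTE sy1).
    by rewrite (sy s) // (sy t).
  rewrite rsE => /or3P[/eqP->|/eqP->|/eqP->] //; first by rewrite !fixR.
  by rewrite zE !rmorphB !rmorphN !rmorph_int /= sty.
have := card_in_imset inj; have := max_card (mem [set (fun s : gal_of E => s y == y) x | x in 'Gal(E / 1)%g]).
by rewrite card_bool => h1 h2; move: h1; rewrite h2 cG.
Qed.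


(** The roots are taken in [algC], and the number field that they generate carries the splitting
    field structure. *)
Lemma splitting_field_cubic (a b c : rat) :
  exists (L : splittingFieldType rat) (x y z : L),
    map_poly (in_alg L) (cubic a b c) = ('X - x%:P) * ('X - y%:P) * ('X - z%:P) /\
    <<1 & [:: x; y; z]>>%VS = fullv.
Proof.
have [rs pE] := closed_field_poly_normal (map_poly (ratr : rat -> algC) (cubic a b c)).
have pm : map_poly (ratr : rat -> algC) (cubic a b c) \is monic.
  by rewrite map_monic monic_cubic.
rewrite (monicP pm) scale1r in pE.
have [Q [QC [s sE gens]]] := num_field_exists rs.
have ss : size s = 3.
  have := congr1 (fun p : {poly algC} => size p) pE.
  by rewrite size_map_poly size_cubic size_prod_XsubC -sE size_map => -[].
case: s ss sE gens => [|x [|y [|z [|]]]] // _ rsE gens.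
have fE : map_poly (in_alg Q) (cubic a b c) = ('X - x%:P) * ('X - y%:P) * ('X - z%:P).
  apply: (map_poly_inj QC); rewrite -map_poly_comp.
  rewrite (eq_map_poly (g := ratr)); last first.
    by move=> u /=; rewrite alg_num_field fmorph_rat.
  by rewrite pE -rsE !big_cons big_nil mulr1 mulrA !rmorphM /= !map_polyXsubC.
have ax : splitting_field_axiom Q.
  exists (map_poly (in_alg Q) (cubic a b c)).
    by apply/polyOverP => i; rewrite coef_map /= rpredZ // mem1v.
  exists [:: x; y; z] => //.
  by rewrite fE !big_cons big_nil mulr1 mulrA eqpxx.
pose QM := FieldExt_isSplittingField.Build rat Q ax.
pose L : splittingFieldType rat := HB.pack Q QM.
by exists L, x, y, z.
Qed.

Lemma cubic_disc (R : comNzRingType) (x y z : R) :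
  let a := - (x + y + z) in let b := x * y + y * z + z * x in let c := - (x * y * z) in
  a ^+ 2 * b ^+ 2 - 4 * a ^+ 3 * c + 18 * a * b * c - 4 * b ^+ 3 - 27 * c ^+ 2 =
  ((x - y) * (y - z) * (z - x)) ^+ 2.
Proof. by move=> a b c; rewrite /a /b /c; ring. Qed.

(** A root has degree 3 because the cubic is irreducible, and [d], a square root of the
    discriminant, has degree 2. So 6 divides the order of the group, which embeds into the
    permutations of the roots. *)
Lemma no_root_S3 (a b c : int) :
  (forall r, r ^+ 3 + a * r ^+ 2 + b * r + c <> 0) ->
  ~ (exists z, cdisc a b c = z ^+ 2) ->
  gal_isog_Sn 3 (monic_of 3 [:: a; b; c]).
Proof.
move=> nr nsq; rewrite monic_ofE.
have [L [x [y [z [fE genE]]]]] := splitting_field_cubic a%:~R b%:~R c%:~R.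
set P := map_poly _ _ in fE.
pose E : {subfield L} := fullv%AS.
have spl : splittingFieldFor 1%AS P E.
  by exists [:: x; y; z]; rewrite ?fE ?genE // !big_cons big_nil mulr1 mulrA eqpxx.
exists L, E; split=> //.
have [aE bE cE] : [/\ (a%:~R : L) = - (x + y + z), (b%:~R : L) = x * y + y * z + z * x
    & (c%:~R : L) = - (x * y * z)].
  by apply: cubic_roots; rewrite -fE /P map_cubic /= !scaler_int.
pose d := (x - y) * (y - z) * (z - x).
have d2 : d ^+ 2 = (cdisc a b c)%:~R.
  rewrite -cubic_disc -aE -bE -cE /cdisc.
  by rewrite /cdisc; ring.
have ratd : d \notin 1%VS.
  apply/vlineP => -[q qE]; apply: nsq; apply: (@int_sqr_rat _ q).
  apply: (fmorph_inj (in_alg L)); rewrite (rmorphXn (in_alg L)) /= -qE d2.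
  by rewrite scaler_int.
have d0 : d != 0 by apply: contraNneq ratd => ->; rewrite mem0v.
have [xy yz zx] : [/\ x != y, y != z & z != x].
  by move: d0; rewrite /d !mulf_eq0 !negb_or !subr_eq0 => /andP[/andP[]].
have urs : uniq [:: x; y; z] by rewrite /= !inE negb_or xy yz eq_sym zx.
have gal : galois 1 E.
  apply/splitting_galoisField; exists P; split=> //.
    by apply/polyOverP => i; rewrite coef_map /= rpredZ // mem1v.
  rewrite (_ : P = \prod_(u <- [:: x; y; z]) ('X - u%:P)); last first.
    by rewrite fE !big_cons big_nil mulr1 mulrA.
  by rewrite separable_prod_XsubC.
have dimG : #|'Gal(E / 1)%g| = \dim E.
  by rewrite -galois_dim // dimv1 divn1.
have irr : irreducible_poly (cubic a%:~R b%:~R c%:~R : {poly rat}).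
  apply: cubic_irreducible => [|q]; first by rewrite size_cubic.
  by apply/negP => /cubic_rat_root[n /nr].
have dx : \dim <<1; x>>%VS = 3%N.
  rewrite dim_Fadjoin dimv1 muln1; apply: succn_inj; rewrite -size_minPoly.
  have /polyOver1P[p pE] := minPolyOver 1 x.
  have : minPoly 1 x %| P.
    apply: minPoly_dvdp.
      by apply/polyOverP => i; rewrite coef_map /= rpredZ // mem1v.
    by rewrite fE !rootM root_XsubC eqxx.
  rewrite pE dvdp_map => /irr.2 h; rewrite size_map_poly.
  rewrite (eqp_size (h _)) ?size_cubic //.
  by have := size_minPoly 1 x; rewrite pE size_map_poly => ->.
have dd : \dim <<1; d>>%VS = 2%N.
  rewrite dim_Fadjoin dimv1 muln1; apply/eqP; rewrite eqn_leq; apply/andP; split.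
    rewrite -ltnS -size_minPoly.
    have h : minPoly 1 d %| 'X^2 - (d ^+ 2)%:P.
      apply: minPoly_dvdp; last by rewrite rootE !hornerE subrr.
      apply/polyOverP => i; rewrite coefB coefXn coefC rpredB ?rpred_nat //.
      by case: ifP => _; rewrite ?rpred0 // d2 rpred_int.
    have := dvdp_leq _ h; rewrite size_XnsubC // => -> //.
    by rewrite -size_poly_eq0 size_XnsubC.
  by rewrite ltn_neqAle eq_sym adjoin_deg_eq1 ratd.
have six : (6 %| #|'Gal(E / 1)%g|)%N.
  rewrite dimG (_ : 6 = 3 * 2)%N // Gauss_dvd //.
  by rewrite -{1}dx -dd !field_dimS ?subvf.
pose rt := tnth [tuple x; y; z].
have rtI : injective rt.
  by move=> i j; rewrite /rt !(tnth_nth 0) /= => /eqP; rewrite nth_uniq // => /eqP/val_inj.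
have rtP u : root P u -> exists i, u = rt i.
  rewrite fE !rootM !root_XsubC => h.
  have /tnthP[i ->] : u \in [tuple x; y; z] by rewrite !inE orbA.
  by exists i.
have Prt i : root P (rt i).
  have : rt i \in [tuple x; y; z] by apply: mem_tnth.
  by rewrite fE !rootM !root_XsubC !inE orbA.
have /choice[phi phiP] (s : gal_of E) :
    exists p : 'S_3, s \in 'Gal(E / 1)%g -> forall i, s (rt i) = rt (p i).
  have [sG|] := boolP (s \in 'Gal(E / 1)%g); last by exists 1%g.
  have /choice[f fP] i : exists j, s (rt i) = rt j.
    by apply: rtP; apply: gal_root_perm; rewrite ?memvf.
  have fI : injective f.
    move=> i j ij; have e : s (rt i) = s (rt j) by rewrite !fP ij.
    exact: rtI (fmorph_inj _ e).
  by exists (perm fI) => _ i; rewrite permE.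
have phiM : {in 'Gal(E / 1)%g &, {morph phi : s t / (s * t)%g}}.
  move=> s t sG tG /=; apply/permP => i; apply: rtI.
  by rewrite -phiP ?groupM // galM ?memvf // permM phiP // phiP.
have phiI : {in 'Gal(E / 1)%g &, injective phi}.
  move=> s t sG tG st; apply: (gal_eq_on_roots (rs := [:: x; y; z]) (E := E)) => // u.
  move=> urs0; have /tnthP[i ->] : u \in [tuple x; y; z] by [].
  by rewrite -/rt phiP // phiP // st.
apply/isogP; exists (Morphism phiM); first exact/injmP.
apply/eqP; rewrite eqEcard finset.subsetT card_injm //=; last exact/injmP.
rewrite cardsT card_Sn; apply: dvdn_leq => //; exact: cardG_gt0.
Qed.

(** * The Basel sum *)


Section Basel.
Variable R : realType.
Implicit Types x : R.

Lemma sin_le_id x : 0 < x -> sin x <= x.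
Proof.
move=> x0; have [|c _] := @MVT R sin cos 0 x x0 (fun c _ => is_derive_sin c).
  exact/continuous_subspaceT/continuous_sin.
rewrite sin0 !subr0 => ->; rewrite -[X in _ <= X]mul1r.
by rewrite ler_wpM2r ?cos_le1 // ltW.
Qed.

Lemma cos_gt0_half x : 0 <= x < pi / 2 -> 0 < cos x.
Proof.
move=> /andP[x0 x1]; apply: cos_gt0_pihalf; rewrite x1 andbT.
by apply: lt_le_trans x0; rewrite oppr_lt0 divr_gt0 ?pi_gt0.
Qed.

Lemma id_le_tan x : 0 < x < pi / 2 -> x * cos x <= sin x.
Proof.
move=> /andP[x0 x1].
have cx y : y \in `[0, x] -> 0 < cos y.
  rewrite in_itv /= => /andP[y0 yx]; apply: cos_gt0_half.
  by rewrite y0 (le_lt_trans yx).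
have [||c cI] := @MVT R tan (fun y => (cos y)^-2) 0 x x0.
- move=> y /subset_itv_oo_cc yI; apply: is_derive_tan.
  by rewrite gt_eqF // cx.
- apply: continuous_in_subspaceT => y /[1!inE] yI.
  by apply: continuous_tan; rewrite gt_eqF // cx.
have x_in : x \in `[0, x] by rewrite in_itv /= (ltW x0) lexx.
have cc : 0 < cos c by apply: cx; exact: subset_itv_oo_cc cI.
rewrite tan0 !subr0 => tE; rewrite -ler_pdivlMr ?cx // -[_ / _]/(tan x) tE.
by rewrite ler_peMl ?(ltW x0) // invf_ge1 ?exprn_gt0 // exprn_ile1 ?cos_le1 // ltW.
Qed.

(** sin x <= x <= tan x, inverted and squared; the lower bound is the square of the cotangent. *)
Lemma invsqr_bounds x : 0 < x < pi / 2 ->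
  (sin x ^+ 2)^-1 - 1 <= (x ^+ 2)^-1 <= (sin x ^+ 2)^-1.
Proof.
move=> /[dup] xI /andP[x0 x1].
have sx : 0 < sin x by apply: sin_gt0_pihalf.
have cx : 0 < cos x by apply: cos_gt0_half; rewrite ltW.
apply/andP; split; last first.
  by rewrite lef_pV2 ?posrE ?exprn_gt0 // ler_pXn2r ?nnegrE ?sin_le_id // ltW.
have -> : (sin x ^+ 2)^-1 - 1 = cos x ^+ 2 / sin x ^+ 2.
  by rewrite cos2sin2 mulrBl mul1r divff // gt_eqF // exprn_gt0.
rewrite ler_pdivrMr ?exprn_gt0 // mulrC ler_pdivlMr ?exprn_gt0 // -exprMn mulrC.
by rewrite ler_pXn2r ?nnegrE ?id_le_tan // ltW // mulr_gt0.
Qed.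

Lemma invsqr_sin_double x : 0 < x < pi / 2 ->
  (sin x ^+ 2)^-1 + (sin (pi / 2 - x) ^+ 2)^-1 = 4 * (sin (2 * x) ^+ 2)^-1.
Proof.
move=> /[dup] xI /andP[x0 x1].
have sx : 0 < sin x by apply: sin_gt0_pihalf.
have cx : 0 < cos x by apply: cos_gt0_half; rewrite ltW.
have -> : sin (pi / 2 - x) = cos x by rewrite sinB sin_pihalf cos_pihalf; ring.
rewrite [2 * x]mulrC mulr_natr sin_mulr2n.
have -> : (sin x ^+ 2)^-1 + (cos x ^+ 2)^-1 =
    (cos x ^+ 2 + sin x ^+ 2) / (cos x ^+ 2 * sin x ^+ 2).
  by field; rewrite !gt_eqF.
by rewrite cos2Dsin2; field; rewrite !gt_eqF.
Qed.

Definition odd_angle (n k : nat) : R := (k.*2.+1)%:R * (pi / (2 ^ n.+2)%:R).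

Lemma odd_angle_itv n k : (k < 2 ^ n)%N -> 0 < odd_angle n k < pi / 2.
Proof.
move=> kn; have p0 : 0 < pi / (2 ^ n.+2)%:R :> R.
  by rewrite divr_gt0 ?pi_gt0 // ltr0n expn_gt0.
rewrite /odd_angle mulr_gt0 ?ltr0n //=.
have -> : pi / 2 = (2 ^ n.+1)%:R * (pi / (2 ^ n.+2)%:R) :> R.
  rewrite (expnS 2 n.+1) natrM; field.
  by rewrite pnatr_eq0 -lt0n expn_gt0.
rewrite ltr_pM2r // ltr_nat expnS; lia.
Qed.

(* Pairing the angles [x] and [pi / 2 - x] doubles the angles and quadruples the
   sum (Hofbauer). *)
Lemma sum_invsqr_sin n :
  \sum_(k < 2 ^ n) (sin (odd_angle n k) ^+ 2)^-1 = (4 ^ n.+1)%:R / 2.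
Proof.
elim: n => [|n IH].
  rewrite expn0 big_ord_recl big_ord0 addr0 /odd_angle /= mul1r.
  have := @invsqr_sin_double (pi / 4); rewrite (_ : pi / 2 - pi / 4 = pi / 4); last by field.
  rewrite (_ : 2 * (pi / 4) = pi / 2); last by field.
  rewrite sin_pihalf expr1n invr1 mulr1 => h.
  have : 0 < (pi : R) / 4 < pi / 2.
    have := pi_gt0 R => p0; apply/andP; split; lra.
  by move/h; rewrite -[(2 ^ 2)%:R]/(4%:R); lra.
have e2 : (2 ^ n.+1 = 2 ^ n + 2 ^ n)%N by rewrite expnS mul2n addnn.
rewrite -(big_mkord xpredT (fun k => (sin (odd_angle n.+1 k) ^+ 2)^-1)).
(* The second half of the sum is reversed, so that index [k] meets the index whose angle is [pi / 2]
   minus its own. *)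
rewrite e2 (big_cat_nat (n := 2 ^ n)) ?leq_addr //=.
rewrite -{2}[(2 ^ n)%N]add0n big_addn addnK [X in _ + X]big_nat_rev /= add0n.
rewrite -big_split /= big_mkord.
rewrite (eq_bigr (fun k : 'I_(2 ^ n) => 4 * (sin (odd_angle n k) ^+ 2)^-1)).
  by rewrite -mulr_sumr IH [in RHS]expnS natrM; field.
move=> k _; have kn := ltn_ord k.
have h : 0 < odd_angle n.+1 k < pi / 2.
  by apply: odd_angle_itv; apply: leq_trans kn _; rewrite e2 leq_addr.
have p0 : (2 ^ n)%:R != 0 :> R by rewrite pnatr_eq0 -lt0n expn_gt0.
have -> : odd_angle n.+1 (2 ^ n - k.+1 + 2 ^ n) = pi / 2 - odd_angle n.+1 k.
  have q : ((2 ^ n - k.+1 + 2 ^ n).*2.+1 + k.*2.+1 = 2 ^ n.+2)%N.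
    rewrite !expnS; lia.
  apply/eqP; rewrite eq_sym subr_eq -mulrDl -natrD q; apply/eqP.
  by rewrite (expnS 2 n.+2) natrM; field; rewrite pnatr_eq0 -lt0n expn_gt0.
rewrite invsqr_sin_double //; congr (4 * (sin _ ^+ 2)^-1).
by rewrite /odd_angle !expnS !natrM; field.
Qed.

Definition sum_invsqr (N : nat) : R := \sum_(k < N) (k.+1%:R ^+ 2)^-1.
Definition sum_odd_invsqr (N : nat) : R := \sum_(k < N) (k.*2.+1%:R ^+ 2)^-1.

(** Replacing 1 / sin^2 by 1 / x^2 costs at most 1 per term, thus q = 2^n in total, which the factor
    pi^2 / (16 q^2) turns into pi^2 / (16 q). *)
Lemma sum_odd_bounds n :
  pi ^+ 2 / 8 - pi ^+ 2 / 16 / (2 ^ n)%:R <= sum_odd_invsqr (2 ^ n) <= pi ^+ 2 / 8.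
Proof.
have p0 := pi_gt0 R.
set q : R := (2 ^ n)%:R; have q0 : 0 < q by rewrite ltr0n expn_gt0.
have q2 : (2 ^ n.+2)%:R = 4 * q by rewrite !expnS !natrM mulrA -natrM.
have q4 : (4 ^ n.+1)%:R = 4 * q ^+ 2 :> R.
  by rewrite expnS natrM /q -natrX -expnM mulnC expnM.
have E : sum_odd_invsqr (2 ^ n) =
    pi ^+ 2 / (16 * q ^+ 2) * \sum_(k < 2 ^ n) (odd_angle n k ^+ 2)^-1.
  rewrite mulr_sumr; apply: eq_bigr => k _; rewrite /odd_angle q2.
  have w0 : (k.*2.+1)%:R != 0 :> R by rewrite pnatr_eq0.
  move: (k.*2.+1)%:R w0 (q) q0 (pi) p0 => w w0 u u0 v v0.
  by field; rewrite w0 !gt_eqF.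
have S2 : \sum_(k < 2 ^ n) (odd_angle n k ^+ 2)^-1 <= 4 * q ^+ 2 / 2.
  rewrite -q4 -sum_invsqr_sin; apply: ler_sum => k _.
  by have /andP[] := invsqr_bounds (odd_angle_itv (ltn_ord k)).
have S1 : 4 * q ^+ 2 / 2 - q <= \sum_(k < 2 ^ n) (odd_angle n k ^+ 2)^-1.
  rewrite -q4 -sum_invsqr_sin.
  have -> : q = \sum_(k < 2 ^ n) 1 by rewrite sumr_const card_ord.
  rewrite -sumrB; apply: ler_sum => k _.
  by have /andP[] := invsqr_bounds (odd_angle_itv (ltn_ord k)).
have c0 : 0 < pi ^+ 2 / (16 * q ^+ 2) by rewrite divr_gt0 ?mulr_gt0 ?exprn_gt0.
rewrite E; apply/andP; split.
  apply: le_trans (_ : pi ^+ 2 / (16 * q ^+ 2) * (4 * q ^+ 2 / 2 - q) <= _).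
    by rewrite le_eqVlt; apply/orP; left; apply/eqP; field; rewrite gt_eqF.
  by rewrite ler_pM2l.
apply: le_trans (_ : _ <= pi ^+ 2 / (16 * q ^+ 2) * (4 * q ^+ 2 / 2)) _.
  by rewrite ler_pM2l.
by rewrite le_eqVlt; apply/orP; left; apply/eqP; field; rewrite gt_eqF.
Qed.

Lemma sum_invsqr_double N : sum_invsqr (N + N) = sum_odd_invsqr N + sum_invsqr N / 4.
Proof.
elim: N => [|N IH]; first by rewrite /sum_invsqr /sum_odd_invsqr !big_ord0 mul0r addr0.
rewrite addSn addnS /sum_invsqr !big_ord_recr /= -/(sum_invsqr _) -/(sum_invsqr _).
rewrite IH /sum_odd_invsqr big_ord_recr /= addnn.
have -> : (N.*2.+2 = 2 * N.+1)%N by lia.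
by rewrite natrM; field; rewrite !nat1r !pnatr_eq0.
Qed.

(** Doubling divides the error by 4 and adds at most pi^2 / 16 / 2^n; pi^2 / 4 is the constant C
    with C / 4 + pi^2 / 16 = C / 2. *)
Lemma basel_pow2 n : `|pi ^+ 2 / 6 - sum_invsqr (2 ^ n)| <= pi ^+ 2 / 4 / (2 ^ n)%:R.
Proof.
have p2 : 4 <= pi ^+ 2 :> R.
  have := pi_ge2 R => h; nra.
elim: n => [|n IH].
  rewrite expn0 /sum_invsqr big_ord_recl big_ord0 /= expr1n invr1.
  by rewrite ler_norml; apply/andP; split; lra.
have /andP[o1 o2] := sum_odd_bounds n.
rewrite expnS mul2n -addnn sum_invsqr_double natrD.
have q0 : 0 < (2 ^ n)%:R :> R by rewrite ltr0n expn_gt0.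
move: o1 o2 IH; rewrite !ler_norml -[(2 ^ n)%:R + _]mulr2n -[_ *+ 2]mulr_natl invfM.
have : 0 < (2 ^ n)%:R^-1 :> R by rewrite invr_gt0.
have : 0 < pi ^+ 2 / (2 ^ n)%:R :> R by rewrite divr_gt0 // exprn_gt0 ?pi_gt0.
move: (sum_odd_invsqr _) (sum_invsqr _) ((2 ^ n)%:R^-1) => o s q h0 h1 h2 h3 /andP[h4 h5].
apply/andP; split; lra.
Qed.

Lemma sum_invsqr_le M N : (M <= N)%N -> sum_invsqr M <= sum_invsqr N.
Proof.
move=> /subnKC <-; elim: (N - M)%N => [|k IH]; first by rewrite addn0.
apply: le_trans IH _; rewrite addnS /sum_invsqr big_ord_recr /= lerDl.
by rewrite invr_ge0 exprn_ge0.
Qed.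

(** The partial sums increase, so [N] is squeezed between consecutive powers of 2; N < 2^(n+1)
    doubles the constant. *)
Lemma basel N : (0 < N)%N -> `|sum_invsqr N - pi ^+ 2 / 6| <= pi ^+ 2 / 2 / N%:R.
Proof.
move=> N0; set n := trunc_log 2 N.
have n1 : (2 ^ n <= N)%N by apply: trunc_logP.
have n2 : (N < 2 ^ n.+1)%N by apply: trunc_log_ltn.
have s1 := sum_invsqr_le n1; have s2 := sum_invsqr_le (ltnW n2).
have := basel_pow2 n; have := basel_pow2 n.+1; rewrite !ler_norml.
have q0 : 0 < (2 ^ n)%:R :> R by rewrite ltr0n expn_gt0.
have N0' : 0 < N%:R :> R by rewrite ltr0n.
have p0 : 0 < pi ^+ 2 :> R by rewrite exprn_gt0 ?pi_gt0.
have r1 : pi ^+ 2 / 4 / (2 ^ n)%:R <= pi ^+ 2 / 2 / N%:R :> R.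
  rewrite ler_pdivrMr // [X in _ <= X]mulrAC ler_pdivlMr //.
  have : N%:R <= 2 * (2 ^ n)%:R :> R by rewrite -natrM -expnS ler_nat ltnW.
  nra.
have r2 : pi ^+ 2 / 4 / (2 ^ n.+1)%:R <= pi ^+ 2 / 4 / (2 ^ n)%:R :> R.
  rewrite ler_pM2l ?divr_gt0 // lef_pV2 ?posrE ?ltr0n ?expn_gt0 // ler_nat.
  by rewrite leq_pexp2l.
move=> /andP[h1 h2] /andP[h3 h4]; apply/andP; split; lra.
Qed.
End Basel.

(** * Counting cubics with a given root *)


Definition atleast (T : eqType) (P : T -> Prop) (c : nat) : Prop :=
  exists s : seq T, [/\ uniq s, forall x, x \in s -> P x & size s = c].

Lemma atleast_inj (T U : eqType) (P : T -> Prop) (Q : U -> Prop) (f : U -> T) c :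
  (forall u, Q u -> P (f u)) -> (forall u v, Q u -> Q v -> f u = f v -> u = v) ->
  atleast Q c -> atleast P c.
Proof.
move=> QP fI [s [us sQ <-]]; exists (map f s); split; last by rewrite size_map.
  by rewrite map_inj_in_uniq // => u v /sQ Qu /sQ Qv; apply: fI.
by move=> x /mapP[u /sQ Qu ->]; apply: QP.
Qed.

Lemma atleast_pair (T U : eqType) (P : T -> Prop) (Q : U -> Prop) c d :
  atleast P c -> atleast Q d -> atleast (fun z => P z.1 /\ Q z.2) (c * d).
Proof.
move=> [s [us sP <-]] [t [ut tQ <-]]; exists [seq (x, y) | x <- s, y <- t].
split; last by rewrite size_allpairs.
  by apply: allpairs_uniq => // -[? ?] [? ?].
by move=> z /allpairsP[[x y] [/= xs yt ->]]; split; [apply: sP | apply: tQ].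
Qed.

Lemma atleast_or (T : eqType) (P Q R : T -> Prop) c d :
  (forall x, P x -> R x) -> (forall x, Q x -> R x) -> (forall x, P x -> Q x -> False) ->
  atleast P c -> atleast Q d -> atleast R (c + d).
Proof.
move=> PR QR PQ [s [us sP <-]] [t [ut tQ <-]]; exists (s ++ t); split.
- rewrite cat_uniq us ut andbT /=; apply/hasPn => x /tQ Qx.
  by apply/negP => /sP Px; apply: PQ Px Qx.
- by move=> x; rewrite mem_cat => /orP[/sP/PR|/tQ/QR].
by rewrite size_cat.
Qed.

Lemma atleast_range (lo : int) (n : nat) : atleast (fun i : int => lo <= i < lo + n%:Z) n.
Proof.
exists [seq lo + i%:Z | i <- iota 0 n]; split; last by rewrite size_map size_iota.
  by rewrite map_inj_uniq ?iota_uniq // => i j; lia.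
by move=> x /mapP[i]; rewrite mem_iota => ? ->; lia.
Qed.

Lemma atmost_range (lo : int) (n : nat) : atmost (fun i : int => lo <= i < lo + n%:Z) n.
Proof.
apply: (@atmost_inj _ _ _ (fun i => i \in iota 0 n) (fun j => absz (j - lo))).
- by move=> j; rewrite mem_iota; lia.
- by move=> j j'; lia.
by rewrite -{2}(size_iota 0 n); apply: atmost_seq.
Qed.

Lemma count_atmost (T : eqType) (p : pred T) (s : seq T) c :
  uniq s -> atmost (fun x => x \in s /\ p x) c -> (count p s <= c)%N.
Proof.
move=> us; rewrite -size_filter; apply; first exact: filter_uniq.
by move=> x; rewrite mem_filter => /andP[].
Qed.

Lemma count_atleast (T : eqType) (p : pred T) (s : seq T) c :
  atleast (fun x => x \in s /\ p x) c -> (c <= count p s)%N.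
Proof.
move=> [t [ut tP <-]]; rewrite -size_filter; apply: uniq_leq_size => // x /tP[xs px].
by rewrite mem_filter px.
Qed.

Definition irange (N : nat) : seq int := [seq i%:Z - N%:Z | i <- iota 0 (N + N).+1].

Lemma irange_uniq N : uniq (irange N).
Proof. by rewrite map_inj_uniq ?iota_uniq // => i j; lia. Qed.

Lemma mem_irange N i : (i \in irange N) = (`|i| <= N%:Z).
Proof.
apply/mapP/idP => [[j]|h]; first by rewrite mem_iota => ? ->; lia.
by exists (absz (i + N%:Z)); rewrite ?mem_iota; lia.
Qed.

Definition box_seq (N : nat) : seq (int * int * int) :=
  [seq (p, c) | p <- [seq (a, b) | a <- irange N, b <- irange N], c <- irange N].

Lemma box_seq_uniq N : uniq (box_seq N).
Proof.
apply: allpairs_uniq; rewrite ?irange_uniq //; last by move=> [? ?] [? ?].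
by apply: allpairs_uniq; rewrite ?irange_uniq // => -[? ?] [? ?].
Qed.

Lemma mem_box_seq N t : t \in box_seq N <-> box N t.
Proof.
case: t => [[a b] c]; rewrite /box /=; split.
  case/allpairsP => -[p c'] [pin cN [pE cE]].
  move: pin; rewrite -[(p, c').1]/p -pE => /allpairsP[[a' b'] [aN bN [-> ->]]].
  by rewrite cE -!mem_irange.
move=> [aN bN cN]; apply/allpairsP; exists ((a, b), c); split => //; last first.
  by rewrite mem_irange.
by apply/allpairsP; exists (a, b); rewrite !mem_irange.
Qed.

Definition cubic_val (t : int * int * int) (r : int) : int :=
  r ^+ 3 + t.1.1 * r ^+ 2 + t.1.2 * r + t.2.

Lemma dvdz_le (r c : int) (N : int) : c != 0 -> (r %| c)%Z -> `|c| <= N -> `|r| <= N.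
Proof.
move=> c0; rewrite dvdzE => h cN; apply: le_trans cN.
by have := dvdn_leq _ h; lia.
Qed.

(** A nonzero root divides the lowest nonzero coefficient [c] or [b], and equals - a if both
    vanish. *)
Lemma root_le (N : int) t r : box N t -> cubic_val t r = 0 -> `|r| <= N.
Proof.
case: t => [[a b] c] [/= aN bN cN]; rewrite /cubic_val /= => h.
have [c0|c0] := eqVneq c 0; last first.
  apply: dvdz_le c0 _ cN; apply/dvdzP; exists (- (r ^+ 2 + a * r + b)).
  by apply/eqP; rewrite -subr_eq0; apply/eqP; rewrite -[RHS]h; ring.
have [->|r0] := eqVneq r 0; first by rewrite normr0; apply: le_trans aN.
have {}h : r ^+ 2 + a * r + b = 0.
  by apply: (mulfI r0); rewrite mulr0 -[RHS]h c0; ring.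
have [b0|b0] := eqVneq b 0; last first.
  apply: dvdz_le b0 _ bN; apply/dvdzP; exists (- (r + a)).
  by apply/eqP; rewrite -subr_eq0; apply/eqP; rewrite -[RHS]h; ring.
have : r * (r + a) = 0 by rewrite -[RHS]h b0; ring.
move/eqP; rewrite mulf_eq0 (negbTE r0) /= => /eqP ra.
have -> : r = - a by lia.
by rewrite normrN.
Qed.

Lemma two_roots_factor (t : int * int * int) (r s : int) : r != s ->
  cubic_val t r = 0 -> cubic_val t s = 0 ->
  let u := - t.1.1 - r - s in
  (forall x, cubic_val t x = (x - r) * (x - s) * (x - u)) /\
  cdisc t.1.1 t.1.2 t.2 = ((r - s) * (s - u) * (u - r)) ^+ 2.
Proof.
case: t => [[a b] c]; rewrite /cubic_val /= => rs hr hs; set u := - a - r - s.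
have bE : b = r * s + s * u + u * r.
  have rs0 : r - s != 0 by rewrite subr_eq0.
  apply: (mulfI rs0).
  have : (r - s) * b = (r ^+ 3 + a * r ^+ 2 + b * r + c) - (s ^+ 3 + a * s ^+ 2 + b * s + c)
     + (r - s) * (r * s + s * u + u * r) by rewrite /u; ring.
  by rewrite hr hs subrr add0r.
have cE : c = - (r * s * u).
  have : c = (r ^+ 3 + a * r ^+ 2 + b * r + c) - (r ^+ 3 + a * r ^+ 2 + b * r) by ring.
  by rewrite hr => ->; rewrite bE /u; ring.
have aE : a = - (r + s + u) by rewrite /u; ring.
clearbody u; rewrite bE cE aE; split; first by move=> x; ring.
by rewrite /cdisc; ring.
Qed.

(** Roots are counted without multiplicity; by [root_le] the range misses none when [t] lies in the
    box. *)
Definition nroots N t := count (fun r => cubic_val t r == 0) (irange N).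

Lemma nroots_gt0 N t : (0 < nroots N t)%N -> exists r, cubic_val t r = 0.
Proof. by rewrite -has_count => /hasP[r _ /eqP]; exists r. Qed.

Lemma root_nroots (N : nat) t r : box N t -> cubic_val t r = 0 -> (0 < nroots N t)%N.
Proof.
move=> tN rt; rewrite -has_count; apply/hasP; exists r; last by rewrite rt.
by rewrite mem_irange (root_le tN rt).
Qed.

Lemma nroots_square N t : (1 < nroots N t)%N ->
  (nroots N t <= 3)%N /\ square_disc t.
Proof.
rewrite /nroots -size_filter; set s := seq.filter _ _.
have us : uniq s by rewrite filter_uniq ?irange_uniq.
have sP r : r \in s -> cubic_val t r = 0 by rewrite mem_filter => /andP[/eqP].
case: s us sP => [|x [|y s]] //= us sP _.
have xy : x != y by move: us; rewrite inE negb_or -andbA => /and3P[].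
have rx : cubic_val t x = 0 by apply: sP; rewrite inE eqxx.
have ry : cubic_val t y = 0 by apply: sP; rewrite !inE eqxx orbT.
have [fE dE] := @two_roots_factor t x y xy rx ry.
split; last by eexists; rewrite dE.
apply: (@uniq_leq_size _ (x :: y :: s) [:: x; y; - t.1.1 - x - y]) => // z /sP.
move/eqP; rewrite fE !mulf_eq0 !subr_eq0 !inE => /orP[/orP[->//|->]|->]; rewrite ?orbT //.
Qed.


Definition root_count (N : nat) (r : int) : nat :=
  count (fun t => cubic_val t r == 0) (box_seq N).

Lemma root_count_le (N : nat) r c :
  atmost (fun t => box N t /\ cubic_val t r = 0) c -> (root_count N r <= c)%N.
Proof.
move=> h; apply: count_atmost; first exact: box_seq_uniq.
by apply: atmost_sub h => // t [/mem_box_seq tN /eqP].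
Qed.

Lemma root_count_ge (N : nat) r c :
  atleast (fun t => box N t /\ cubic_val t r = 0) c -> (c <= root_count N r)%N.
Proof.
move=> h; apply: count_atleast; apply: (@atleast_inj _ _ _ _ id _ _ _ h) => // t [tN rt].
by split; [apply/mem_box_seq | rewrite rt].
Qed.

Lemma root_countN_le N r : (root_count N (- r) <= root_count N r)%N.
Proof.
apply: root_count_ge.
exists [seq (- t.1.1, t.1.2, - t.2) | t <- box_seq N & cubic_val t (- r) == 0]; split.
- rewrite map_inj_uniq ?filter_uniq ?box_seq_uniq // => -[[a b] c] [[a' b'] c'] /=.
  by case=> /oppr_inj -> -> /oppr_inj ->.
- move=> t /mapP[[[a b] c]]; rewrite mem_filter => /andP[/eqP h /mem_box_seq[/= aN bN cN]] ->.
  split; first by split; rewrite /= ?normrN.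
  move: h; rewrite /cubic_val /= => h; apply: oppr_inj; rewrite oppr0 -[RHS]h; ring.
by rewrite size_map size_filter.
Qed.

Lemma root_countN N r : root_count N (- r) = root_count N r.
Proof.
apply/eqP; rewrite eqn_leq root_countN_le /=.
by have := root_countN_le N (- r); rewrite opprK.
Qed.

Lemma root_count0 N : root_count N 0 = ((N + N).+1 * (N + N).+1)%N.
Proof.
have E (a b c : int) : cubic_val (a, b, c) 0 = c by rewrite /cubic_val /=; ring.
apply/eqP; rewrite eqn_leq; apply/andP; split.
  apply: root_count_le; apply: (atmost_inj _ _ (f := fst)
    (atmost_pair (@atmost_int_abs N) (@atmost_int_abs N))).
    by move=> t [[? ? ?] _].
  move=> [[a b] c] [[a' b'] c'] [_ +] [_ +] /= [-> ->].
  by rewrite !E => -> ->.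
apply: root_count_ge; apply: (atleast_inj _ _ (f := fun p : int * int => (p, 0))
  (atleast_pair (atleast_range (- N%:Z) (N + N).+1) (atleast_range (- N%:Z) (N + N).+1))).
  move=> [a b] [/= h1 h2]; rewrite E; split=> //; rewrite /box /=.
  by split; [lia | lia | rewrite normr0].
by move=> p q _ _ [].
Qed.

(* The solutions of a + b + c = -1 are split into three parallelograms
   according to the cyclic position of a nonnegative coordinate followed by a
   negative one. *)
Lemma root_count1 N : root_count N 1 = (N.+1 * N + N.+1 * N + N.+1 * N)%N.
Proof.
have E (a b c : int) : cubic_val (a, b, c) 1 = 1 + a + b + c.
  by rewrite /cubic_val /=; ring.
pose Q (p : int * int) := 0 <= p.1 < 0 + (N.+1)%:Z /\ - N%:Z <= p.2 < - N%:Z + N%:Z.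
have Qa : atmost Q (N.+1 * N) by exact: (atmost_pair (@atmost_range 0 N.+1) (@atmost_range (- N%:Z) N)).
have Ql : atleast Q (N.+1 * N) by exact: (atleast_pair (@atleast_range 0 N.+1) (@atleast_range (- N%:Z) N)).
pose P (x y : int * int * int -> int) (t : int * int * int) :=
  [/\ box N t, cubic_val t 1 = 0, 0 <= x t & y t < 0].
pose a (t : int * int * int) : int := t.1.1; pose b (t : int * int * int) : int := t.1.2.
pose c (t : int * int * int) : int := t.2.
have Pa (x y : int * int * int -> int) (f : int * int * int -> int * int) :
    (forall t, box N t -> cubic_val t 1 = 0 ->
      [/\ `|x t| <= N%:Z, `|y t| <= N%:Z & f t = (x t, y t)]) ->
    (forall t t', cubic_val t 1 = 0 -> cubic_val t' 1 = 0 -> f t = f t' -> t = t') ->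
    atmost (P x y) (N.+1 * N).
  move=> fE fI; apply: (atmost_inj _ _ (f := f) Qa).
    by move=> t [tN rt x0 y0]; have [h1 h2 ->] := fE t tN rt; rewrite /Q /=; lia.
  by move=> t t' [_ rt _ _] [_ rt' _ _]; apply: fI.
apply/eqP; rewrite eqn_leq; apply/andP; split.
  apply: root_count_le.
  have h1 : atmost (P a b) (N.+1 * N).
    apply: (Pa a b (fun t => (a t, b t))); first by move=> t [].
    move=> [[u v] w] [[u' v'] w']; rewrite !E /a /b /= => h h' [e1 e2].
    by subst; congr pair; lia.
  have h2 : atmost (P b c) (N.+1 * N).
    apply: (Pa b c (fun t => (b t, c t))); first by move=> t [].
    move=> [[u v] w] [[u' v'] w']; rewrite !E /c /b /= => h h' [e1 e2].
    by subst; congr (_, _, _); lia.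
  have h3 : atmost (P c a) (N.+1 * N).
    apply: (Pa c a (fun t => (c t, a t))); first by move=> t [].
    move=> [[u v] w] [[u' v'] w']; rewrite !E /c /a /= => h h' [e1 e2].
    by subst; congr (_, _, _); lia.
  apply: (atmost_sub _ (leqnn _) (atmost_or (atmost_or h1 h2 (fun _ => EM _)) h3 (fun _ => EM _))).
  move=> [[u v] w] [tN]; rewrite E => h.
  have : (0 <= u /\ v < 0) \/ (0 <= v /\ w < 0) \/ (0 <= w /\ u < 0) by lia.
  case=> [[? ?]|[[? ?]|[? ?]]]; [left; left|left; right|right]; split; rewrite ?E //.
apply: root_count_ge.
have l1 : atleast (P a b) (N.+1 * N).
  apply: (atleast_inj _ _ (f := fun p : int * int => (p.1, p.2, - 1 - p.1 - p.2)) Ql).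
    move=> [u v] [/= h1 h2]; split; rewrite ?E /a /b /box /=; try lia; split; lia.
  by move=> [u v] [u' v'] _ _ /= [-> ->].
have l2 : atleast (P b c) (N.+1 * N).
  apply: (atleast_inj _ _ (f := fun p : int * int => (- 1 - p.1 - p.2, p.1, p.2)) Ql).
    move=> [u v] [/= h1 h2]; split; rewrite ?E /c /b /box /=; try lia; split; lia.
  by move=> [u v] [u' v'] _ _ /= [_ -> ->].
have l3 : atleast (P c a) (N.+1 * N).
  apply: (atleast_inj _ _ (f := fun p : int * int => (p.2, - 1 - p.1 - p.2, p.1)) Ql).
    move=> [u v] [/= h1 h2]; split; rewrite ?E /c /a /box /=; try lia; split; lia.
  by move=> [u v] [u' v'] _ _ /= [-> _ ->].
pose R t := P a b t \/ P b c t.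
have l12 : atleast R (N.+1 * N + N.+1 * N).
  apply: (atleast_or _ _ _ l1 l2); rewrite /R; try tauto.
  by move=> t [_ _ _ h1] [_ _ h2 _]; move: h1 h2; rewrite /b; lia.
apply: (atleast_or _ _ _ l12 l3).
- by move=> t [|] [].
- by move=> t [].
by move=> t [[_ _ h1 h2]|[_ _ h1 h2]] [_ _ h3 h4]; move: h1 h2 h3 h4; rewrite /a /b /c; lia.
Qed.

(** With p = a + r one has q = b + r p and c = - r q. The bound on [c] leaves 2 (N %/ r) + 1 values
    of q, and |q - r p| <= N confines p to an interval of length 2 N / r. The bound on [a] is
    dropped. *)
Lemma root_count_upper (N r : nat) : (0 < r)%N ->
  (root_count N r <= (N %/ r + N %/ r).+1 * ((N + N) %/ r).+1)%N.
Proof.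
move=> r0; apply: root_count_le; set M := (N %/ r)%N.
have rz : r%:Z != 0 by lia.
pose q (t : int * int * int) : int := t.1.2 + r%:Z * (t.1.1 + r%:Z).
have cE t : cubic_val t r = 0 -> t.2 = - (r%:Z * q t).
  rewrite /cubic_val /q => h.
  have : t.2 = (r%:Z ^+ 3 + t.1.1 * r%:Z ^+ 2 + t.1.2 * r%:Z + t.2) -
     r%:Z * (t.1.2 + r%:Z * (t.1.1 + r%:Z)) by ring.
  by rewrite h sub0r.
apply: (atmost_fiber _ (@atmost_int_abs M) (f := q)).
  move=> t [[_ _ cN] rt]; move: cN; rewrite (cE t rt) normrN normrM ger0_norm // => h.
  have : (r * absz (q t) <= N)%N by rewrite -lez_nat PoszM; lia.
  by rewrite mulnC -leq_divRL // -lez_nat; lia.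
move=> v _.
have lo_hi : (v + N%:Z + 1 <= (v - N%:Z) + (N + N).+1%:Z)%R by lia.
pose K := ((N + N) %/ r)%N.
(* The ceiling of (v - N) / r, the least admissible p. *)
pose lo : int := - ((N%:Z - v) %/ r%:Z)%Z.
apply: (@atmost_inj _ _ _ _ (fun t : int * int * int => (t.1.1 + r%:Z : int)) _ _ _
  (@atmost_range lo K.+1)).
  move=> [[a b] c] [[/= [aN bN cN] rt]]; rewrite /q /= => qE.
  have h1 := divz_eq (N%:Z - v) r%:Z.
  have h2 := modz_ge0 (N%:Z - v) rz.
  have h3 := @ltz_pmod (N%:Z - v) r%:Z _; have {}h3 := h3 ltac:(lia).
  have k1 : (N + N < K.+1 * r)%N by rewrite /K -ltn_divLR.
  rewrite /lo; move: (_ %/ _)%Z (_ %% _)%Z h1 h2 h3 => d e h1 h2 h3.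
  have b1 : r%:Z * (a + r%:Z) = v - b by rewrite -qE; ring.
  move: b1; move: (a + r%:Z) => p b1.
  have {}bN : - N%:Z <= b <= N%:Z by move: bN => /=; lia.
  have k2 : N%:Z + N%:Z < K.+1%:Z * r%:Z by rewrite -PoszM -PoszD ltz_nat.
  have r1 : 0 < r%:Z by lia.
  apply/andP; split.
    rewrite -ltzD1 -(ltr_pM2l r1); have -> : r%:Z * - d = e - (N%:Z - v) by rewrite h1; ring.
    by rewrite mulrDr b1; lia.
  rewrite -(ltr_pM2l r1) b1.
  have -> : r%:Z * (- d + K.+1%:Z) = e - (N%:Z - v) + K.+1%:Z * r%:Z by rewrite h1; ring.
  lia.
move=> [[a b] c] [[a' b'] c'] [[_ rt] qE] [[_ rt'] qE'] /= /addIr eqa.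
have := cE _ rt; have := cE _ rt'; rewrite qE qE' /= => -> ->.
move: qE qE'; rewrite /q /= eqa => <- /addIr ->.
by [].
Qed.

(** For these [r] the bound on [a = p - r] holds automatically, so q and p range freely; an interval
    of length 2 N / r contains at least (N + N) %/ r integers. For r = 1 the bound on [a] does cut,
    and the count is only 3 N^2 + O(N). *)
Lemma root_count_lower (N r : nat) : (1 < r)%N -> (4 * r <= N)%N ->
  ((N %/ r + N %/ r).+1 * ((N + N) %/ r) <= root_count N r)%N.
Proof.
move=> r1 rN; apply: root_count_ge; set M := (N %/ r)%N; set K := ((N + N) %/ r)%N.
have rz : r%:Z != 0 by lia.
have r0 : 0 < r%:Z by lia.
pose f (z : int * int) : int * int * int :=
  let p := z.2 - ((N%:Z - z.1) %/ r%:Z)%Z in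
  (p - r%:Z, z.1 - r%:Z * p, - (r%:Z * z.1)).
have Ql := atleast_pair (atleast_range (- M%:Z) (M + M).+1) (atleast_range 0 K).
apply: (atleast_inj _ _ (f := f) Ql); last first.
  move=> [q j] [q' j'] _ _; rewrite /f /=.
  case=> e _ /oppr_inj /(mulfI rz) eq; move: e; rewrite eq => /addIr /addIr ->.
  by [].
move=> [q j] [/= /andP[q1 q2] /andP[j0 jK]]; rewrite /f /=.
have h1 := divz_eq (N%:Z - q) r%:Z.
have h2 := modz_ge0 (N%:Z - q) rz.
have h3 := @ltz_pmod (N%:Z - q) r%:Z r0.
move: (_ %/ _)%Z (_ %% _)%Z h1 h2 h3 => d e h1 h2 h3.
set p := j - d.
have Mr : M%:Z * r%:Z <= N%:Z by rewrite -PoszM lez_nat leq_trunc_div.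
have Kr : K%:Z * r%:Z <= N%:Z + N%:Z by rewrite -PoszM -PoszD lez_nat leq_trunc_div.
have jr : 0 <= r%:Z * j by rewrite mulr_ge0 // ltW.
have jr2 : r%:Z * j <= N%:Z + N%:Z - r%:Z.
  have : r%:Z * (j + 1) <= r%:Z * K%:Z by rewrite ler_pM2l //; lia.
  rewrite mulrDr mulr1 [_ * K%:Z]mulrC; lia.
have rpE : r%:Z * p = r%:Z * j - (N%:Z - q) + e by rewrite h1 /p; ring.
have qr : `|r%:Z * q| <= N%:Z.
  rewrite normrM ger0_norm // ; apply: le_trans Mr; rewrite mulrC ler_pM2r //; lia.
have rr : r%:Z * (4 * r%:Z) <= r%:Z * N%:Z by rewrite ler_pM2l //; lia.
have rN2 : 2 * N%:Z <= r%:Z * N%:Z by rewrite ler_wpM2r //; lia.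
have M2 : 2 * M%:Z <= N%:Z.
  by apply: le_trans Mr; rewrite mulrC ler_wpM2l //; lia.
(* In the lower bound, |r p| <= N + M <= 3 N / 2 <= 3 r N / 4 by r >= 2, and r^2 <= r N / 4 by 4 r
   <= N; together they give r N. *)
have pN : - N%:Z <= p - r%:Z <= N%:Z.
  rewrite -(ler_pM2l r0) -(ler_pM2l r0 _ N%:Z) mulrN mulrBr rpE; apply/andP; split; last first.
    have : 0 <= r%:Z * r%:Z by rewrite mulr_ge0 // ltW.
    lia.
  lia.
split; last by rewrite /cubic_val /=; ring.
split; rewrite /= ?normrN //; first by lia.
by rewrite rpE; lia.
Qed.

(** * Comparing the counts *)


Definition non_S3 (t : int * int * int) : bool :=
  ~~ `[< gal_isog_Sn 3 (monic_of 3 [:: t.1.1; t.1.2; t.2]) >].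

Definition tuple_triple (N : nat) (a : 3.-tuple 'I_(N + N).+1) : int * int * int :=
  ((tnth a ord0)%:Z - N%:Z, (tnth a (inord 1))%:Z - N%:Z, (tnth a (inord 2))%:Z - N%:Z).

Lemma tuple3E T (a : 3.-tuple T) :
  tval a = [:: tnth a ord0; tnth a (inord 1); tnth a (inord 2)].
Proof.
case: a => -[|x [|y [|z [|]]]] // sz.
by rewrite !(tnth_nth x) /= !inordK.
Qed.

Lemma perm_tuple_triple N : perm_eq [seq tuple_triple a | a <- enum {:3.-tuple 'I_(N + N).+1}] (box_seq N).
Proof.
apply: uniq_perm; last 1 first.
- move=> [[a b] c]; apply/mapP/idP => [[u _ ->]|/mem_box_seq[/= aN bN cN]].
    apply/mem_box_seq; split=> /=; [move: (tnth u ord0)|move: (tnth u (inord 1))|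
      move: (tnth u (inord 2))] => -[i /= hi]; lia.
  have e (x : int) : `|x| <= N%:Z -> exists i : 'I_(N + N).+1, x = (i : nat)%:Z - N%:Z.
    move=> xN; have h : (absz (x + N%:Z)%R < (N + N).+1)%N by lia.
    by exists (Ordinal h) => /=; lia.
  have [i ->] := e a aN; have [j ->] := e b bN; have [k ->] := e c cN.
  exists [tuple i; j; k]; first by rewrite mem_enum.
  by rewrite /tuple_triple !(tnth_nth i) /= !inordK.
- rewrite map_inj_uniq ?enum_uniq // => u v; rewrite /tuple_triple => -[e0 e1 e2].
  apply: val_inj; rewrite /= (tuple3E u) (tuple3E v).
  by congr [:: _; _; _]; apply: val_inj => /=; lia.
exact: box_seq_uniq.
Qed.

Lemma E_count_box (R : realType) (H : R) :
  E_count 3 H = count non_S3 (box_seq (Num.truncn H)).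
Proof.
rewrite /E_count; set N := Num.truncn H.
rewrite -(seq.permP (perm_tuple_triple N)) count_map [LHS]cardsE [LHS]cardE.
rewrite [in LHS]/enum_mem -[in LHS]enumT size_filter.
by apply: eq_count => a; rewrite /= unfold_in /non_S3 /tuple_triple /= {1}(tuple3E a).
Qed.

Lemma non_S3_le_roots (N : nat) t : box N t ->
  (non_S3 t <= nroots N t + `[< square_disc t >])%N.
Proof.
case: t => [[a b] c] tN; rewrite /non_S3.
case: asboolP => //= nS.
have [sq|nsq] := asboolP (square_disc (a, b, c)); first by rewrite addn1.
rewrite addn0; rewrite lt0n; apply/negP => /eqP n0; apply: nS.
apply: no_root_S3 => // r rt.
have := root_nroots tN (r := r); rewrite n0 => /(_ rt).
by [].
Qed.

(** A cubic with two distinct integer roots has at most three, an excess of 2 that its square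
    discriminant pays for. *)
Lemma roots_le_non_S3 (N : nat) t :
  (nroots N t <= non_S3 t + 2 * `[< square_disc t >])%N.
Proof.
have [->//|n0] := posnP (nroots N t).
have -> : non_S3 t = true.
  apply/negP => /asboolP; case: t n0 => [[a b] c] /nroots_gt0[r rt].
  exact: root_not_S3 rt.
have [n1|/nroots_square[n3 sq]] := leqP (nroots N t) 1.
  by apply: leq_trans n1 _.
by rewrite (asboolT sq).
Qed.

Lemma sum_nroots N : (\sum_(t <- box_seq N) nroots N t =
  \sum_(r <- irange N) root_count N r)%N.
Proof.
rewrite (eq_bigr (fun t => \sum_(r <- irange N) (cubic_val t r == 0 : nat))%N); last first.
  by move=> t _; rewrite /nroots -sum1_count big_mkcond; apply: eq_bigr => r _; case: eqP.
rewrite exchange_big; apply: eq_bigr => r _.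
by rewrite /root_count -sum1_count [RHS]big_mkcond; apply: eq_bigr => t _; case: eqP.
Qed.

Lemma sum_irange (F : int -> nat) N : (forall r, F (- r) = F r) ->
  (\sum_(r <- irange N) F r = F 0 + 2 * \sum_(k < N) F k.+1)%N.
Proof.
move=> FN; rewrite big_map -[iota 0 _]/(index_iota 0 (N + N).+1).
rewrite (big_cat_nat (n := N)) //=; last by rewrite leqW ?leq_addr.
rewrite [X in (_ + X)%N]big_nat_recl ?leq_addr // subrr addnCA; congr addn.
rewrite mul2n -addnn; congr addn.
  rewrite big_nat_rev add0n /= big_mkord; apply: eq_bigr => k _.
  rewrite -FN; congr F; have := ltn_ord k; lia.
rewrite -{1}[N]add0n big_addn addnK big_mkord; apply: eq_bigr => k _.
by congr F; lia.
Qed.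

Definition square_count (N : nat) : nat :=
  count (fun t => `[< square_disc t >]) (box_seq N).

Lemma E_count_le (N : nat) :
  (count non_S3 (box_seq N) <= \sum_(r <- irange N) root_count N r + square_count N)%N.
Proof.
rewrite -sum_nroots /square_count -!sum1_count.
rewrite [X in (X <= _)%N]big_mkcond [X in (_ <= _ + X)%N]big_mkcond -big_split /=.
rewrite big_seq [X in (_ <= X)%N]big_seq; apply: leq_sum => t /mem_box_seq tN.
have := non_S3_le_roots tN; by case: (non_S3 t) => //; case: (`[< _ >]).
Qed.

Lemma E_count_ge (N : nat) :
  (\sum_(r <- irange N) root_count N r <= count non_S3 (box_seq N) + 2 * square_count N)%N.
Proof.
rewrite -sum_nroots /square_count -!sum1_count.
rewrite [X in (_ <= X + _)%N]big_mkcond [X in (_ <= _ + 2 * X)%N]big_mkcond.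
rewrite big_distrr -big_split /=; apply: leq_sum => t _.
have := roots_le_non_S3 N t; by case: (non_S3 t); case: (`[< _ >]).
Qed.

Lemma square_count_eps (K : nat) : (0 < K)%N -> exists C, forall N s : nat,
  (0 < N)%N -> (s ^ 2 <= N < s.+1 ^ 2)%N ->
  exists2 E, (E ^ K <= C * N ^ 26)%N &
    (square_count N <= 1000 * 400 * (s.+1 * N * E))%N.
Proof.
move=> K0; have [C hC] := atmost_square_eps K0; exists C => N s N0 sN.
have [E EK h] := hC N s N0 sN; exists E => //.
apply: count_atmost; first exact: box_seq_uniq.
by apply: atmost_sub h => // t [/mem_box_seq tN /asboolP].
Qed.


Section RootCountSum.
Variable R : realType.

(** With u and v the square roots of N and N + 1, 1 = (v - u) (v + u) <= 2 v^2 (v - u). A logarithm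
    would be sharper, but the error term already has size N^(3/2). *)
Lemma harmonic_le (N : nat) : \sum_(k < N) (k.+1%:R)^-1 <= 2 * Num.sqrt N%:R :> R.
Proof.
elim: N => [|N IH]; first by rewrite big_ord0 mulr_ge0 // sqrtr_ge0.
rewrite big_ord_recr /=; apply: le_trans (lerD IH (lexx _)) _.
set u := Num.sqrt N%:R; set v := Num.sqrt N.+1%:R.
have u2 : u ^+ 2 = N%:R by rewrite sqr_sqrtr.
have v2 : v ^+ 2 = N.+1%:R by rewrite sqr_sqrtr.
have u0 : 0 <= u by apply: sqrtr_ge0.
have v1 : 1 <= v by rewrite -sqrtr1 ler_wsqrtr // ler1n.
have uv : u <= v by rewrite ler_wsqrtr // ler_nat.
have e : v ^+ 2 - u ^+ 2 = 1 by rewrite u2 v2 -natr1; ring.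
rewrite -v2 -lerBrDl -mulrBr.
have v20 : 0 < v ^+ 2 by rewrite exprn_gt0 // (lt_le_trans _ v1).
rewrite -[_^-1]mul1r ler_pdivrMr //.
nra.
Qed.

Lemma divn_bounds (a r : nat) : (0 < r)%N ->
  a%:R / r%:R - 1 <= (a %/ r)%:R :> R /\ (a %/ r)%:R <= a%:R / r%:R :> R.
Proof.
move=> r0; have r0' : 0 < r%:R :> R by rewrite ltr0n.
split; last by rewrite ler_pdivlMr // -natrM ler_nat leq_trunc_div.
rewrite lerBlDr ler_pdivrMr // natr1 -natrM ler_nat ltnW //.
by rewrite -ltn_divLR.
Qed.

Lemma root_count_approx (N r : nat) : (1 < r <= N)%N ->
  `|(root_count N r)%:R - 4 * N%:R ^+ 2 / r%:R ^+ 2| <= 16 * (N%:R / r%:R) :> R.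
Proof.
move=> /andP[r1 rN]; have r0 : (0 < r)%N by apply: ltnW.
have r0' : 0 < r%:R :> R by rewrite ltr0n.
have -> : 4 * N%:R ^+ 2 / r%:R ^+ 2 = 4 * (N%:R / r%:R) ^+ 2 :> R.
  by field; rewrite gt_eqF.
have x1 : 1 <= N%:R / r%:R :> R by rewrite ler_pdivlMr // mul1r ler_nat.
have [m1 m2] := divn_bounds N r0.
have [k1 k2] := divn_bounds (N + N) r0.
have up : (root_count N r)%:R <= (2 * (N %/ r)%:R + 1) * (((N + N) %/ r)%:R + 1) :> R.
  apply: (@le_trans _ _ (((N %/ r + N %/ r).+1 * ((N + N) %/ r).+1)%N%:R)).
    by rewrite ler_nat root_count_upper.
  by rewrite natrM -!natr1 natrD; lra.
rewrite natrD mulrDl in k1 k2.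
have M0 : 0 <= (N %/ r)%:R :> R by [].
have K0 : 0 <= ((N + N) %/ r)%:R :> R by [].
have W0 : 0 <= (root_count N r)%:R :> R by [].
have up2 : (root_count N r)%:R <= (2 * (N%:R / r%:R) + 1) * (2 * (N%:R / r%:R) + 1) :> R.
  by apply: le_trans up _; apply: ler_pM; lra.
have low : 4 * (N%:R / r%:R) ^+ 2 - 16 * (N%:R / r%:R) <= (root_count N r)%:R :> R.
  (* For N < 4 r the ratio x = N / r is at most 4, so 4 x^2 - 16 x <= 0 and the lower bound is
     trivial; the constant 16 provides for this. *)
  have [h|h] := leqP (4 * r) N; last first.
    have x4 : N%:R / r%:R <= 4 :> R by rewrite ler_pdivrMr // -natrM ler_nat ltnW.
    apply: le_trans W0; move: (N%:R / r%:R) x1 x4 => x x1 x4; nra.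
  have lo : (2 * (N %/ r)%:R + 1) * ((N + N) %/ r)%:R <= (root_count N r)%:R :> R.
    apply: (@le_trans _ _ (((N %/ r + N %/ r).+1 * ((N + N) %/ r))%N%:R)).
      by rewrite natrM -!natr1 natrD; lra.
    by rewrite ler_nat root_count_lower.
  have lo2 : (2 * (N%:R / r%:R) - 1) * (2 * (N%:R / r%:R) - 1) <=
     (2 * (N %/ r)%:R + 1) * ((N + N) %/ r)%:R :> R.
    by apply: ler_pM; lra.
  apply: le_trans (le_trans lo2 lo); move: (N%:R / r%:R) x1 => x x1; nra.
rewrite ler_norml; move: (N%:R / r%:R) x1 up2 low => x x1 up2 low.
apply/andP; split; nra.
Qed.

Lemma root_count_sum (N : nat) : (0 < N)%N ->
  `|(\sum_(r <- irange N) root_count N r)%N%:R - 8 * (pi ^+ 2 / 6 + 1 / 4) * N%:R ^+ 2|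
  <= (75 + 4 * pi ^+ 2) * (N%:R * Num.sqrt N%:R) :> R.
Proof.
move=> N0; have N1 : 1 <= N%:R :> R by rewrite ler1n.
have s1 : 1 <= Num.sqrt N%:R :> R by rewrite -[X in X <= _]sqrtr1 ler_wsqrtr.
rewrite sum_irange; last exact: root_countN.
rewrite root_count0.
(* The root 1 has 3 N^2 + 3 N cubics, N^2 short of the pattern 4 N^2 / r^2 at leading order.
   Doubling this defect for r = 1 and r = -1 and adding 4 N^2 for r = 0 leaves 2 N^2, the 1/4 of the
   main term. *)
have D : \sum_(k < N) (root_count N k.+1)%:R = - N%:R ^+ 2 + 3 * N%:R
   + 4 * N%:R ^+ 2 * sum_invsqr R N
   + \sum_(k < N | (0 < k)%N) ((root_count N k.+1)%:R - 4 * N%:R ^+ 2 / k.+1%:R ^+ 2) :> R.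
  rewrite sumrB /sum_invsqr mulr_sumr.
  case: N N0 {N1 s1} => // n _; rewrite (bigD1 ord0) //= [X in _ = _ + _ + X + _](bigD1 ord0) //=.
  have -> : \sum_(i < n.+1 | (0 < i)%N) (root_count n.+1 i.+1)%:R =
     \sum_(i < n.+1 | i != ord0) (root_count n.+1 i.+1)%:R :> R.
    by apply: eq_bigl => i; rewrite -val_eqE /= lt0n.
  have -> : \sum_(i < n.+1 | (0 < i)%N) 4 * n.+1%:R ^+ 2 / i.+1%:R ^+ 2 =
     \sum_(i < n.+1 | i != ord0) 4 * n.+1%:R ^+ 2 / i.+1%:R ^+ 2 :> R.
    by apply: eq_bigl => i; rewrite -val_eqE /= lt0n.
  rewrite root_count1 !natrD !natrM -natr1 expr1n invr1 mulr1; ring.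
have Err : `|\sum_(k < N | (0 < k)%N) ((root_count N k.+1)%:R - 4 * N%:R ^+ 2 / k.+1%:R ^+ 2)|
    <= 32 * (N%:R * Num.sqrt N%:R) :> R.
  apply: le_trans (ler_norm_sum _ _ _) _.
  apply: (@le_trans _ _ (\sum_(k < N) 16 * (N%:R / k.+1%:R))).
    rewrite [X in _ <= X](bigID (fun k : 'I_N => (0 < k)%N)) /=.
    rewrite -[X in X <= _]addr0 lerD //.
      by apply: ler_sum => k k0; apply: root_count_approx; rewrite ltnS k0 ltn_ord.
    by apply: sumr_ge0 => k _; rewrite mulr_ge0 // divr_ge0.
  rewrite -mulr_sumr -mulr_sumr; have := harmonic_le N.
  have N00 : 0 <= N%:R :> R by [].
  move: (\sum_(k < N) _) (Num.sqrt _) s1 => h s s1 hs; nra.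
have := basel R N0; rewrite natrD !natrM natr_sum D -[(N + N).+1%:R]natr1 natrD.
move: Err; set e := \sum_(k < N | _) _; set S := sum_invsqr R N.
rewrite ler_pdivlMr ?(lt_le_trans _ N1) // => Err B.
have {}B : `|8 * N%:R ^+ 2 * (S - pi ^+ 2 / 6)| <= 4 * pi ^+ 2 * N%:R :> R.
  rewrite normrM ger0_norm; last by rewrite mulr_ge0 ?sqr_ge0.
  have N00 : 0 <= N%:R :> R by [].
  have := ler_wpM2l N00 B; move: (`|_|) => w; lra.
have p0 : 0 <= pi ^+ 2 :> R by rewrite sqr_ge0.
have Ns : N%:R <= N%:R * Num.sqrt N%:R :> R by rewrite ler_peMr.
have pNs : pi ^+ 2 * N%:R <= pi ^+ 2 * (N%:R * Num.sqrt N%:R) :> R by rewrite ler_wpM2l.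
(* 75 collects 4 N + 1 from r = 0, 6 N from r = 1 and r = -1, and twice 32 from the other roots; 4
   pi^2 is the error of the Basel sum. *)
move: Err B; rewrite !ler_norml => /andP[e1 e2] /andP[b1 b2]; apply/andP; split; nra.
Qed.
End RootCountSum.


(** * Real exponents and the final estimate *)

Lemma sqrt_nat (N : nat) : exists s, (s ^ 2 <= N < s.+1 ^ 2)%N.
Proof.
have ex : exists n, (n ^ 2 <= N)%N by exists 0%N.
have bd n : (n ^ 2 <= N)%N -> (n <= N)%N.
  by apply: leq_trans; rewrite -mulnn; case: n => // n; rewrite leq_pmulr.
case: (ex_maxnP ex bd) => s sN max; exists s; rewrite sN ltnNge.
by apply/negP => /max; rewrite ltnn.
Qed.

Lemma square_count_powR (R : realType) (eps : R) : 0 < eps ->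
  exists C, 0 <= C /\ forall N : nat, (0 < N)%N ->
    (square_count N)%:R <= C * (N%:R * Num.sqrt N%:R * N%:R `^ eps).
Proof.
(* With 26 / K <= eps, the K-th root of [E ^ K <= C * N ^ 26] bounds [E] by a constant times
   N^eps. *)
move=> e0; set K := (Num.truncn (26 / eps)).+1.
have K0 : 0 < K%:R :> R by rewrite ltr0n.
have Ke : 26 / K%:R <= eps.
  rewrite ler_pdivrMr // mulrC -ler_pdivrMr //; apply/ltW.
  by have /andP[] := truncn_itv (ltW (divr_gt0 (ltr0n R 26) e0)).
have [//|C hC] := @square_count_eps K; set D : R := C%:R `^ K%:R^-1.
have D0 : 0 <= D by apply: powR_ge0.
exists ((1000 * 400) * 2 * D); split; first by rewrite !mulr_ge0.
move=> N N0; have [s sN] := sqrt_nat N; have [E EK h] := hC N s N0 sN.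
have N1 : 1 <= N%:R :> R by rewrite ler1n.
have Nge0 : 0 <= N%:R :> R by [].
have EN : E%:R <= D * N%:R `^ eps.
  have -> : E%:R = (E%:R ^+ K) `^ K%:R^-1 :> R.
    by rewrite -powR_mulrn // -powRrM divff ?powRr1 // gt_eqF.
  apply: (@le_trans _ _ ((C%:R * N%:R ^+ 26) `^ K%:R^-1)).
    apply: ge0_ler_powR; rewrite ?nnegrE ?invr_ge0 ?exprn_ge0 ?mulr_ge0 ?exprn_ge0 //.
    by rewrite -!natrX -natrM ler_nat.
  rewrite powRM ?exprn_ge0 // -/D ler_wpM2l // -powR_mulrn // -powRrM.
  by rewrite ler_powR.
have sq : s.+1%:R <= 2 * Num.sqrt N%:R :> R.
  have s1 : s%:R <= Num.sqrt N%:R :> R.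
    have /andP[s2 _] := sN.
    rewrite -[s%:R]ger0_norm // -sqrtr_sqr ler_wsqrtr // -natrX ler_nat //.
  have s2 : 1 <= Num.sqrt N%:R :> R by rewrite -[X in X <= _]sqrtr1 ler_wsqrtr.
  by rewrite -natr1; lra.
apply: (@le_trans _ _ ((1000 * 400 * (s.+1 * N * E))%N%:R)); first by rewrite ler_nat.
have h2 : s.+1%:R * N%:R * E%:R <= (2 * Num.sqrt N%:R) * N%:R * (D * N%:R `^ eps).
  by apply: ler_pM => //; [rewrite mulr_ge0 | rewrite ler_wpM2r].
rewrite (natrM _ (1000 * 400)) (natrM _ 1000) (natrM _ (s.+1 * N)) (natrM _ s.+1).
have c0 : 0 <= 1000 * 400 :> R by rewrite mulr_ge0.
apply: le_trans (ler_wpM2l c0 h2) _.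
by rewrite le_eqVlt; apply/orP; left; apply/eqP; ring.
Qed.

Lemma powR_three_halves (R : realType) (H eps : R) : 0 < H ->
  H `^ (3 / 2 + eps) = H * Num.sqrt H * H `^ eps.
Proof.
move=> H0; rewrite powRD; last by rewrite (gt_eqF H0) implybT.
congr (_ * _); rewrite (_ : 3 / 2 = 1 + 2^-1); last by field.
by rewrite powRD ?(gt_eqF H0) ?implybT // powRr1 ?powR12_sqrt ?ltW.
Qed.

Theorem theorem1p1 (R : realType) (eps : R) (heps : 0 < eps) :
  exists (C H0 : R), forall H : R, H0 <= H ->
    `| (E_count 3 H)%:R - 8 * (pi ^+ 2 / 6 + 1 / 4) * H ^+ 2 |
      <= C * H `^ (3 / 2 + eps).
Proof.
have [C [C0 hC]] := square_count_powR heps.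
set c := 8 * (pi ^+ 2 / 6 + 1 / 4).
have c0 : 0 <= c by rewrite mulr_ge0 // addr_ge0 // mulr_ge0 ?sqr_ge0 ?invr_ge0.
pose d : R := 75 + 4 * pi ^+ 2.
have d0 : 0 <= d by rewrite addr_ge0 // mulr_ge0 ?sqr_ge0.
(* [2 * C] pays for cubics with square discriminant, [d] for the sum over the roots, [2 * c] for
   replacing [N] by [H]; [H >= 1] ensures [N > 0]. *)
exists (2 * C + d + 2 * c), 1 => H H1; have H0 : 0 < H by apply: lt_le_trans H1.
rewrite E_count_box powR_three_halves //; set N := Num.truncn H.
have /andP[NH HN] := truncn_itv (ltW H0); rewrite -/N in NH HN.
have N0 : (0 < N)%N by rewrite truncn_gt0.
have := E_count_le N; have := E_count_ge N; rewrite -!(ler_nat R).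
rewrite (natrD _ (count _ _)) (natrM _ 2) (natrD _ (\sum_(r <- _) _)).
have := hC N N0; have := root_count_sum R N0; rewrite -/c -/d.
move: (\sum_(r <- _) _)%N%:R (count _ _)%:R (square_count _)%:R => T E S hT hS h1 h2.
set P := H * Num.sqrt H * H `^ eps.
have Nn : 0 <= N%:R :> R by [].
have e1 : 1 <= H `^ eps by rewrite -(powRr0 H) ler_powR // ltW.
have s1 : 1 <= Num.sqrt H by rewrite -[X in X <= _]sqrtr1 ler_wsqrtr.
have NsH : N%:R * Num.sqrt N%:R <= H * Num.sqrt H.
  by apply: ler_pM => //; [exact: sqrtr_ge0 | exact: ler_wsqrtr].
have HsP : H * Num.sqrt H <= P by rewrite ler_peMr // mulr_ge0 ?sqrtr_ge0 // ltW.
have HP : H <= P by apply: le_trans HsP; rewrite ler_peMr // ltW.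
have SP : S <= C * P.
  apply: le_trans hS _; rewrite ler_wpM2l //; apply: ler_pM => //.
  - by rewrite mulr_ge0 ?sqrtr_ge0.
  - exact: powR_ge0.
  - by apply: ge0_ler_powR; rewrite ?nnegrE // ltW.
have TP : `|T - c * N%:R ^+ 2| <= d * P.
  by apply: le_trans hT _; rewrite ler_wpM2l // (le_trans NsH).
(* H^2 - N^2 = (H - N) (H + N) <= 2 H, since truncation loses at most 1. *)
have NP : `|c * N%:R ^+ 2 - c * H ^+ 2| <= 2 * c * P.
  rewrite -mulrBr normrM (ger0_norm c0) distrC ger0_norm; last first.
    by rewrite subr_ge0 ler_pXn2r ?nnegrE // ltW.
  apply: le_trans (_ : c * (2 * H) <= _); last by rewrite mulrCA mulrA ler_wpM2l // mulr_ge0.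
  rewrite ler_wpM2l // subr_sqr.
  have : H - N%:R <= 1 by move: HN; rewrite -natr1; lra.
  have : 0 <= H - N%:R by rewrite subr_ge0.
  move: (N%:R) Nn NH => n Nn NH a b; nra.
have -> : E - c * H ^+ 2 = (E - T) + (T - c * N%:R ^+ 2) + (c * N%:R ^+ 2 - c * H ^+ 2).
  by ring.
apply: le_trans (ler_normD _ _) _; apply: le_trans (lerD (ler_normD _ _) (lexx _)) _.
have ET : `|E - T| <= 2 * C * P.
  have S0 : 0 <= S by lra.
  by rewrite ler_norml; apply/andP; split; lra.
by rewrite mulrDl (mulrDl (2 * C) d); apply: lerD NP; apply: lerD ET TP.
Qed.
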